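(* Let $a$ be a symmetric, sub-gaussian random variable with $\mathbb{E}a^2=1$ and sub-gaussian norm $\kappa$. Let $\mathbf{a}_1,\dots,\mathbf{a}_m$ be independent random vectors in $\mathbb{R}^n$ whose coordinates are i.i.d. copies of $a$. Let $K\subseteq B_2^n$ and fix $\mathbf{x}\in K$ with $\|\mathbf{x}\|_2=1$. Let $p\in[0,1/2)$, let $\varepsilon_1,\dots,\varepsilon_m$ be i.i.d. random variables, independent of the $\mathbf{a}_i$, with $P(\varepsilon_i=1)=1-p$ and $P(\varepsilon_i=-1)=p$, and let $y_i=\varepsilon_i\,\mathrm{sign}(\langle \mathbf{a}_i,\mathbf{x}\rangle)$, $i=1,\dots,m$. Then for each $\beta>0$, with probability at least $1-4e^{-\beta^2}$, the solution $\widehat{\mathbf{x}}$ of $$\max \sum_{i=1}^m y_i\langle \mathbf{a}_i,\mathbf{x}'\rangle\quad\text{subject to}\quad \mathbf{x}'\in K$$ satisfies $$\|\mathbf{x}-\widehat{\mathbf{x}}\|_2^2\le C\Big(\kappa^3\|\mathbf{x}\|_\infty^{1/2}+\frac{\kappa}{\sqrt{m}\,(1-2p)}\big(w(K)+\beta\big)\Big),$$ where $C>0$ is an absolute constant.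
   Context: $\mathrm{sign}(t)=1$ if $t\ge 0$ and $-1$ otherwise. $B_2^n$ is the closed Euclidean unit ball of $\mathbb{R}^n$. The sub-gaussian norm of a random variable $a$ is $\kappa=\sup_{q\ge1}q^{-1/2}(\mathbb{E}|a|^q)^{1/q}$, and $a$ is sub-gaussian if this is finite. The Gaussian mean width of $K$ is $w(K)=\mathbb{E}\sup_{\mathbf{u}\in K-K}\langle \mathbf{g},\mathbf{u}\rangle$, where $\mathbf{g}$ is a standard Gaussian vector in $\mathbb{R}^n$ and $K-K=\{\mathbf{u}-\mathbf{v}:\mathbf{u},\mathbf{v}\in K\}$. *)

(* Defs.v *)
From HB Require Import structures.
From mathcomp Require Import all_boot all_order all_algebra.
From mathcomp Require Import all_classical all_reals all_analysis.
Set Implicit Arguments. Unset Strict Implicit. Unset Printing Implicit Defensive.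
Import Order.TTheory GRing.Theory Num.Theory.
Import numFieldNormedType.Exports.
Local Open Scope classical_set_scope.
Local Open Scope ring_scope.

Definition sgn {R : realType} (t : R) : R := if 0 <= t then 1 else -1.

Definition dotv {R : realType} {n : nat} (u v : 'rV[R]_n) : R :=
  \sum_(j < n) u ord0 j * v ord0 j.
Definition norm2 {R : realType} {n : nat} (v : 'rV[R]_n) : R :=
  Num.sqrt (dotv v v).
Definition normInf {R : realType} {n : nat} (v : 'rV[R]_n) : R :=
  \big[Num.max/0]_(j < n) `|v ord0 j|.

Definition minkdiff {R : realType} {n : nat} (K : set 'rV[R]_n) : set 'rV[R]_n :=
  [set w | exists u v, K u /\ K v /\ w = u - v].

(* Mutual independence of a finite family of real random variables:
   product rule for all choices of measurable sets (B i = setT covers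
   subfamilies). *)
Definition mutually_independent {d} {T : measurableType d} {R : realType}
  (P : probability T R) (I : finType) (X : I -> {RV P >-> R}) : Prop :=
  forall B : I -> set R, (forall i, measurable (B i)) ->
    P (\bigcap_(i in [set: I]) (X i @^-1` B i)) =
    (\prod_(i : I) fine (P (X i @^-1` B i)))%:E.

Definition subg_norm {R : realType} (mu : probability R R) : \bar R :=
  ereal_sup [set ((q `^ (- (2^-1)))%:E * poweR (\int[mu]_x ((`|x| `^ q)%:E))%E q^-1)%E
            | q in [set q : R | 1 <= q]].

Definition symmetric_law {R : realType} (mu : probability R R) : Prop :=
  forall B : set R, measurable B -> mu [set - x | x in B] = mu B.

Definition std_gaussian_vector {d} {T : measurableType d} {R : realType}
  (Q : probability T R) (n : nat) (G : 'I_n -> {RV Q >-> R}) : Prop :=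
  mutually_independent G /\
  forall j B, measurable B -> distribution Q (G j) B = normal_prob 0 1 B.

Definition rvec {d} {T : measurableType d} {R : realType} (P : probability T R)
  (n : nat) (X : 'I_n -> {RV P >-> R}) (w : T) : 'rV[R]_n := \row_j X j w.

(* Gaussian mean width w(K) = E sup_{u in K-K} <g,u>, computed with a
   standard Gaussian vector G on the probability space Q *)
Definition mean_width {d} {T : measurableType d} {R : realType}
  (Q : probability T R) (n : nat) (G : 'I_n -> {RV Q >-> R})
  (K : set 'rV[R]_n) : \bar R :=
  (\int[Q]_w ereal_sup ((fun u => (dotv (rvec G w) u)%:E) @` minkdiff K))%E.

(* Main.v *)
(** The objective is [<sum_i Y_i, x'>] with [Y_i = y_i a_i], so a maximizer [xh]
    satisfies [<sum_i E Y_i, x - xh> <= sup_(u in K - K) <sum_i (Y_i - E Y_i), u>].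

    Left-hand side: [E Y_i = (1 - 2 p) v] with [v = E (sgn <a, x> a)].  Replacing
    [sgn] by a smooth sign at scale [e] and integrating by parts coordinate by
    coordinate (Stein's method, exact for Gaussians and off by a third-order Taylor
    term controlled by [E a^4] here) gives [v = lam x + z] with [lam >= 1/8] and
    [|z|^2 = O(e)] for [e = kappa^3 |x|_inf^(1/2)]; completing the square turns this
    into a lower bound of order [|x - xh|^2 - O(e)].

    Right-hand side: since [Y_i = a_i] or [Y_i = - a_i], symmetrizing one row at a time
    bounds the exponential moments of the supremum by those of
    [sup <sum_i 2 r_i a_i, u>] for some deterministic signs [r_i].  The coordinates of
    [sum_i 2 r_i a_i] are independent, centered and sub-gaussian at scale
    [kappa sqrt m]; a convex function of such a variable has at most the expectation it
    has at a rescaled Gaussian, so they can be replaced by Gaussians one at a time.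
    The Gaussian exponential moments follow from the Prekopa-Leindler inequality, and
    Markov's inequality concludes. *)
Require Import Defs.
From HB Require Import structures.
From mathcomp Require Import all_boot all_order all_algebra.
From mathcomp Require Import all_classical all_reals all_analysis.
From mathcomp Require Import measurable_realfun.
From mathcomp Require Import ring lra.
Set Implicit Arguments. Unset Strict Implicit. Unset Printing Implicit Defensive.
Import Order.TTheory GRing.Theory Num.Theory.
Import numFieldNormedType.Exports.
Local Open Scope classical_set_scope.
Local Open Scope ring_scope.

(** * Independence and iterated integrals *)

(** The scale [e] balances two errors. Smoothing costs [O(e)]; the Taylor remainder is
    [del = 2 M |x|_inf^2 / e^3] with [M = 16 kappa^4], and [e = kappa^3 |x|_inf^(1/2)] turns it into
    [32 e / kappa^8], again [O(e)] because unit variance forces [kappa^2 >= 1/2]. When [e > 1/8] the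
    claim follows from [|x - xh| <= 2]. The arctangent is the smooth sign of choice:
    [(sgn - smooth_sgn)^2] is at most [4 e] times the derivative of [smooth_sgn], and Stein's
    identity itself bounds the mean of that derivative by [1 + del].

    The signs [r_i] can be deterministic because an average over two signs is at most its larger
    term; everything then stays on the given probability space. The set [K] is arbitrary, so the
    supremum over [K - K] is treated as a Lipschitz function, and one event serves all maximizers.
    The Gaussian vector lives on an unrelated space, hence the comparison is between integrals, one
    coordinate at a time. *)

Section pushforward.
Context d d' {T : measurableType d} {T' : measurableType d'} {R : realType}
  (P : probability T R).

Lemma integral_distributionT (X : {RV P >-> T'}) (f : T' -> \bar R) :
  measurable_fun [set: T'] f -> (\int[distribution P X]_y f y = \int[P]_x f (X x))%E.
Proof.
move=> mf; rewrite integralE [RHS]integralE.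
have -> : (fun x => f (X x)) = f \o X by [].
rewrite (funepos_comp f X) (funeneg_comp f X).
rewrite !ge0_integral_distribution//;
  by [exact: measurable_funeneg|exact: measurable_funepos].
Qed.
End pushforward.

Section independence.
Context d (T : measurableType d) (R : realType) (P : probability T R).
Context (I : finType) (X : I -> {RV P >-> R}).

Definition cyl (B : I -> set R) : set T :=
  \bigcap_(i in [set: I]) (X i @^-1` B i).

Definition cylinders (J : {set I}) : set (set T) :=
  [set A | exists B : I -> set R, [/\ forall i, measurable (B i),
     forall i, i \notin J -> B i = setT & A = cyl B]].

(** The points of [T] with the smaller sigma-algebra generated by the [X i], [i \in J].
    Measurability on this type encodes that a function depends only on the block [J]. *)
Definition sub_space (J : {set I}) := g_sigma_algebraType (cylinders J).

Lemma cyl_measurable (B : I -> set R) : (forall i, measurable (B i)) -> measurable (cyl B).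
Proof.
move=> mB; apply: fin_bigcap_measurable; first exact: finite_finset.
by move=> i _; rewrite -[X in measurable X]setTI; exact: measurable_funP.
Qed.

Lemma cylinders_setT J : cylinders J setT.
Proof.
exists (fun=> setT); split => //.
by apply/seteqP; split.
Qed.

Lemma cylinders_setI J : setI_closed (cylinders J).
Proof.
move=> _ _ [B [mB BJ ->]] [C [mC CJ ->]].
exists (fun i => B i `&` C i); split.
- by move=> i; exact: measurableI.
- by move=> i iJ; rewrite BJ// CJ// setTI.
- by apply/seteqP; split=> [w [h1 h2] i _|w h]; [split; [exact: h1|exact: h2]
  | split=> i _; have [] := h i Logic.I].
Qed.

Lemma sub_space_measurable J (A : set T) :
  measurable (A : set (sub_space J)) -> measurable A.
Proof.
have : <<s cylinders J >> `<=` (measurable : set (set T)).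
  apply: smallest_sub; first exact: sigma_algebra_measurable.
  by move=> _ [B [mB _ ->]]; exact: cyl_measurable.
by apply.
Qed.

Definition to_sub J : T -> sub_space J := id.

Lemma to_sub_measurable J : measurable_fun setT (@to_sub J).
Proof.
by move=> _ A mA; rewrite setTI; exact: (@sub_space_measurable J).
Qed.

HB.instance Definition _ J :=
  isMeasurableFun.Build _ _ _ _ (@to_sub J) (@to_sub_measurable J).

Lemma sub_space_coord (J : {set I}) i : i \in J ->
  measurable_fun setT (X i : sub_space J -> R).
Proof.
move=> iJ _ B mB; rewrite setTI; apply: sub_sigma_algebra.
exists (fun k => if k == i then B else setT); split.
- by move=> k; case: ifP.
- by move=> k kJ; case: eqP => // ki; rewrite -ki (negbTE kJ) in iJ.
- apply/seteqP; split=> [w h k _ /=|w /(_ i Logic.I)/=].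
    by case: eqP => // ->.
  by rewrite eqxx.
Qed.

Lemma measurable_coord_fst (J J' : {set I}) i : i \in J ->
  measurable_fun setT (fun z : sub_space J * sub_space J' => X i z.1).
Proof. by move=> /sub_space_coord h; apply: (measurableT_comp h); exact: measurable_fst. Qed.

Lemma measurable_coord_snd (J J' : {set I}) i : i \in J' ->
  measurable_fun setT (fun z : sub_space J * sub_space J' => X i z.2).
Proof. by move=> /sub_space_coord h; apply: (measurableT_comp h); exact: measurable_snd. Qed.

Definition diag2 J J' : T -> sub_space J * sub_space J' := fun w => (w, w).

Lemma diag2_measurable J J' : measurable_fun setT (@diag2 J J').
Proof.
by apply/measurable_fun_pairP; split; exact: to_sub_measurable.
Qed.

HB.instance Definition _ J J' :=
  isMeasurableFun.Build _ _ _ _ (@diag2 J J') (@diag2_measurable J J').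

Hypothesis indX : mutually_independent X.

Lemma cyl_indep (J J' : {set I}) B C : (forall i, i \in J -> i \notin J') ->
  (forall i, measurable (B i)) -> (forall i, i \notin J -> B i = setT) ->
  (forall i, measurable (C i)) -> (forall i, i \notin J' -> C i = setT) ->
  P ((cyl B : set T) `&` (cyl C : set T)) = (P (cyl B) * P (cyl C))%E.
Proof.
move=> dJ mB BJ mC CJ.
have -> : cyl B `&` cyl C = cyl (fun i => B i `&` C i).
  by apply/seteqP; split=> [w [h1 h2] i _|w h]; [split; [exact: h1|exact: h2]
  | split=> i _; have [] := h i Logic.I].
have E0 D : (forall i, measurable (D i)) -> P (cyl D) = (\prod_i fine (P (X i @^-1` D i)))%:E.
  exact: indX.
rewrite !E0//; last by move=> i; exact: measurableI.
rewrite -EFinM -big_split/=; congr EFin; apply: eq_bigr => i _.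
have [iJ|iJ] := boolP (i \in J).
  rewrite (CJ i) ?setIT ?preimage_setT ?probability_setT ?mulr1//.
  exact: dJ.
by rewrite (BJ i)// setTI preimage_setT probability_setT mul1r.
Qed.

(** Uniqueness of finite measures on a pi-system, applied twice: for a fixed cylinder [C] over [J']
    the measures [P (A & C)] and [P A * P C] agree on cylinders over [J], hence for all [A]; then
    [A] is fixed and [C] varies. *)
Lemma sub_space_indep (J J' : {set I}) : (forall i, i \in J -> i \notin J') ->
  forall (A : set (sub_space J)) (B : set (sub_space J')), measurable A -> measurable B ->
  P (A `&` B) = (P A * P B)%E.
Proof.
move=> dJ A B mA mB.
have uniq K (m1 m2 : {finite_measure set T -> \bar R}) :
    (forall C, cylinders K C -> m1 C = m2 C) ->
    forall C : set (sub_space K), measurable C -> m1 C = m2 C.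
  move=> H C mC; apply: (g_sigma_algebra_measure_unique (cylinders K) _ (fun=> setT)) => //.
  - by move=> _ [D [mD _ ->]]; exact: cyl_measurable.
  - by move=> _; exact: cylinders_setT.
  - by rewrite bigcup_const.
  - exact: cylinders_setI.
  - by move=> _; rewrite ltey_eq fin_num_measure.
have scaleE (C D : set T) : measurable C ->
    mscale (NngNum (fine_ge0 (measure_ge0 P C))) P D = (P D * P C)%E.
  by move=> mC; rewrite /mscale/= fineK ?fin_num_measure// muleC.
have step1 (C : set T) : cylinders J' C -> P (A `&` C) = (P A * P C)%E.
  move=> cC; have mC : measurable C by case: cC => D [mD _ ->]; exact: cyl_measurable.
  rewrite -scaleE// -[LHS]/(mrestr P mC A); apply: (uniq J) => // _ [D [mD DJ ->]].
  rewrite -[RHS]/(mscale (NngNum (fine_ge0 (measure_ge0 P C))) P _) scaleE//.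
  rewrite -[LHS]/(P (cyl D `&` C)); case: cC => E [mE EJ ->].
  exact: (cyl_indep dJ).
have mA' : measurable (A : set T) by exact: sub_space_measurable mA.
rewrite muleC setIC -scaleE// -[LHS]/(mrestr P mA' B); apply: (uniq J') => // C cC.
rewrite -[RHS]/(mscale (NngNum (fine_ge0 (measure_ge0 P A))) P _) scaleE//.
by rewrite -[LHS]/(P (C `&` A)) setIC step1// muleC.
Qed.

(** Independence in decoupled form: under the diagonal map the two blocks see one sample point, yet
    the image law is the product law. Integrals of [f (w, w)] thereby become iterated integrals of
    [f (w, w')], the form in which independence is used from here on. *)
Lemma diag2_pushforward (J J' : {set I}) : (forall i, i \in J -> i \notin J') ->
  forall S, measurable S ->
  (distribution P (@to_sub J) \x distribution P (@to_sub J'))%E S =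
  distribution P (@diag2 J J') S.
Proof.
move=> dJ; apply: product_measure_unique => A B mA mB.
by rewrite -(sub_space_indep dJ).
Qed.

Lemma indep_ge0_integral (J J' : {set I}) (f : sub_space J * sub_space J' -> \bar R) :
  (forall i, i \in J -> i \notin J') -> measurable_fun setT f -> (forall z, 0 <= f z)%E ->
  (\int[P]_w f (w, w) = \int[P]_w \int[P]_w' f (w, w'))%E.
Proof.
move=> dJ mf f0.
transitivity (\int[distribution P (@diag2 J J')]_z f z)%E.
  by rewrite ge0_integral_distribution.
transitivity (\int[distribution P (@to_sub J) \x distribution P (@to_sub J')]_z f z)%E.
  by apply: eq_measure_integral => S mS _; exact/esym/diag2_pushforward.
rewrite fubini_tonelli1// ge0_integral_distribution//=.
- apply: eq_integral => w _; rewrite /fubini_F/= ge0_integral_distribution//.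
  by apply: measurableT_comp => //; exact: measurable_pair1.
- exact: measurable_fun_fubini_tonelli_F.
- by move=> w; exact: integral_ge0.
Qed.

Lemma indep_integrable_prod (J J' : {set I}) (f : sub_space J * sub_space J' -> R) :
  (forall i, i \in J -> i \notin J') -> measurable_fun setT f ->
  P.-integrable setT (fun w => (f (w, w))%:E) ->
  (distribution P (@to_sub J) \x distribution P (@to_sub J'))%E.-integrable
    setT (EFin \o f).
Proof.
move=> dJ mf intf.
have mf' : measurable_fun setT (EFin \o f) by exact/measurable_EFinP.
have intf' : (distribution P (@diag2 J J')).-integrable setT (EFin \o f).
  by apply: integrable_pushforward => //; exact: diag2_measurable.
apply/integrableP; split => //.
have /integrableP[_] := intf'; apply: le_lt_trans.
rewrite (eq_measure_integral (distribution P (@diag2 J J')))// => S mS _.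
exact: diag2_pushforward.
Qed.

Let fubini_sub (J J' : {set I}) (f : sub_space J * sub_space J' -> R) :
  measurable_fun setT f ->
  fubini_F (distribution P (@to_sub J')) (EFin \o f) =
  (fun w => \int[P]_w' (f (w, w'))%:E)%E.
Proof.
move=> mf; apply/funext => w; rewrite /fubini_F/= integral_distributionT//.
by apply/measurable_EFinP; apply: measurableT_comp => //; exact: measurable_pair1.
Qed.

Lemma indep_integral_measurable (J J' : {set I}) (f : sub_space J * sub_space J' -> R) :
  (forall i, i \in J -> i \notin J') -> measurable_fun setT f ->
  P.-integrable setT (fun w => (f (w, w))%:E) ->
  measurable_fun [set: T] (fun w => \int[P]_w' (f (w, w'))%:E)%E.
Proof.
move=> dJ mf intf; have := measurable_fubini_F (indep_integrable_prod dJ mf intf).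
rewrite fubini_sub// => h; exact: (measurableT_comp h (@to_sub_measurable J)).
Qed.

Lemma indep_integral (J J' : {set I}) (f : sub_space J * sub_space J' -> R) :
  (forall i, i \in J -> i \notin J') -> measurable_fun setT f ->
  P.-integrable setT (fun w => (f (w, w))%:E) ->
  (\int[P]_w (f (w, w))%:E = \int[P]_w \int[P]_w' (f (w, w'))%:E)%E.
Proof.
move=> dJ mf intf.
have mf' : measurable_fun setT (EFin \o f) by exact/measurable_EFinP.
have intf2 := indep_integrable_prod dJ mf intf.
transitivity (\int[distribution P (@diag2 J J')]_z (EFin \o f) z)%E.
  by rewrite integral_distributionT.
transitivity (\int[distribution P (@to_sub J) \x distribution P (@to_sub J')]_z (EFin \o f) z)%E.
  by apply: eq_measure_integral => S mS _; exact/esym/diag2_pushforward.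
rewrite -integral12_prod_meas1// integral_distributionT/=; last exact: (measurable_fubini_F intf2).
by rewrite fubini_sub.
Qed.
End independence.

(** * The width of K in a direction *)

Section dot_product.
Context {R : realType} {n : nat}.
Implicit Types u v w : 'rV[R]_n.

Lemma dotvC u v : dotv u v = dotv v u.
Proof. by apply: eq_bigr => j _; rewrite mulrC. Qed.

Lemma dotvDl u v w : dotv (u + v) w = dotv u w + dotv v w.
Proof. by rewrite -big_split/=; apply: eq_bigr => j _; rewrite mxE mulrDl. Qed.

Lemma dotvZl c u v : dotv (c *: u) v = c * dotv u v.
Proof. by rewrite mulr_sumr; apply: eq_bigr => j _; rewrite mxE mulrA. Qed.

Lemma dotvNl u v : dotv (- u) v = - dotv u v.
Proof. by rewrite -scaleN1r dotvZl mulN1r. Qed.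

Lemma dotvBl u v w : dotv (u - v) w = dotv u w - dotv v w.
Proof. by rewrite dotvDl dotvNl. Qed.

Lemma dotvDr u v w : dotv w (u + v) = dotv w u + dotv w v.
Proof. by rewrite dotvC dotvDl !(dotvC w). Qed.

Lemma dotvZr c u v : dotv u (c *: v) = c * dotv u v.
Proof. by rewrite dotvC dotvZl dotvC. Qed.

Lemma dotvNr u v : dotv u (- v) = - dotv u v.
Proof. by rewrite dotvC dotvNl dotvC. Qed.

Lemma dotvBr u v w : dotv w (u - v) = dotv w u - dotv w v.
Proof. by rewrite dotvDr dotvNr. Qed.

Lemma dotv0l u : dotv 0 u = 0.
Proof. by rewrite -(scale0r 0) dotvZl mul0r. Qed.

Lemma dotv_suml m (f : 'I_m -> 'rV[R]_n) u :
  dotv (\sum_i f i) u = \sum_i dotv (f i) u.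
Proof.
by elim/big_ind2 : _ => [|x ? y ? <- <-|//]; rewrite ?dotv0l ?dotvDl.
Qed.

Lemma dotvv_ge0 u : 0 <= dotv u u.
Proof. by apply: sumr_ge0 => j _; rewrite -expr2 sqr_ge0. Qed.

Lemma norm2_ge0 u : 0 <= norm2 u. Proof. exact: sqrtr_ge0. Qed.

Lemma sqr_norm2 u : norm2 u ^+ 2 = dotv u u.
Proof. by rewrite sqr_sqrtr// dotvv_ge0. Qed.

Lemma sqr_norm2B u v :
  norm2 (u - v) ^+ 2 = norm2 u ^+ 2 - 2 * dotv u v + norm2 v ^+ 2.
Proof. by rewrite !sqr_norm2 !(dotvBl, dotvBr) (dotvC v u); ring. Qed.

Lemma coord_le_norm2 u j : `|u ord0 j| <= norm2 u.
Proof.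
rewrite -(ler_pXn2r (n := 2))// ?nnegrE ?norm2_ge0// sqr_norm2 real_normK ?num_real//.
rewrite /dotv (bigD1 j)//= -expr2 lerDl.
by apply: sumr_ge0 => k _; rewrite -expr2 sqr_ge0.
Qed.

Lemma cauchy_schwarz u v : dotv u v <= norm2 u * norm2 v.
Proof.
have [v0|v0] := eqVneq (dotv v v) 0.
  have v00 : v = 0.
    apply/rowP => j; rewrite mxE; apply/eqP; rewrite -normr_le0.
    by rewrite (le_trans (coord_le_norm2 v j))// /norm2 v0 sqrtr0.
  by rewrite v00 dotvC dotv0l mulr_ge0 ?norm2_ge0.
have vgt0 : 0 < dotv v v by rewrite lt_neqAle eq_sym v0 dotvv_ge0.
have := dotvv_ge0 (u - (dotv u v / dotv v v) *: v).
rewrite !(dotvBl, dotvBr, dotvZl, dotvZr) (dotvC v u).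
set b := dotv u v; set a := dotv u u; set c := dotv v v in v0 vgt0 *.
move=> h; have {h} : 0 <= a - b ^+ 2 / c by apply: le_trans h _; rewrite le_eqVlt; apply/orP; left; apply/eqP; field.
rewrite subr_ge0 ler_pdivrMr// => bac.
rewrite (le_trans (ler_norm _))// -(ler_pXn2r (n := 2)) ?nnegrE ?mulr_ge0 ?norm2_ge0//.
by rewrite exprMn !sqr_norm2 real_normK ?num_real.
Qed.

Lemma norm2N u : norm2 (- u) = norm2 u.
Proof. by rewrite /norm2 dotvNl dotvNr opprK. Qed.

Lemma ler_norm2D u v : norm2 (u + v) <= norm2 u + norm2 v.
Proof.
rewrite -(ler_pXn2r (n := 2)) ?nnegrE ?addr_ge0 ?norm2_ge0//.
have := cauchy_schwarz u v.
by rewrite sqr_norm2 sqrrD !sqr_norm2 !(dotvDl, dotvDr) (dotvC v u); lra.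
Qed.

End dot_product.

(* A real function that is Lipschitz for the l1-distance is the supremum of the
   countable family [g q - L * |v - q|_1], [q] rational, hence measurable. *)
Section lipschitz_measurable.
Context {R : realType} {n : nat}.

Definition lip1 (L : R) (g : 'rV[R]_n -> R) :=
  forall u v, g u - g v <= L * \sum_j `|u ord0 j - v ord0 j|.

Lemma rat_approx (v : 'rV[R]_n) (e : R) : 0 < e ->
  exists q : 'rV[rat]_n, \sum_j `|v ord0 j - ratr (q ord0 j)| <= e.
Proof.
move=> e0; pose e' := e / n.+1%:R.
have e'0 : 0 < e' by rewrite divr_gt0.
have H (j : 'I_n) : {q : rat | `|v ord0 j - ratr q| <= e'}.
  apply: cid; have : v ord0 j - e' < v ord0 j + e' by lra.
  move=> /rat_in_itvoo[q]; rewrite in_itv/= => /andP[q1 q2].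
  by exists q; rewrite ler_norml; lra.
exists (\row_j sval (H j)).
apply: (@le_trans _ _ (\sum_(j < n) e')).
  by apply: ler_sum => j _; rewrite mxE; case: (H j).
rewrite sumr_const card_ord -[leLHS]mulr_natr /e' mulrAC ler_pdivrMr//.
by rewrite ler_wpM2l ?(ltW e0)// ler_nat.
Qed.

Lemma lip1_measurable d (T : measurableType d) (L : R) (g : 'rV[R]_n -> R)
    (Y : 'I_n -> T -> R) :
  0 <= L -> lip1 L g -> (forall j, measurable_fun setT (Y j)) ->
  measurable_fun setT (fun w => g (\row_j Y j w)).
Proof.
move=> L0 gL mY.
(* Enumeration of the rational vectors through their codes; integers that code nothing give the
   vector 0, which is harmless in a supremum. *)
pose q k : 'rV[R]_n := map_mx ratr (odflt 0 (unpickle k : option 'rV[rat]_n)).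
pose h k w := g (q k) - L * \sum_j `|Y j w - q k ord0 j|.
have hle k w : h k w <= g (\row_j Y j w).
  have := gL (q k) (\row_j Y j w).
  under eq_bigr do rewrite mxE distrC.
  by rewrite /h lerBlDl lerBlDr addrC.
have -> : (fun w => g (\row_j Y j w)) = (fun w => sups (h ^~ w) 0%N).
  apply/funext => w; rewrite /sups /=; apply/eqP; rewrite eq_le; apply/andP; split.
    apply/ler_addgt0Pr => e e0.
    (* Replacing the point by [q] loses [L] times the distance twice, once by the Lipschitz bound
       and once in the penalty; the added 1 keeps the denominator positive when [L = 0]. *)
    have L1 : 0 < 2 * L + 1 by lra.
    have [p hp] := @rat_approx (\row_j Y j w) (e / (2 * L + 1)) (divr_gt0 e0 L1).
    have qp : q (pickle p) = map_mx ratr p by rewrite /q pickleK.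
    have hph : h (pickle p) w <= sup (sdrop (h ^~ w) 0%N).
      apply: ub_le_sup; last by exists (pickle p).
      by exists (g (\row_j Y j w)) => _ [k _ <-].
    have hs : \sum_j `|Y j w - q (pickle p) ord0 j| <= e / (2 * L + 1).
      by apply: le_trans hp; apply: ler_sum => j _; rewrite qp !mxE.
    have hg : g (\row_j Y j w) - g (q (pickle p)) <=
        L * \sum_j `|Y j w - q (pickle p) ord0 j|.
      apply: le_trans (gL _ _) _; rewrite ler_wpM2l//; apply: ler_sum => j _.
      by rewrite mxE.
    apply: le_trans (lerD hph (lexx e)); rewrite /h.
    move: hs hg; set s := \sum_(i < n) _; rewrite ler_pdivlMr// => hs hg.
    have s0 : 0 <= s by apply: sumr_ge0.
    have : L * s <= e / 2 by nra.
    lra.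
  apply: ge_sup; first by exists (h 0%N w); exists 0%N.
  by move=> _ [k _ <-].
apply: measurable_fun_sups => [w _|k].
  by exists (g (\row_j Y j w)) => _ [k _ <-].
apply: measurable_funB => //; apply: measurable_funM => //.
apply: measurable_sum => j; apply: measurableT_comp => //.
exact: measurable_funB.
Qed.

End lipschitz_measurable.

(** * Support function of [K - K] *)

Section width_function.
Context {R : realType} {n : nat} (K : set 'rV[R]_n).
Hypotheses (K0 : K !=set0) (K1 : forall v, K v -> norm2 v <= 1).
Implicit Types u v w : 'rV[R]_n.

Definition width_fun v : R := sup [set dotv v u | u in minkdiff K].

Lemma minkdiff_norm2 u : minkdiff K u -> norm2 u <= 2.
Proof.
move=> [a [b [Ka [Kb ->]]]]; apply: le_trans (ler_norm2D _ _) _.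
by rewrite norm2N; have := K1 Ka; have := K1 Kb; lra.
Qed.

Lemma minkdiff0 : minkdiff K 0.
Proof. by have [k Kk] := K0; exists k, k; rewrite subrr. Qed.

Let bnd v : has_ubound [set dotv v u | u in minkdiff K].
Proof.
exists (norm2 v * 2) => _ [u Ku <-]; apply: le_trans (cauchy_schwarz _ _) _.
by rewrite ler_wpM2l ?norm2_ge0 ?minkdiff_norm2.
Qed.

Lemma dotv_le_width v u : minkdiff K u -> dotv v u <= width_fun v.
Proof. by move=> Ku; apply: ub_le_sup (bnd v) _ _; exists u. Qed.

Lemma width_fun_le v c : (forall u, minkdiff K u -> dotv v u <= c) -> width_fun v <= c.
Proof.
move=> H; apply: ge_sup; first by exists (dotv v 0); exists 0 => //; exact: minkdiff0.
by move=> _ [u Ku <-]; exact: H.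
Qed.

Lemma width_fun_ge0 v : 0 <= width_fun v.
Proof. by have := dotv_le_width v minkdiff0; rewrite dotvC dotv0l. Qed.

Lemma width_funD v w : width_fun (v + w) <= width_fun v + width_fun w.
Proof. by apply: width_fun_le => u Ku; rewrite dotvDl lerD// dotv_le_width. Qed.

Lemma width_funZ (c : R) v : 0 <= c -> width_fun (c *: v) = c * width_fun v.
Proof.
move=> c0; apply/eqP; rewrite eq_le; apply/andP; split.
  by apply: width_fun_le => u Ku; rewrite dotvZl ler_wpM2l// dotv_le_width.
have [->|cn0] := eqVneq c 0; first by rewrite mul0r width_fun_ge0.
have {cn0}c0 : 0 < c by rewrite lt_neqAle eq_sym cn0.
rewrite mulrC -ler_pdivlMr//; apply: width_fun_le => u Ku.
by rewrite ler_pdivlMr// mulrC -dotvZl dotv_le_width.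
Qed.

Lemma width_fun_lip v w : width_fun v - width_fun w <= 2 * norm2 (v - w).
Proof.
rewrite lerBlDr; apply: width_fun_le => u Ku.
have -> : dotv v u = dotv (v - w) u + dotv w u by rewrite dotvBl subrK.
rewrite lerD ?dotv_le_width// mulrC (le_trans (cauchy_schwarz _ _))//.
by rewrite ler_wpM2l ?norm2_ge0 ?minkdiff_norm2.
Qed.

(** Both Lipschitz constants are the bound 2 on the norms in [K - K]. The Euclidean version feeds
    Gaussian concentration, this coordinatewise one feeds [lip1_measurable]. *)
Lemma width_fun_lip1 : lip1 2 width_fun.
Proof.
move=> v w; rewrite lerBlDr; apply: width_fun_le => u Ku.
have -> : dotv v u = dotv (v - w) u + dotv w u by rewrite dotvBl subrK.
rewrite lerD ?dotv_le_width// [leLHS]/dotv mulr_sumr.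
apply: ler_sum => j _; rewrite !mxE (le_trans (ler_norm _))// normrM mulrC.
by rewrite ler_wpM2r// (le_trans (coord_le_norm2 _ _))// minkdiff_norm2.
Qed.

(** Identifies the integrand of [mean_width] with the real-valued function used in the proof. *)
Lemma ereal_sup_width v :
  ereal_sup ((fun u => (dotv v u)%:E) @` minkdiff K) = (width_fun v)%:E.
Proof.
rewrite -ereal_sup_EFin; [by rewrite image_comp|exact: bnd|].
by exists (dotv v 0); exists 0 => //; exact: minkdiff0.
Qed.

End width_function.

(** * Prekopa-Leindler for the Gaussian measure *)

Section layer_cake.
Context d (T : measurableType d) (R : realType).
Variable m : {sigma_finite_measure set T -> \bar R}.
Local Notation leb := (@lebesgue_measure R).

Let reg (f : T -> R) : set (T * measurableTypeR R) := [set z | 0 < z.2 < f z.1].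

Let reg_measurable (f : T -> R) : measurable_fun setT f -> measurable (reg f).
Proof.
move=> mf; pose g1 (p : T * measurableTypeR R) := (0 < p.2)%R.
pose g2 (p : T * measurableTypeR R) := (p.2 < f p.1)%R.
rewrite [X in measurable X](_ : _ = g1 @^-1` [set true] `&` g2 @^-1` [set true]); last first.
  by apply/seteqP; split => p /=; rewrite /reg/= => /andP.
apply: measurableI.
- have : measurable_fun setT g1 by apply: measurable_fun_ltr => //; exact: measurable_snd.
  by move=> /(_ measurableT [set true]); rewrite setTI; exact.
- have : measurable_fun setT g2.
    by apply: measurable_fun_ltr; [exact: measurable_snd|exact: measurableT_comp].
  by move=> /(_ measurableT [set true]); rewrite setTI; exact.
Qed.

(** Tonelli on the region under the graph of [f]. The weight [g] plays the role of a density. *)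
Lemma layer_cake_weighted (f : T -> R) (g : T -> \bar R) :
  measurable_fun setT f -> (forall x, 0 <= f x) ->
  measurable_fun setT g -> (forall x, 0 <= g x)%E ->
  (\int[m]_x ((f x)%:E * g x) =
   \int[leb]_(s in `]0%R, +oo[) \int[m]_(x in [set x | (s < f x)%R]) g x)%E.
Proof.
move=> mf f0 mg g0.
transitivity (\int[m]_x \int[leb]_s ((\1_(reg f) (x, s))%:E * g x))%E.
  apply: eq_integral => x _.
  have mi : measurable_fun [set: measurableTypeR R] (fun s => (\1_(reg f) (x, s) : R)%:E).
    apply/(@measurable_EFinP _ (measurableTypeR R) R setT (fun s => \1_(reg f) (x, s))).
    have mi : measurable_fun setT (\1_(reg f) : T * measurableTypeR R -> R).
      by apply: measurable_indic; exact: reg_measurable.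
    by apply: (measurableT_comp mi); exact: measurable_pair1.
  rewrite ge0_integralZr//.
  congr (_ * _)%E.
  transitivity (\int[leb]_s (\1_(`]0, f x[%classic : set R) s)%:E)%E.
    rewrite integral_indic//= setIT lebesgue_measure_itv/= lte_fin.
    by have := f0 x; rewrite le_eqVlt => /predU1P[<-|->]; rewrite ?ltxx ?oppr0 ?adde0.
  apply: eq_integral => s _; congr (_%:E).
rewrite (fubini_tonelli (fun z => (\1_(reg f) z)%:E * g z.1)%E); last 2 first.
- apply: emeasurable_funM.
    by apply/measurable_EFinP; apply: measurable_indic; exact: reg_measurable.
  by apply: measurableT_comp => //; exact: measurable_fst.
- by move=> z; rewrite mule_ge0// lee_fin.
rewrite [RHS]integral_mkcond/=; apply: eq_integral => s _; rewrite patchE.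
case: ifPn => s0.
  have {}s0 : 0 < s by move: s0; rewrite inE/= in_itv/= andbT.
  rewrite [RHS]integral_mkcond; apply: eq_integral => x _; rewrite patchE indicE.
  case: ifPn => h; first by rewrite mem_set ?mul1e// /reg/= s0; move: h; rewrite inE.
  by rewrite memNset ?mul0e// /reg/= s0/= => sf; move: h; rewrite notin_setE.
rewrite integral0_eq// => x _; rewrite indicE memNset ?mul0e// /reg/= => /andP[h _].
by move: s0; rewrite notin_setE/= in_itv/= h.
Qed.

Lemma layer_cake (f : T -> R) :
  measurable_fun setT f -> (forall x, 0 <= f x) ->
  (\int[m]_x (f x)%:E = \int[leb]_(s in `]0%R, +oo[) m [set x | (s < f x)%R])%E.
Proof.
move=> mf f0; have := layer_cake_weighted mf f0 (measurable_cst 1%E) (fun=> lee01).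
under eq_integral do rewrite mule1; move=> ->.
apply: eq_integral => s _; rewrite integral_cst ?mul1e//.
have -> : [set x | s < f x] = f @^-1` `]s, +oo[.
  by apply/seteqP; split => x /=; rewrite in_itv/= andbT.
by rewrite -[X in measurable X]setTI; exact: mf.
Qed.

Lemma measurable_superlevel (f : T -> R) : measurable_fun setT f ->
  measurable_fun (`]0%R, +oo[%classic : set (measurableTypeR R))
    (fun s => m [set x | (s < f x)%R]).
Proof.
move=> mf.
apply: (@eq_measurable_fun _ _ _ _ _ (m \o ysection (reg f))).
  move=> s; rewrite inE/= in_itv/= andbT => s0; congr (m _).
  by apply/seteqP; split => x; rewrite /ysection/= inE /reg/= s0.
apply: measurable_funTS; apply: measurable_fun_ysection; exact: reg_measurable.
Qed.

End layer_cake.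

(** * Prekopa-Leindler on the line with a Gaussian majorant *)

Section gauss_prekopa_leindler.
Context {R : realType}.
Local Notation leb := (@lebesgue_measure R).
Local Notation gauss := (@normal_prob R 0 1).

(** Slicing both sides by level sets reduces the claim to the definition of [normal_prob] as the
    integral of its density over a set. *)
Lemma ge0_integral_normal_prob (f : R -> R) :
  measurable_fun setT f -> (forall x, 0 <= f x) ->
  (\int[gauss]_x (f x)%:E = \int[leb]_x (f x * normal_pdf 0 1 x)%:E)%E.
Proof.
move=> mf f0; rewrite layer_cake//.
under [RHS]eq_integral do rewrite EFinM.
rewrite (@layer_cake_weighted _ _ _ leb f (fun x => (normal_pdf 0 1 x)%:E))//.
- by apply/measurable_EFinP; exact: measurable_normal_pdf.
- by move=> x; rewrite lee_fin normal_pdf_ge0.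
Qed.

Lemma lebesgue_measure_le_itv (A : set R) (a b : R) : measurable A -> a <= b ->
  A `<=` `[a, b] -> (leb A <= (b - a)%:E)%E.
Proof.
move=> mA ab Aab; apply: (@le_trans _ _ (leb `[a, b])).
  by apply: le_measure => //; rewrite inE.
rewrite lebesgue_measure_itv/= lte_fin; case: ltP => // ba.
by rewrite lee_fin subr_ge0.
Qed.

(** The midpoints lie in a symmetric interval, so [sup A + sup B <= 2 r] and
    [inf A + inf B >= - 2 r]; the bound then holds already for the hulls of [A] and [B]. *)
Lemma brunn_minkowski_itv (A B : set R) (r : R) :
  measurable A -> measurable B -> A !=set0 -> B !=set0 ->
  (forall x y, A x -> B y -> `|(x + y) / 2| < r) ->
  (leb A + leb B <= (2 * (2 * r))%:E)%E.
Proof.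
move=> mA mB [x0 Ax0] [y0 By0] H.
have H' x y : A x -> B y -> (- (2 * r) < x + y) /\ (x + y < 2 * r).
  by move=> Ax By; have := H x y Ax By; rewrite ltr_norml => /andP[? ?]; lra.
have ubA : has_ubound A by exists (2 * r - y0) => x Ax; have := H' x y0 Ax By0; lra.
have lbA : has_lbound A by exists (- (2 * r) - y0) => x Ax; have := H' x y0 Ax By0; lra.
have ubB : has_ubound B by exists (2 * r - x0) => y By; have := H' x0 y Ax0 By; lra.
have lbB : has_lbound B by exists (- (2 * r) - x0) => y By; have := H' x0 y Ax0 By; lra.
have supAB : sup A + sup B <= 2 * r.
  rewrite -lerBrDl; apply: ge_sup; first by exists y0.
  move=> y By; rewrite lerBrDl -lerBrDr; apply: ge_sup; first by exists x0.
  by move=> x Ax; have := H' x y Ax By; lra.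
have infAB : - (2 * r) <= inf A + inf B.
  rewrite -lerBlDl; apply: lb_le_inf; first by exists y0.
  move=> y By; rewrite lerBlDl -lerBlDr; apply: lb_le_inf; first by exists x0.
  by move=> x Ax; have := H' x y Ax By; lra.
have Aitv : A `<=` `[inf A, sup A].
  by move=> x Ax; rewrite /= in_itv/= ge_inf//= ub_le_sup.
have Bitv : B `<=` `[inf B, sup B].
  by move=> x Ax; rewrite /= in_itv/= ge_inf//= ub_le_sup.
have Ale : inf A <= sup A.
  by apply: (@le_trans _ _ x0); [apply: ge_inf|apply: ub_le_sup].
have Ble : inf B <= sup B.
  by apply: (@le_trans _ _ y0); [apply: ge_inf|apply: ub_le_sup].
apply: le_trans (leeD (lebesgue_measure_le_itv mA Ale Aitv) (lebesgue_measure_le_itv mB Ble Bitv)) _.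
by rewrite -EFinD lee_fin; lra.
Qed.

Lemma superlevel_gauss (c s : R) : 0 < s -> s < c ->
  exists2 r : R, 0 <= r & forall z : R, (s < c * expR (- (z ^+ 2) / 2)) = (`|z| < r).
Proof.
move=> s0 sc; have c0 : 0 < c by exact: lt_trans sc.
exists (Num.sqrt (2 * ln (c / s))) => [|z]; first exact: sqrtr_ge0.
have ln0 : 0 < ln (c / s) by rewrite ln_gt0// ltr_pdivlMr// mul1r.
rewrite -[RHS](ltr_pXn2r (n := 2)) ?nnegrE ?sqrtr_ge0//.
rewrite sqr_sqrtr ?mulr_ge0 ?(ltW ln0)// real_normK ?num_real//.
rewrite mulrC -ltr_pdivrMr// -{1}[s / c]lnK ?posrE ?divr_gt0//.
rewrite ltr_expR -[s / c]invf_div lnV ?posrE ?divr_gt0//.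
by apply/idP/idP; lra.
Qed.

(** Level by level: with both suprema equal to 1, the sets where [U] and [V] exceed [s] are nonempty
    for exactly the same heights [s < 1], and their midpoints lie where the Gaussian exceeds [s],
    which is an interval around 0. Integrating [brunn_minkowski_itv] over [s] gives an additive
    inequality. *)
Lemma prekopa_leindler_normalized (U V : R -> R) (c : R) : 0 < c ->
  measurable_fun setT U -> measurable_fun setT V ->
  (forall x, 0 <= U x <= 1) -> (forall x, 0 <= V x <= 1) ->
  (forall s, s < 1 -> exists x, s < U x) -> (forall s, s < 1 -> exists x, s < V x) ->
  (forall x y, U x * V y <= (c * expR (- (((x + y) / 2) ^+ 2) / 2)) ^+ 2) ->
  (\int[leb]_x (U x)%:E + \int[leb]_x (V x)%:E <=
    2%:E * \int[leb]_x (c * expR (- (x ^+ 2) / 2))%:E)%E.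
Proof.
move=> c0 mU mV U01 V01 Us Vs UVH.
set H := fun x : R => c * expR (- (x ^+ 2) / 2).
have H0 x : 0 <= H x by rewrite mulr_ge0 ?expR_ge0 ?ltW.
have mH : measurable_fun setT H.
  apply: measurable_funM => //; apply: measurableT_comp => //.
  by apply: measurable_funM => //; apply: measurableT_comp => //; exact: measurable_funX.
rewrite (layer_cake leb mU) => [|x]; last by case/andP: (U01 x).
rewrite (layer_cake leb mV) => [|x]; last by case/andP: (V01 x).
rewrite (layer_cake leb mH)//.
have ml f := @measurable_superlevel _ (measurableTypeR R) R leb f.
rewrite -ge0_integralD//; [|exact: ml..].
rewrite -ge0_integralZl//; [|exact: ml].
have msup (f : R -> R) s : measurable_fun setT f -> measurable [set x | (s < f x)%R].
  move=> mf; have -> : [set x | (s < f x)%R] = f @^-1` `]s, +oo[.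
    by apply/seteqP; split => x /=; rewrite in_itv/= andbT.
  by rewrite -[X in measurable X]setTI; exact: mf.
apply: ge0_le_integral => //.
- by move=> s _; exact: adde_ge0.
- by apply: emeasurable_funD; exact: ml.
- by apply: measurable_funeM; exact: ml.
move=> s; rewrite /= in_itv/= andbT => s0.
have [s1|s1] := leP 1 s.
  have -> : [set x | s < U x] = set0.
    by rewrite -subset0 => x /=; case/andP: (U01 x) => _ h1 h2; lra.
  have -> : [set x | s < V x] = set0.
    by rewrite -subset0 => x /=; case/andP: (V01 x) => _ h1 h2; lra.
  by rewrite measure0 adde0 mule_ge0.
have [x0 Ux0] := Us s s1; have [y0 Vy0] := Vs s s1.
have sH x y : s < U x -> s < V y -> s < H ((x + y) / 2).
  move=> sU sV; rewrite -(ltr_pXn2r (n := 2)) ?nnegrE ?(ltW s0)//.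
  by apply: lt_le_trans (UVH x y); rewrite expr2; apply: ltr_pM => //; exact: ltW.
have sc : s < c.
  apply: lt_le_trans (sH _ _ Ux0 Vy0) _; rewrite /H ler_piMr ?(ltW c0)//.
  by rewrite -[leRHS]expR0 ler_expR; have := sqr_ge0 ((x0 + y0) / 2); lra.
have [r r0 rE] := superlevel_gauss s0 sc.
have -> : [set x | s < H x] = `](- r), r[%classic.
  by apply/seteqP; split => x /=; rewrite in_itv/= rE ltr_norml.
have -> : leb `](- r), r[%classic = (2 * r)%:E.
  rewrite lebesgue_measure_itv/= lte_fin; case: ltP => h; first by rewrite -EFinD; congr EFin; lra.
  by congr EFin; lra.
rewrite -EFinM; apply: brunn_minkowski_itv.
- exact: msup.
- exact: msup.
- by exists x0.
- by exists y0.
- by move=> x y /= sU sV; rewrite -rE; exact: sH.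
Qed.

End gauss_prekopa_leindler.

Section gauss_prekopa_leindler_functional.
Context {R : realType}.
Local Notation leb := (@lebesgue_measure R).
Local Notation gauss := (@normal_prob R 0 1).

Lemma std_normal_pdfE (x : R) :
  normal_pdf 0 1 x = normal_peak 1 * expR (- (x ^+ 2) / 2).
Proof. by rewrite normal_pdfE ?oner_eq0// /normal_fun subr0 expr1n. Qed.

Lemma std_normal_peak_gt0 : 0 < normal_peak 1 :> R.
Proof. by rewrite normal_peak_gt0// oner_eq0. Qed.

(** The functions [U] and [V] carry the Gaussian density; after division by their suprema [M] and
    [N] the normalized inequality reads [a / M + b / N <= 2 / sqrt (M N)] for the two integrals, and
    the arithmetic-geometric mean inequality yields [a b <= 1]. *)
Let real_case (u v : R -> R) :
  measurable_fun setT u -> measurable_fun setT v ->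
  (forall x, 0 <= u x) -> (forall x, 0 <= v x) ->
  (exists x, 0 < u x) -> (exists x, 0 < v x) ->
  (forall x y, u x * v y <= expR ((x - y) ^+ 2 / 4)) ->
  (\int[gauss]_x (u x)%:E * \int[gauss]_x (v x)%:E <= 1)%E.
Proof.
move=> mu mv u0 v0 [x0 ux0] [y0 vy0] uv.
have pk0 := std_normal_peak_gt0; set pk := normal_peak 1 in pk0.
have pdf0 x : 0 < normal_pdf 0 1 x :> R by rewrite std_normal_pdfE mulr_gt0 ?expR_gt0.
pose U x := u x * normal_pdf 0 1 x; pose V x := v x * normal_pdf 0 1 x.
have mU : measurable_fun setT U by apply: measurable_funM => //; exact: measurable_normal_pdf.
have mV : measurable_fun setT V by apply: measurable_funM => //; exact: measurable_normal_pdf.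
have U0 x : 0 <= U x by rewrite mulr_ge0// ltW.
have V0 x : 0 <= V x by rewrite mulr_ge0// ltW.
have Ux0 : 0 < U x0 by rewrite mulr_gt0.
have Vy0 : 0 < V y0 by rewrite mulr_gt0.
(* By the parallelogram identity [x^2 / 2 + y^2 / 2 = (x - y)^2 / 4 + ((x + y) / 2)^2], the growth
   allowed for [u x * v y] is exactly what the two densities leave over. *)
have UV x y : U x * V y <= (pk * expR (- (((x + y) / 2) ^+ 2) / 2)) ^+ 2.
  rewrite /U /V !std_normal_pdfE -/pk.
  have -> : u x * (pk * expR (- x ^+ 2 / 2)) * (v y * (pk * expR (- y ^+ 2 / 2))) =
    (u x * v y) * (pk ^+ 2 * (expR (- x ^+ 2 / 2) * expR (- y ^+ 2 / 2))) by ring.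
  have -> : (pk * expR (- ((x + y) / 2) ^+ 2 / 2)) ^+ 2 =
    expR ((x - y) ^+ 2 / 4) * (pk ^+ 2 * (expR (- x ^+ 2 / 2) * expR (- y ^+ 2 / 2))).
    rewrite exprMn -expRM_natl [RHS]mulrCA -!expRD; congr (_ * expR _).
    by field.
  by apply: ler_wpM2r => //; rewrite !mulr_ge0 ?expR_ge0 ?(ltW pk0).
have UVpk x y : U x * V y <= pk ^+ 2.
  apply: le_trans (UV x y) _; rewrite ler_pXn2r ?nnegrE ?mulr_ge0 ?expR_ge0 ?(ltW pk0)//.
  rewrite ler_piMr ?(ltW pk0)// -[leRHS]expR0 ler_expR.
  by have := sqr_ge0 ((x + y) / 2); lra.
(* One positive value of [V] bounds all of [U], and conversely. *)
have ubU : has_ubound (range U).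
  by exists (pk ^+ 2 / V y0) => _ [x _ <-]; rewrite ler_pdivlMr.
have ubV : has_ubound (range V).
  by exists (pk ^+ 2 / U x0) => _ [x _ <-]; rewrite ler_pdivlMr// mulrC.
pose M := sup (range U); pose N := sup (range V).
have UM x : U x <= M by apply: ub_le_sup => //; exists x.
have VN x : V x <= N by apply: ub_le_sup => //; exists x.
have M0 : 0 < M := lt_le_trans Ux0 (UM x0).
have N0 : 0 < N := lt_le_trans Vy0 (VN y0).
have s0 : 0 < Num.sqrt (M * N) by rewrite sqrtr_gt0 mulr_gt0.
have sE : Num.sqrt (M * N) ^+ 2 = M * N by rewrite sqr_sqrtr// ltW// mulr_gt0.
set q := Num.sqrt (M * N) in s0 sE.
have norm_sup W (L : R) : 0 < L -> L = sup (range W) -> (exists x, 0 < W x) ->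
    forall s, s < 1 -> exists x, s < L^-1 * W x.
  move=> L0 LE [x1 Wx1] s s1; have : s * L < sup (range W).
    by rewrite -LE -ltr_pdivlMr// divff ?gt_eqF.
  move=> /sup_gt[|_ [x _ <-] h]; first by exists (W x1); exists x1.
  by exists x; rewrite mulrC ltr_pdivlMr.
have : (\int[leb]_x (M^-1 * U x)%:E + \int[leb]_x (N^-1 * V x)%:E <=
    2%:E * \int[leb]_x (pk / q * expR (- (x ^+ 2) / 2))%:E)%E.
  apply: prekopa_leindler_normalized.
  - by rewrite divr_gt0.
  - exact: measurable_funM.
  - exact: measurable_funM.
  - by move=> x; rewrite mulr_ge0 ?invr_ge0 ?(ltW M0)//= mulrC ler_pdivrMr// mul1r.
  - by move=> x; rewrite mulr_ge0 ?invr_ge0 ?(ltW N0)//= mulrC ler_pdivrMr// mul1r.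
  - by apply: norm_sup => //; exists x0.
  - by apply: norm_sup => //; exists y0.
  - move=> x y; set e := expR _.
    have -> : (pk / q * e) ^+ 2 = (pk * e) ^+ 2 / (M * N).
      by rewrite -sE; field; rewrite gt_eqF.
    have -> : M^-1 * U x * (N^-1 * V y) = (U x * V y) / (M * N).
      by field; rewrite !gt_eqF.
    by rewrite ler_pM2r ?invr_gt0 ?mulr_gt0//; exact: UV.
have -> : (\int[leb]_x (pk / q * expR (- (x ^+ 2) / 2))%:E =
    (q^-1)%:E)%E.
  under eq_integral do rewrite mulrAC -std_normal_pdfE mulrC EFinM.
  rewrite ge0_integralZl//; last 2 first.
  - by move=> x _; rewrite lee_fin ltW.
  - by rewrite lee_fin invr_ge0 ltW.
    by rewrite integral_normal_pdf mule1.
  by apply/measurable_EFinP; exact: measurable_normal_pdf.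
rewrite !ge0_integral_normal_prob//.
have intZ (L : R) (W : R -> R) : 0 < L -> measurable_fun setT W -> (forall x, 0 <= W x) ->
    (\int[leb]_x (L^-1 * W x)%:E = L^-1%:E * \int[leb]_x (W x)%:E)%E.
  move=> L0 mW W0; under eq_integral do rewrite EFinM.
  rewrite ge0_integralZl//; last by rewrite lee_fin invr_ge0 ltW.
    exact/measurable_EFinP.
  by move=> x _; rewrite lee_fin.
rewrite !intZ// -/(U _).
have : (0 <= \int[leb]_x (U x)%:E)%E by apply: integral_ge0 => x _; rewrite lee_fin.
have : (0 <= \int[leb]_x (V x)%:E)%E by apply: integral_ge0 => x _; rewrite lee_fin.
rewrite -[X in (X * _ <= 1)%E]/(\int[leb]_x (U x)%:E)%E.
rewrite -[X in (_ * X <= 1)%E]/(\int[leb]_x (V x)%:E)%E.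
move: (\int[leb]_x (U x)%:E)%E (\int[leb]_x (V x)%:E)%E => [a| |] [b| |]//; last 3 first.
- by move=> _ _; rewrite gt0_muley ?lte_fin ?invr_gt0// -EFinM addye.
- by move=> _ _; rewrite gt0_muley ?lte_fin ?invr_gt0// -!EFinM addey.
- by move=> _ _; rewrite !gt0_muley ?lte_fin ?invr_gt0// -!EFinM addye.
rewrite -!EFinM -EFinD !lee_fin => b0 a0 h.
have h2 : (M^-1 * a + N^-1 * b) ^+ 2 <= 4 / (M * N).
  have -> : 4 / (M * N) = (2 * q^-1) ^+ 2.
    by rewrite exprMn exprVn sE; ring.
  by rewrite ler_pXn2r ?nnegrE ?addr_ge0 ?mulr_ge0 ?invr_ge0 ?(ltW M0) ?(ltW N0) ?(ltW s0).
have h3 : 4 * (M^-1 * a) * (N^-1 * b) <= 4 / (M * N).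
  by apply: le_trans h2; have := sqr_ge0 (M^-1 * a - N^-1 * b); nra.
move: h3; have -> : 4 * (M^-1 * a) * (N^-1 * b) = (4 / (M * N)) * (a * b).
  by field; rewrite !gt_eqF.
by rewrite -{2}[4 / _]mulr1 ler_pM2l// divr_gt0 ?mulr_gt0.
Qed.

(** In the tensorization [u] and [v] are themselves integrals, a priori infinite, and [c] is the
    cost of the coordinates not yet integrated. A positive value of one function forces the other to
    be finite everywhere. *)
Lemma gauss_prekopa_leindler (c : R) (u v : R -> \bar R) :
  measurable_fun setT u -> measurable_fun setT v ->
  (forall x, 0 <= u x)%E -> (forall x, 0 <= v x)%E ->
  (forall x y, u x * v y <= (expR ((x - y) ^+ 2 / 4 + c))%:E)%E ->
  (\int[gauss]_x u x * \int[gauss]_x v x <= (expR c)%:E)%E.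
Proof.
move=> mu mv u0 v0 uv.
have [[x0 ux0]|nu] := pselect (exists x, 0 < u x)%E; last first.
  rewrite (integral0_eq gauss) ?mul0e ?lee_fin ?expR_ge0// => x _.
  apply/eqP; rewrite eq_le u0 andbT leNgt; apply/negP => ux; apply: nu; by exists x.
have [[y0 vy0]|nv] := pselect (exists x, 0 < v x)%E; last first.
  rewrite [X in (_ * X)%E](integral0_eq gauss) ?mule0 ?lee_fin ?expR_ge0// => x _.
  apply/eqP; rewrite eq_le v0 andbT leNgt; apply/negP => vx; apply: nv; by exists x.
have ufin x : u x \is a fin_num.
  rewrite ge0_fin_numE// ltey; apply/eqP => ux; have := uv x y0.
  by rewrite ux gt0_mulye// leye_eq.
have vfin x : v x \is a fin_num.
  rewrite ge0_fin_numE// ltey; apply/eqP => vx; have := uv x0 x.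
  by rewrite vx gt0_muley// leye_eq.
have uE x : u x = ((expR c)%:E * (expR (- c) * fine (u x))%:E)%E.
  by rewrite -EFinM mulrA -expRD subrr expR0 mul1r fineK.
under eq_integral do rewrite uE.
under [X in (_ * X)%E]eq_integral do rewrite -(fineK (vfin _)).
have mfu : measurable_fun setT (fine \o u) by exact: measurableT_comp.
have mfv : measurable_fun setT (fine \o v) by exact: measurableT_comp.
have mfu' : measurable_fun setT (fun x => expR (- c) * fine (u x)) by exact: measurable_funM.
rewrite ge0_integralZl//; last 2 first.
- exact/measurable_EFinP.
- by move=> x _; rewrite lee_fin mulr_ge0 ?expR_ge0 ?fine_ge0.
rewrite -muleA -[leRHS]mule1; apply: lee_wpmul2l; first by rewrite lee_fin expR_ge0.
apply: real_case => //.
- by move=> x; rewrite mulr_ge0 ?expR_ge0 ?fine_ge0.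
- by move=> x; rewrite fine_ge0.
- by exists x0; rewrite mulr_gt0 ?expR_gt0// fine_gt0// ux0 ltey_eq ufin.
- by exists y0; rewrite fine_gt0// vy0 ltey_eq vfin.
- move=> x y; rewrite -mulrA -lee_fin.
  have := uv x y; rewrite -(fineK (ufin x)) -(fineK (vfin y)) -EFinM !lee_fin.
  rewrite expRD expRN => h; rewrite mulrC ler_pdivrMr ?expR_gt0//.
Qed.

End gauss_prekopa_leindler_functional.

(** * Convex domination by a Gaussian *)

Section convex_domination.
Context {R : realType}.
Local Notation leb := (@lebesgue_measure R).
Local Notation gauss := (@normal_prob R 0 1).

Definition gauss_tail_const : R := normal_peak 1 * expR (- 1).

Lemma gauss_tail_const_gt0 : 0 < gauss_tail_const.
Proof. by rewrite mulr_gt0 ?std_normal_peak_gt0 ?expR_gt0. Qed.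

(** Only the mass of the unit interval after [t] is kept; there the density is at least
    [normal_peak 1 * exp (- (t + 1)^2 / 2)], and [(t + 1)^2 / 2 <= t^2 + 1]. *)
Lemma gauss_tail_ge (t : R) : 0 <= t ->
  ((gauss_tail_const * expR (- t ^+ 2))%:E <= gauss [set x | (t < x)%R])%E.
Proof.
move=> t0; have -> : [set x | t < x] = `]t, +oo[%classic.
  by apply/seteqP; split => x /=; rewrite in_itv/= andbT.
apply: (@le_trans _ _ (gauss `]t, (t + 1)%R[%classic)).
  have -> : (gauss_tail_const * expR (- t ^+ 2))%:E =
      (\int[leb]_(x in `]t, (t + 1)%R[) (gauss_tail_const * expR (- t ^+ 2))%:E)%E.
    rewrite integral_cst//= lebesgue_measure_itv/= lte_fin ltrDl ltr01 -EFinD.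
    by rewrite -EFinM; congr EFin; ring.
  apply: ge0_le_integral => //.
  - by move=> x _; rewrite lee_fin mulr_ge0 ?expR_ge0 ?ltW ?gauss_tail_const_gt0.
  - by apply/measurable_EFinP/measurable_funTS; exact: measurable_normal_pdf.
  move=> x; rewrite /= in_itv/= => /andP[tx xt].
  rewrite lee_fin std_normal_pdfE /gauss_tail_const -mulrA ler_pM2l ?std_normal_peak_gt0//.
  have x2 : x ^+ 2 <= (t + 1) ^+ 2 by rewrite ler_pXn2r ?nnegrE//; lra.
  by rewrite -expRD ler_expR; have := sqr_ge0 (t - 1); nra.
apply: le_measure; rewrite ?inE//.
by move=> x /=; rewrite !in_itv/= andbT => /andP[].
Qed.

Lemma ge0_integral_gaussN (f : R -> R) :
  measurable_fun setT f -> (forall x, 0 <= f x) ->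
  (\int[gauss]_x (f (- x))%:E = \int[gauss]_x (f x)%:E)%E.
Proof.
move=> mf f0; rewrite !ge0_integral_normal_prob//; last first.
  by apply: measurableT_comp.
have pdfN x : normal_pdf 0 1 (- x) = normal_pdf 0 1 x :> R by rewrite !std_normal_pdfE sqrrN.
under eq_integral do rewrite -pdfN.
have mpdf : measurable_fun setT (fun x : R => f x * normal_pdf 0 1 x).
  by apply: measurable_funM => //; exact: measurable_normal_pdf.
transitivity (\int[pushforward leb (-%R : _ -> measurableTypeR R)]_x
    (f x * normal_pdf 0 1 x)%:E)%E.
  rewrite ge0_integral_pushforward//; first exact/measurable_EFinP.
  by move=> x _; rewrite lee_fin mulr_ge0 ?normal_pdf_ge0.
by apply: eq_measure_integral => A mA _; exact: lebesgue_measureN.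
Qed.

Definition convex_real (psi : R -> R) := forall s t a : R, 0 <= a <= 1 ->
  psi (a * s + (1 - a) * t) <= a * psi s + (1 - a) * psi t.

(** The slope is the supremum of the difference quotients from the left, which convexity bounds by
    every quotient from the right. *)
Lemma convex_subgradient0 (psi : R -> R) : convex_real psi ->
  exists c, forall t, psi 0 + c * t <= psi t.
Proof.
move=> cpsi; pose S := [set (psi 0 - psi (- s)) / s | s in [set s : R | 0 < s]].
have SB s t : 0 < s -> 0 < t -> (psi 0 - psi (- s)) / s <= (psi t - psi 0) / t.
  move=> s0 t0; have st0 : 0 < s + t by rewrite addr_gt0.
  have := @cpsi (- s) t (t / (s + t)).
  rewrite divr_ge0 ?(ltW t0) ?(ltW st0)//= ler_pdivrMr// mul1r lerDr (ltW s0) => /(_ isT).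
  have -> : t / (s + t) * - s + (1 - t / (s + t)) * t = 0 by field; rewrite gt_eqF.
  have -> : t / (s + t) * psi (- s) + (1 - t / (s + t)) * psi t =
    (t * psi (- s) + s * psi t) / (s + t) by field; rewrite gt_eqF.
  rewrite ler_pdivlMr// ler_pdivrMr// mulrAC ler_pdivlMr//; lra.
have S0 : S !=set0 by exists ((psi 0 - psi (- 1)) / 1); exists 1 => //=; exact: ltr01.
have SU : has_ubound S.
  by exists ((psi 1 - psi 0) / 1) => _ [s s0 <-]; exact: SB.
exists (sup S) => t; have [t0|t0|<-] := ltgtP 0 t; last by rewrite mulr0 addr0.
  have : sup S <= (psi t - psi 0) / t.
    by apply: ge_sup => // _ [s s0 <-]; exact: SB.
  by rewrite ler_pdivlMr//; lra.
have : (psi 0 - psi t) / - t <= sup S.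
  by apply: ub_le_sup => //; exists (- t); rewrite ?opprK//= oppr_gt0.
by rewrite ler_pdivrMr ?oppr_gt0//; lra.
Qed.

Section tail_domination.
Context d (T : measurableType d) (P : probability T R).
Variables (Z : {RV P >-> R}) (sigma : R).
Hypotheses (sigma0 : 0 < sigma)
  (tailZ : forall t : R, 0 <= t ->
    (P [set w | (t <= `|Z w|)%R] <= (2 * expR (- (t / sigma) ^+ 2))%:E)%E).

Definition domination_const : R := 2 / gauss_tail_const.

(** Level by level: for [f] even and nondecreasing on the half-line, [f (Z) > s] implies
    [|Z| >= inf S], while every [x > inf S / sigma] satisfies [f (sigma * x) > s]. The constant is
    the ratio between the assumed tail of [Z] and the lower bound on the Gaussian tail. *)
Lemma tail_domination (f : R -> R) : measurable_fun setT f ->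
  (forall t, 0 <= f t) -> (forall t, f (- t) = f t) ->
  (forall s t, 0 <= s -> s <= t -> f s <= f t) ->
  (\int[P]_w (f (Z w))%:E <= domination_const%:E * \int[gauss]_x (f (sigma * x))%:E)%E.
Proof.
move=> mf f0 fN fmono.
have K0 : 0 < domination_const by rewrite divr_gt0 ?gauss_tail_const_gt0.
have mfZ : measurable_fun setT (fun w => f (Z w)) by exact: measurableT_comp.
have mfs : measurable_fun setT (fun x : R => f (sigma * x)).
  by apply: measurableT_comp => //; exact: measurable_funM.
rewrite layer_cake// layer_cake// -ge0_integralZl//; last 2 first.
- exact: measurable_superlevel.
- by rewrite lee_fin ltW.
have msup d1 (T1 : measurableType d1) (g : T1 -> R) s :
    measurable_fun setT g -> measurable [set x | (s < g x)%R].
  move=> mg; have -> : [set x | (s < g x)%R] = g @^-1` `]s, +oo[.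
    by apply/seteqP; split => x /=; rewrite in_itv/= andbT.
  by rewrite -[X in measurable X]setTI; exact: mg.
apply: ge0_le_integral => //.
- exact: measurable_superlevel.
- by apply: measurable_funeM; exact: measurable_superlevel.
move=> s; rewrite /= in_itv/= andbT => s0.
have fabs t : f `|t| = f t by case: ger0P => // _; rewrite fN.
pose S := [set t : R | 0 <= t /\ s < f t].
have [[t0 St0]|nS] := pselect (exists t, S t); last first.
  have -> : [set x | (s < f (Z x))%R] = set0.
    rewrite -subset0 => w /= h; apply: nS; exists `|Z w|; split => //=.
    by rewrite fabs.
  by rewrite measure0 mule_ge0// lee_fin ltW.
have lbS : has_lbound S by exists 0 => t [].
have tau0 : 0 <= inf S by apply: lb_le_inf; [exists t0|move=> t []].
apply: (@le_trans _ _ (P [set w | (inf S <= `|Z w|)%R])).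
  apply: le_measure; rewrite ?inE; first exact: msup.
    have -> : [set w | (inf S <= `|Z w|)%R] = (fun w => `|Z w|) @^-1` `[inf S, +oo[.
      by apply/seteqP; split => x /=; rewrite in_itv/= andbT.
    rewrite -[X in measurable X]setTI.
    have mZ : measurable_fun setT (fun w => `|Z w|) by exact: measurableT_comp.
    exact: mZ.
  by move=> w /= h; apply: ge_inf => //; split => //; rewrite fabs.
apply: le_trans (tailZ tau0) _.
have ts0 : 0 <= inf S / sigma by rewrite divr_ge0// ltW.
apply: (@le_trans _ _ (domination_const%:E * gauss [set x | (inf S / sigma < x)%R])%E).
  apply: le_trans (lee_wpmul2l _ (gauss_tail_ge ts0)); last by rewrite lee_fin ltW.
  rewrite -EFinM lee_fin /domination_const mulrA divfK ?gt_eqF//.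
  exact: gauss_tail_const_gt0.
apply: lee_wpmul2l; first by rewrite lee_fin ltW.
apply: le_measure; rewrite ?inE; [exact: msup|exact: msup|].
move=> x /=; rewrite ltr_pdivrMr// mulrC => h.
have [t [t1 t2] t3] : exists2 t, S t & t < sigma * x.
  have [] := @inf_adherent _ S (sigma * x - inf S); first by rewrite subr_gt0.
    by split => //; exists t0.
  by move=> t St; rewrite addrCA subrr addr0 => h2; exists t.
by apply: lt_le_trans t2 (fmono _ _ t1 (ltW t3)).
Qed.

Lemma domination_const_ge1 : 1 <= domination_const.
Proof.
rewrite ler_pdivlMr ?gauss_tail_const_gt0// mul1r /gauss_tail_const.
apply: (@le_trans _ _ 1); last by lra.
rewrite mulr_ile1 ?expR_ge0 ?normal_peak_ge0//.
rewrite /normal_peak expr1n mulr2n invf_le1; last first.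
  by rewrite sqrtr_gt0; have := pi_gt0 R; lra.
rewrite -[leLHS]sqrtr1 ler_sqrt; have := pi_ge2 R; lra.
Qed.

Hypotheses (intZ : P.-integrable setT (EFin \o Z)) (EZ : (\int[P]_w (Z w)%:E = 0)%E).

(* With [c] a subgradient of [psi] at [0] and [D t = psi t + psi (- t) - 2 psi 0],
   one has [psi t - c t - psi 0 <= D t <= D (L t) / L], so the multiplicative
   constant of the tail comparison is absorbed by the scaling [L]. *)
Lemma convex_domination (psi : R -> R) : measurable_fun setT psi ->
  (forall t, 0 <= psi t) -> convex_real psi ->
  (\int[P]_w (psi (Z w))%:E <=
   \int[gauss]_x (psi (2 * domination_const * sigma * x))%:E)%E.
Proof.
move=> mpsi psi0 cpsi; set K := domination_const; have K1 : 1 <= K := domination_const_ge1.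
(* The Gaussian mean of [D] is [2 (I - psi 0)] by symmetry; the factor 2 in [L] makes
   [K * 2 (I - psi 0) / L] exactly [I - psi 0]. *)
pose L := 2 * K; have L1 : 1 <= L by rewrite /L; lra.
have L0 : 0 < L by lra.
have [c hc] := convex_subgradient0 cpsi.
pose D (t : R) := psi t + psi (- t) - 2 * psi 0.
have D0 t : 0 <= D t by have := hc t; have := hc (- t); rewrite /D; lra.
have DN t : D (- t) = D t by rewrite /D opprK; ring.
have mpsiN : measurable_fun setT (fun t : R => psi (- t)) by exact: measurableT_comp.
have mD : measurable_fun setT D.
  by apply: measurable_funB => //; exact: measurable_funD.
(* Both [s] and [- s] are convex combinations of [t] and [- t], with the weights [a] and [1 - a]
   exchanged. *)
have Dmono s t : 0 <= s -> s <= t -> D s <= D t.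
  move=> s0; rewrite le_eqVlt => /predU1P[->//|st].
  have t0 : 0 < t := le_lt_trans s0 st.
  pose a := (s + t) / (2 * t).
  have a01 : 0 <= a <= 1.
    by rewrite /a divr_ge0 ?addr_ge0 ?mulr_ge0 ?(ltW t0)//= ler_pdivrMr ?mulr_gt0//; lra.
  have h1 := @cpsi t (- t) a a01.
  have h2 := @cpsi (- t) t a a01.
  have e1 : a * t + (1 - a) * - t = s by rewrite /a; field; rewrite gt_eqF.
  have e2 : a * - t + (1 - a) * t = - s by rewrite /a; field; rewrite gt_eqF.
  by rewrite e1 in h1; rewrite e2 in h2; rewrite /D; lra.
(* Convexity on the segments from 0 to [L t] and to [- L t], using [D 0 = 0]. *)
have DL t : D t <= L^-1 * D (L * t).
  have Li : 0 <= L^-1 <= 1 by rewrite invr_ge0 ltW//= invf_le1.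
  have h1 := @cpsi (L * t) 0 L^-1 Li; have h2 := @cpsi (- (L * t)) 0 L^-1 Li.
  move: h1 h2; rewrite !mulr0 !addr0 mulrN !mulKf ?gt_eqF// /D; nra.
have [->|fin] := eqVneq (\int[gauss]_x (psi (L * sigma * x))%:E)%E +oo%E; first exact: leey.
have intpsi0 : (0 <= \int[gauss]_x (psi (L * sigma * x))%:E)%E.
  by apply: integral_ge0 => x _; rewrite lee_fin.
have mpsis : measurable_fun setT (fun x : R => psi (L * sigma * x)).
  by apply: measurableT_comp => //; exact: measurable_funM.
have mpsisN : measurable_fun setT (fun x : R => psi (- (L * sigma * x))).
  by apply: (measurableT_comp mpsiN); exact: measurable_funM.
pose I := fine (\int[gauss]_x (psi (L * sigma * x))%:E)%E.
have IE : (\int[gauss]_x (psi (L * sigma * x))%:E = I%:E)%E.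
  by rewrite fineK// ge0_fin_numE// ltey.
have INE : (\int[gauss]_x (psi (- (L * sigma * x)))%:E = I%:E)%E.
  by rewrite -IE -(@ge0_integral_gaussN (fun x : R => psi (L * sigma * x)))//; under [RHS]eq_integral do rewrite mulrN.
have DI : (\int[gauss]_x (D (L * (sigma * x)))%:E <= (2 * I - 2 * psi 0)%:E)%E.
  have -> : (2 * I - 2 * psi 0)%:E = (I%:E + I%:E + (- (2 * psi 0))%:E)%E.
    by rewrite -!EFinD; congr EFin; ring.
  (* The subtracted constant is moved across so that additivity is applied to nonnegative integrands
     only. *)
  have h : (\int[gauss]_x (D (L * (sigma * x)))%:E + (2 * psi 0)%:E = I%:E + I%:E)%E.
    rewrite -{1}IE -INE -ge0_integralD//; last first.
    - exact/measurable_EFinP.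
    - by move=> x _; rewrite lee_fin.
    - exact/measurable_EFinP.
    - by move=> x _; rewrite lee_fin.
    have -> : ((2 * psi 0)%:E = \int[gauss]_x (2 * psi 0)%:E)%E.
      by rewrite integral_cst//= /normal_prob integral_normal_pdf mule1.
    rewrite -ge0_integralD//; last 3 first.
    - by move=> x _; rewrite lee_fin.
    - apply/measurable_EFinP; apply: measurableT_comp => //.
      by apply: measurable_funM => //; exact: measurable_funM.
    - by move=> x _; rewrite lee_fin mulr_ge0.
    by apply: eq_integral => x _; rewrite -!EFinD; congr EFin; rewrite /D !mulrA; ring.
  by rewrite -h -addeA -EFinD subrr adde0.
have DZ : (\int[P]_w (D (Z w))%:E <= (I - psi 0)%:E)%E.
  apply: (@le_trans _ _ (\int[P]_w (L^-1%:E * (D (L * Z w))%:E))%E).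
    apply: ge0_le_integral => //.
    - by move=> w _; rewrite lee_fin.
    - by apply/measurable_EFinP; exact: measurableT_comp.
    - apply: measurable_funeM; apply/measurable_EFinP; apply: measurableT_comp => //.
      exact: measurable_funM.
    - by move=> w _; rewrite -EFinM lee_fin.
  rewrite ge0_integralZl//; last 3 first.
  - apply/measurable_EFinP; apply: measurableT_comp => //; exact: measurable_funM.
  - by move=> w _; rewrite lee_fin.
  - by rewrite lee_fin invr_ge0 ltW.
  apply: (@le_trans _ _ (L^-1%:E * (K%:E * (2 * I - 2 * psi 0)%:E))%E).
    apply: lee_wpmul2l; first by rewrite lee_fin invr_ge0 ltW.
    apply: le_trans (lee_wpmul2l _ DI); last by rewrite lee_fin; lra.
    apply: (tail_domination (f := fun t : R => D (L * t))) => //.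
    - by apply: measurableT_comp => //; exact: measurable_funM.
    - by move=> t; rewrite mulrN DN.
    - by move=> s t s0 st; apply: Dmono; [exact: mulr_ge0 (ltW L0) s0|rewrite ler_pM2l].
  rewrite -!EFinM lee_fin /L le_eqVlt; apply/orP; left; apply/eqP; field.
  by rewrite gt_eqF//; lra.
have intD : P.-integrable setT (fun w => (D (Z w))%:E).
  apply/integrableP; split; first by apply/measurable_EFinP; exact: measurableT_comp.
  under eq_integral do rewrite gee0_abs ?lee_fin//.
  by apply: le_lt_trans DZ _; exact: ltry.
have intc : P.-integrable setT (fun w => (c * Z w)%:E).
  by under eq_fun do rewrite EFinM; exact: integrableZl.
have int0 : P.-integrable setT (fun=> (psi 0)%:E).
  exact: finite_measure_integrable_cst.
have mono w : (psi (Z w) <= D (Z w) + (c * Z w + psi 0)).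
  by have := hc (- Z w); rewrite /D; lra.
apply: (@le_trans _ _ (\int[P]_w (D (Z w) + (c * Z w + psi 0))%:E)%E).
  apply: ge0_le_integral => //.
  - by move=> w _; rewrite lee_fin.
  - by apply/measurable_EFinP; exact: measurableT_comp.
  - apply/measurable_EFinP; apply: measurable_funD; first exact: measurableT_comp.
    by apply: measurable_funD => //; exact: measurable_funM.
  - by move=> w _; rewrite lee_fin.
have Ec : (\int[P]_w (c * Z w)%:E = 0)%E.
  by under eq_integral do rewrite EFinM; rewrite integralZl// EZ mule0.
have Ec0 : (\int[P]_w ((c * Z w)%:E + (psi 0)%:E) = (psi 0)%:E)%E.
  by rewrite integralD// Ec add0e integral_cst//= probability_setT mule1.
under eq_integral do rewrite !EFinD.
rewrite integralD//; last by exact: integrableD.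
rewrite Ec0 IE.
by apply: le_trans (leeD DZ (lexx _)) _; rewrite -EFinD lee_fin; lra.
Qed.

End tail_domination.
End convex_domination.

(** * Gaussian concentration *)

Section jensen.
Context d (T : measurableType d) (R : realType) (P : probability T R).

Lemma jensen_expR (X : T -> R) : P.-integrable setT (EFin \o X) ->
  ((expR (fine (\int[P]_w (X w)%:E)))%:E <= \int[P]_w (expR (X w))%:E)%E.
Proof.
move=> intX; set c := fine _.
have cE : (\int[P]_w (X w)%:E = c%:E)%E by rewrite fineK// integrable_fin_num.
have mX : measurable_fun setT X by apply/measurable_EFinP; exact: measurable_int intX.
have mexp : measurable_fun setT (fun w => expR (X w)) by exact: measurableT_comp.
have [->|fin] := eqVneq (\int[P]_w (expR (X w))%:E)%E +oo%E; first exact: leey.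
have intexp : P.-integrable setT (fun w => (expR (X w))%:E).
  apply/integrableP; split; first exact/measurable_EFinP.
  by under eq_integral do rewrite gee0_abs ?lee_fin ?expR_ge0//; rewrite ltey.
have int0 : P.-integrable setT (fun=> (expR c * (1 - c))%:E).
  exact: finite_measure_integrable_cst.
have intcX : P.-integrable setT (fun w => ((expR c)%:E * (X w)%:E)%E).
  exact: integrableZl.
have <- : (\int[P]_w ((expR c)%:E * (X w)%:E + (expR c * (1 - c))%:E) = (expR c)%:E)%E.
  rewrite integralD// integralZl// cE integral_cst//= probability_setT mule1 -EFinM -EFinD.
  by congr EFin; ring.
apply: le_integral => //; first exact: integrableD.
move=> w _; rewrite -EFinM -EFinD lee_fin.
have := expR_ge1Dx (X w - c); rewrite expRD expRN ler_pdivlMr ?expR_gt0//; lra.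
Qed.

End jensen.

(** Measurability is tested by composing with measurable coordinates on an arbitrary space, so row
    vectors carry no sigma-algebra and one statement serves [P], [Q], their products and the types
    [sub_space]. *)
Definition borel_rV {R : realType} {n : nat} (g : 'rV[R]_n -> R) : Prop :=
  forall d (T : measurableType d) (Y : 'I_n -> T -> R),
    (forall j, measurable_fun setT (Y j)) ->
    measurable_fun setT (fun w => g (\row_j Y j w)).

Lemma ge0_integral_gauss_law d (T : measurableType d) (R : realType) (Q : probability T R)
    (X : {RV Q >-> R}) (f : R -> \bar R) :
  (forall B, measurable B -> distribution Q X B = normal_prob 0 1 B) ->
  measurable_fun [set: measurableTypeR R] (f : measurableTypeR R -> \bar R) ->
  (forall t, 0 <= f t)%E ->
  (\int[Q]_w f (X w) = \int[@normal_prob R 0 1]_t f t)%E.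
Proof.
move=> lawX mf f0.
have mX : measurable_fun setT (X : T -> measurableTypeR R).
  have h : measurable_fun setT X by exact: measurable_funP.
  by move=> _ A mA; exact: (h measurableT A mA).
transitivity (\int[pushforward Q (X : T -> measurableTypeR R)]_t f t)%E.
  by rewrite ge0_integral_pushforward.
by apply: eq_measure_integral => A mA _; exact: lawX.
Qed.

Section gauss_tensorization.
Context d (T : measurableType d) (R : realType) (Q : probability T R) (n : nat).
Variable G : 'I_n -> {RV Q >-> R}.
Hypothesis gaussG : std_gaussian_vector G.
Local Notation gauss := (@normal_prob R 0 1).

(** Interpolates between the fixed vector [x] at [k = 0] and the Gaussian vector at [k = n]. *)
Definition mix (k : nat) (w : T) (x : 'rV[R]_n) : 'rV[R]_n :=
  \row_j (if (j < k)%N then G j w else x ord0 j).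

Definition upd (x : 'rV[R]_n) (i : 'I_n) (t : R) : 'rV[R]_n :=
  \row_j (if j == i then t else x ord0 j).

Lemma measurable_integral_mix (u : 'rV[R]_n -> R) (k : nat) (i : 'I_n) (x : 'rV[R]_n) :
  borel_rV u -> (forall x, 0 <= u x) ->
  measurable_fun setT (fun t : R => (\int[Q]_w (u (mix k w (upd x i t)))%:E)%E).
Proof.
move=> mu u0.
have mf : measurable_fun setT (fun z : R * T => (u (mix k z.2 (upd x i z.1)))%:E).
  apply/measurable_EFinP; apply: mu => j /=; case: (j < k)%N.
    by apply: measurableT_comp => //; exact: measurable_snd.
  under eq_fun do rewrite mxE.
  by case: (j == i); [exact: measurable_fst|exact: measurable_cst].
apply: (measurable_fun_fubini_tonelli_F (m2 := Q) _ mf) => z.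
by rewrite lee_fin.
Qed.

(** Coordinate [i] is independent of the earlier ones, so it can be integrated separately against
    its normal law. *)
Lemma integral_mixS (u : 'rV[R]_n -> R) (i : 'I_n) (x : 'rV[R]_n) :
  borel_rV u -> (forall x, 0 <= u x) ->
  (\int[Q]_w (u (mix i.+1 w x))%:E =
   \int[gauss]_t \int[Q]_w (u (mix i w (upd x i t)))%:E)%E.
Proof.
move=> mu u0; have [indG lawG] := gaussG.
pose J := [set j : 'I_n | (j < i)%N]%SET.
pose f (z : sub_space G [set i]%SET * sub_space G J) : \bar R :=
  (u (\row_j (if (j < i)%N then G j z.2 else if j == i then G i z.1 else x ord0 j)))%:E.
transitivity (\int[Q]_w f (w, w))%E.
  apply: eq_integral => w _; congr ((u _)%:E); apply/rowP => j; rewrite !mxE/= ltnS leq_eqVlt orbC.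
  have -> : (val j == val i) = (j == i) by [].
  by case: ltnP => //= _; case: eqP => // ->.
rewrite indep_ge0_integral//.
- rewrite -(ge0_integral_gauss_law (lawG i)).
  + apply: eq_integral => w _; apply: eq_integral => w' _; congr ((u _)%:E).
    by apply/rowP => j; rewrite !mxE.
  + exact: measurable_integral_mix.
  + by move=> t; apply: integral_ge0 => w _; rewrite lee_fin.
- by move=> j; rewrite !inE => /eqP ->; rewrite ltnn.
- apply/measurable_EFinP; apply: mu => j /=; have [ji|ji] := boolP (j < i)%N.
    by apply: measurable_coord_snd; rewrite inE.
  case: (j == i); last exact: measurable_cst.
  by apply: measurable_coord_fst; rewrite inE.
- by move=> z; rewrite lee_fin.
Qed.

(** Induction on the number of integrated coordinates: the quadratic cost of the coordinates still
    frozen stays in the exponent, and the one-dimensional inequality removes one term of it. *)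
Lemma gauss_tensorization (u v : 'rV[R]_n -> R) :
  borel_rV u -> borel_rV v -> (forall x, 0 <= u x) -> (forall x, 0 <= v x) ->
  (forall x y, u x * v y <= expR (\sum_j (x ord0 j - y ord0 j) ^+ 2 / 4)) ->
  (\int[Q]_w (u (rvec G w))%:E * \int[Q]_w (v (rvec G w))%:E <= 1)%E.
Proof.
move=> mu mv u0 v0 uv.
have H k : (k <= n)%N -> forall x y,
    (\int[Q]_w (u (mix k w x))%:E * \int[Q]_w (v (mix k w y))%:E <=
     (expR (\sum_(j < n | (k <= j)%N) (x ord0 j - y ord0 j) ^+ 2 / 4))%:E)%E.
  elim: k => [_ x y|k IH kn x y].
    have mix0 w z : mix 0 w z = z by apply/rowP => j; rewrite mxE.
    under eq_integral do rewrite mix0; under [X in (_ * X)%E]eq_integral do rewrite mix0.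
    by rewrite !integral_cst//= probability_setT !mule1 -EFinM lee_fin.
  pose i := Ordinal kn; rewrite -[k]/(val i) !integral_mixS//.
  apply: gauss_prekopa_leindler.
  - exact: measurable_integral_mix.
  - exact: measurable_integral_mix.
  - by move=> t; apply: integral_ge0 => w _; rewrite lee_fin.
  - by move=> t; apply: integral_ge0 => w _; rewrite lee_fin.
  move=> s t; apply: le_trans (IH (ltnW kn) _ _) _; rewrite lee_fin ler_expR.
  rewrite (bigD1 i)//= !mxE eqxx lerD2l le_eqVlt; apply/orP; left; apply/eqP.
  apply: eq_big => [j|j /andP[_ ji]]; last by rewrite !mxE (negbTE ji).
  by rewrite andbC ltn_neqAle eq_sym.
have mixn w z : mix n w z = rvec G w by apply/rowP => j; rewrite !mxE ltn_ord.
have := H n (leqnn n) 0 0.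
under eq_integral do rewrite mixn; under [X in (_ * X)%E]eq_integral do rewrite mixn.
by rewrite big_pred0 ?expR0// => j; rewrite leqNgt ltn_ord.
Qed.

(** Tensorization for [u = exp (theta F - 4 theta^2)] and [v = exp (- theta F)]: at distance [r] the
    exponents add up to at most [2 theta r - 4 theta^2 <= r^2 / 4]. Jensen bounds the integral of
    [v] below by [exp (- theta W)], which leaves the bound on [u]. *)
Lemma gauss_concentration (F : 'rV[R]_n -> R) (theta W : R) :
  borel_rV F -> (forall x y, F x - F y <= 2 * norm2 (x - y)) ->
  Q.-integrable setT (fun w => (F (rvec G w))%:E) ->
  (\int[Q]_w (F (rvec G w))%:E = W%:E)%E -> 0 <= theta ->
  (\int[Q]_w (expR (theta * F (rvec G w)))%:E <= (expR (theta * W + 4 * theta ^+ 2))%:E)%E.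
Proof.
move=> mF lipF intF FW th0.
pose u x := expR (theta * F x - 4 * theta ^+ 2); pose v x := expR (- theta * F x).
have mu : borel_rV u.
  move=> d1 T1 Y mY; apply: measurableT_comp => //; apply: measurable_funB => //.
  by apply: measurable_funM => //; exact: mF.
have mv : borel_rV v.
  move=> d1 T1 Y mY; apply: measurableT_comp => //.
  by apply: measurable_funM => //; exact: mF.
have := gauss_tensorization mu mv (fun=> expR_ge0 _) (fun=> expR_ge0 _).
have uv x y : u x * v y <= expR (\sum_j (x ord0 j - y ord0 j) ^+ 2 / 4).
  rewrite -expRD ler_expR.
  have -> : \sum_j (x ord0 j - y ord0 j) ^+ 2 / 4 = norm2 (x - y) ^+ 2 / 4.
    rewrite sqr_norm2 /dotv mulr_suml; apply: eq_bigr => j _.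
    by rewrite !mxE expr2.
  have := lipF x y; have := norm2_ge0 (x - y); set r := norm2 _ => r0 h.
  have := sqr_ge0 (r / 2 - 2 * theta); nra.
move=> /(_ uv).
have mY : measurable_fun setT (fun w => F (rvec G w)) by apply: mF.
have intv : Q.-integrable setT (fun w => (- theta * F (rvec G w))%:E).
  by under eq_fun do rewrite EFinM; exact: integrableZl.
have := jensen_expR intv.
have -> : (\int[Q]_w (- theta * F (rvec G w))%:E = (- theta * W)%:E)%E.
  by under eq_integral do rewrite EFinM; rewrite integralZl// FW.
rewrite /=; set Iv := (\int[Q]_w (v _)%:E)%E => hv h.
have -> : (\int[Q]_w (expR (theta * F (rvec G w)))%:E =
    (expR (4 * theta ^+ 2))%:E * \int[Q]_w (u (rvec G w))%:E)%E.
  rewrite -ge0_integralZl//; last 2 first.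
  - by apply/measurable_EFinP; exact: mu.
  - by move=> w _; rewrite lee_fin expR_ge0.
  by apply: eq_integral => w _; rewrite -EFinM -expRD; congr ((expR _)%:E); ring.
have -> : (expR (theta * W + 4 * theta ^+ 2))%:E =
    ((expR (4 * theta ^+ 2))%:E * (expR (theta * W))%:E)%E.
  by rewrite -EFinM -expRD addrC.
apply: lee_wpmul2l; first by rewrite lee_fin expR_ge0.
have Iu0 : (0 <= \int[Q]_w (u (rvec G w))%:E)%E.
  by apply: integral_ge0 => w _; rewrite lee_fin expR_ge0.
have h2 := le_trans (lee_wpmul2l Iu0 hv) h.
have -> : (\int[Q]_w (u (rvec G w))%:E = (expR (theta * W))%:E *
   (\int[Q]_w (u (rvec G w))%:E * (expR (- theta * W))%:E))%E.
  by rewrite muleCA -EFinM mulNr expRxMexpNx_1 mule1.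
by rewrite -[leRHS]mule1; apply: lee_wpmul2l => //; rewrite lee_fin expR_ge0.
Qed.

End gauss_tensorization.

(** * Sub-gaussian moments *)

Lemma fact_ge_expn (k j : nat) : (k ^ j * k`! <= (k + j)`!)%N.
Proof.
elim: j => [|j IH]; first by rewrite expn0 mul1n addn0.
by rewrite addnS factS expnS -mulnA leq_mul// (leq_trans (leq_addr j k)).
Qed.

Lemma sum_exp_coeff_le {R : realType} (z : R) n : 0 <= z ->
  \sum_(k < n) z ^+ k / k`!%:R <= expR z.
Proof.
move=> z0; rewrite -(big_mkord xpredT (fun k => z ^+ k / k`!%:R)).
apply: (@nondecreasing_cvgn_le _ (series (exp_coeff z))).
  apply/nondecreasing_seqP => i; rewrite /series/= big_nat_recr//= lerDl.
  by rewrite /exp_coeff/= divr_ge0// exprn_ge0.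
exact: is_cvg_series_exp_coeff.
Qed.

Section cosh_series.
Context {R : realType}.

(** Partial sums of [2 cosh y]. Only even powers occur, so the terms are nonnegative, increase with
    [n], and are controlled by [subg_moment]. *)
Definition cosh_sum (y : R) (n : nat) : R := \sum_(k < n) 2 * (y ^+ (2 * k) / (2 * k)`!%:R).

Lemma cosh_sumE (y : R) n :
  cosh_sum y n = series (exp_coeff y) (2 * n)%N + series (exp_coeff (- y)) (2 * n)%N.
Proof.
elim: n => [|n IH]; first by rewrite /cosh_sum big_ord0 muln0 /series/= !big_geq// addr0.
rewrite /cosh_sum big_ord_recr/= -/(cosh_sum y n) IH mulnS addnC !addnS addn0.
rewrite /series/= !big_nat_recr//= /exp_coeff/= !exprS.
have -> : (- y) ^+ (2 * n) = y ^+ (2 * n) by rewrite !exprM sqrrN.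
ring.
Qed.

Lemma cvg_cosh_sum (y : R) : cosh_sum y n @[n --> \oo] --> expR y + expR (- y).
Proof.
have H (z : R) : series (exp_coeff z) (2 * n)%N @[n --> \oo] --> expR z.
  have := @is_cvg_series_exp_coeff _ z => /cvg_ex[l hl].
  have -> : expR z = l by apply/cvg_lim.
  apply: (cvg_comp _ _ _ hl); apply/cvgnyPge => A; near=> n.
  apply: (@leq_trans n); last by rewrite leq_pmull.
  by near: n; exact: nbhs_infty_ge.
rewrite (_ : cosh_sum y = (fun n => series (exp_coeff y) (2 * n)%N + series (exp_coeff (- y)) (2 * n)%N)).
  exact: cvgD.
by apply/funext => n; rewrite cosh_sumE.
Unshelve. all: by end_near. Qed.

Lemma cosh_sum_ge0 (y : R) n : 0 <= cosh_sum y n.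
Proof.
by apply: sumr_ge0 => k _; rewrite !mulr_ge0// exprM exprn_ge0// sqr_ge0.
Qed.

Lemma nondecreasing_cosh_sum (y : R) : nondecreasing_seq (cosh_sum y).
Proof.
apply/nondecreasing_seqP => n; rewrite /cosh_sum big_ord_recr/= lerDl.
by rewrite !mulr_ge0// exprM exprn_ge0// sqr_ge0.
Qed.

End cosh_series.

Section symmetric_law.
Context {R : realType} (mu : probability R R).
Hypothesis sym : symmetric_law mu.

Lemma ge0_integral_symmetric (f : R -> \bar R) : measurable_fun setT f ->
  (forall x, 0 <= f x)%E -> (\int[mu]_x f (- x)%R = \int[mu]_x f x)%E.
Proof.
move=> mf f0; have mN : measurable_fun setT (-%R : R -> R) by exact: oppr_measurable.
transitivity (\int[pushforward mu (-%R : R -> R)]_x f x)%E.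
  by rewrite ge0_integral_pushforward.
apply: eq_measure_integral => A mA _; rewrite -[RHS]sym// /pushforward; congr (mu _).
by apply/seteqP; split => [x /= Ax|_ [x Ax <-]/=]; [exists (- x)|]; rewrite ?opprK.
Qed.

Lemma integral_symmetric (f : R -> \bar R) : measurable_fun setT f ->
  (\int[mu]_x f (- x)%R = \int[mu]_x f x)%E.
Proof.
move=> mf; have mN : measurable_fun setT (-%R : R -> R) by exact: oppr_measurable.
rewrite [LHS]integralE [RHS]integralE.
rewrite -(@ge0_integral_symmetric f^\+%E)//; last exact: measurable_funepos.
rewrite -(@ge0_integral_symmetric f^\-%E)//; last exact: measurable_funeneg.
have -> : (fun x => f (- x)) = f \o -%R by [].
by rewrite (funepos_comp f -%R) (funeneg_comp f -%R).
Qed.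

End symmetric_law.

Section subgaussian_moments.
Context {R : realType} (mu : probability R R) (kappa : R).
Hypothesis subg : subg_norm mu = kappa%:E.

Lemma subg_norm_ge0 : 0 <= kappa.
Proof.
rewrite -lee_fin -subg /subg_norm.
apply: (@le_trans _ _ ((1 `^ (- 2^-1))%:E * poweR (\int[mu]_x (`|x| `^ 1)%:E) 1^-1)%E).
  by rewrite mule_ge0 ?poweR_ge0// lee_fin powR_ge0.
by apply: ereal_sup_ubound; exists 1 => /=.
Qed.

Lemma subg_moment (k : nat) : (0 < k)%N ->
  (\int[mu]_x (x ^+ (2 * k))%:E <= ((kappa ^+ 2 * (2 * k)%:R) ^+ k)%:E)%E.
Proof.
move=> k0; set q : R := (2 * k)%:R.
have q1 : 1 <= q by rewrite /q (ler_nat _ 1) muln_gt0.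
have q0 : 0 < q by lra.
under eq_integral do rewrite exprM -(real_normK (num_real _)) -exprM -powR_mulrn// -/q.
set I := (\int[mu]_x _)%E.
have I0 : (0 <= I)%E by apply: integral_ge0 => x _; rewrite lee_fin powR_ge0.
have : ((q `^ (- 2^-1))%:E * poweR I q^-1 <= kappa%:E)%E.
  by rewrite -subg; apply: ereal_sup_ubound; exists q.
rewrite powRN powR12_sqrt ?(ltW q0)// lee_pdivrMl ?sqrtr_gt0// -EFinM => h.
have -> : I = poweR (poweR I q^-1) q by rewrite -poweRrM mulVf ?gt_eqF// poweRe1.
have sk0 : 0 <= Num.sqrt q * kappa by rewrite mulr_ge0 ?sqrtr_ge0 ?subg_norm_ge0.
apply: le_trans (gt0_ler_poweR (ltW q0) _ _ h) _.
- by rewrite in_itv/= poweR_ge0 leey.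
- by rewrite in_itv/= lee_fin sk0 leey.
rewrite poweR_EFin lee_fin powR_mulrn// exprM.
suff -> : (Num.sqrt q * kappa) ^+ 2 = kappa ^+ 2 * q by [].
by rewrite (exprMn _ (Num.sqrt q)) sqr_sqrtr ?(ltW q0)// mulrC.
Qed.

Lemma subg_moment4 : (\int[mu]_x (x ^+ 4)%:E <= (16 * kappa ^+ 4)%:E)%E.
Proof.
have := @subg_moment 2 isT; rewrite -[(2 * 2)%N]/4%N.
have -> : (kappa ^+ 2 * 4) ^+ 2 = 16 * kappa ^+ 4 by ring.
by [].
Qed.

(** The exponent [q = 2] in the sub-gaussian norm. This lower bound later allows negative powers of
    [kappa] to be absorbed into constants. *)
Lemma subg_sqr_ge : (\int[mu]_x (x ^+ 2)%:E = 1)%E -> 2^-1 <= kappa ^+ 2.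
Proof.
move=> v1; have := @subg_moment 1 isT; rewrite muln1 v1 expr1 lee_fin.
by rewrite -[(2%:R)]/(2 : R); lra.
Qed.

Hypothesis sym : symmetric_law mu.

(** By symmetry twice the left side is the mean of [2 cosh (l x)], expanded by monotone convergence.
    The moment bound turns the [k]-th term into [2 (2 (kappa l)^2)^k k^k / (2k)!], and
    [k^k k! <= (2k)!] recovers the exponential series. *)
Lemma subg_mgf (l : R) :
  (\int[mu]_x (expR (l * x))%:E <= (expR (2 * (kappa * l) ^+ 2))%:E)%E.
Proof.
have ml : measurable_fun setT (fun x : R => l * x) by exact: measurable_funM.
have mexp : measurable_fun setT (fun x : R => expR (l * x)) by exact: measurableT_comp.
have mexpN : measurable_fun setT (fun x : R => expR (- (l * x))).
  by do 2 apply: measurableT_comp => //.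
have symI : (\int[mu]_x (expR (- (l * x)))%:E = \int[mu]_x (expR (l * x))%:E)%E.
  rewrite -(ge0_integral_symmetric sym (f := fun x => (expR (l * x))%:E)).
  - by apply: eq_integral => x _; rewrite mulrN.
  - exact/measurable_EFinP.
  - by move=> x; rewrite lee_fin expR_ge0.
have mS n : measurable_fun setT (fun x : R => cosh_sum (l * x) n).
  apply: measurable_sum => k; do 2 apply: measurable_funM => //.
  exact: measurable_funX.
suff : (\int[mu]_x (expR (l * x) + expR (- (l * x)))%:E <=
    (2 * expR (2 * (kappa * l) ^+ 2))%:E)%E.
  under eq_integral do rewrite EFinD.
  rewrite ge0_integralD//; last 2 first.
  - exact/measurable_EFinP.
  - exact/measurable_EFinP.
  rewrite symI; have : (0 <= \int[mu]_x (expR (l * x))%:E)%E.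
    by apply: integral_ge0 => x _; rewrite lee_fin expR_ge0.
  by case: (\int[mu]_x _)%E => [r| |]//=; rewrite ?lee_fin; lra.
have cvg : (\int[mu]_x (cosh_sum (l * x) n)%:E)%E @[n --> \oo] -->
    (\int[mu]_x (expR (l * x) + expR (- (l * x)))%:E)%E.
  rewrite [X in _ --> X](_ : _ =
      \int[mu]_x limn (fun n => (cosh_sum (l * x) n)%:E))%E; last first.
    apply: eq_integral => x _; apply/esym/cvg_lim => //.
    by apply: cvg_EFin; [exact: nearW|exact: cvg_cosh_sum].
  apply: cvg_monotone_convergence => //.
  - by move=> n; exact/measurable_EFinP.
  - by move=> n x _; rewrite lee_fin cosh_sum_ge0.
  - by move=> x _ m n mn; rewrite lee_fin nondecreasing_cosh_sum.
rewrite -(cvg_lim _ cvg)//; apply: lime_le.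
  by apply/cvg_ex; eexists; exact: cvg.
apply: nearW => n; rewrite /cosh_sum.
under eq_integral do rewrite -sumEFin.
rewrite ge0_integral_sum//; last 2 first.
- move=> k; apply/measurable_EFinP; do 2 apply: measurable_funM => //.
  exact: measurable_funX.
- by move=> k x _; rewrite lee_fin !mulr_ge0// exprM exprn_ge0// sqr_ge0.
have z0 : 0 <= 2 * (kappa * l) ^+ 2 by rewrite mulr_ge0 ?sqr_ge0.
apply: (@le_trans _ _ (2 * \sum_(k < n) (2 * (kappa * l) ^+ 2) ^+ k / k`!%:R)%:E); last first.
  by rewrite lee_fin ler_wpM2l// sum_exp_coeff_le.
rewrite mulr_sumr -sumEFin; apply: lee_sum => k _.
pose c : R := 2 * l ^+ (2 * k) / (2 * k)`!%:R.
have c0 : 0 <= c by rewrite divr_ge0// mulr_ge0// exprM exprn_ge0// sqr_ge0.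
have xE (x : R) : (2 * ((l * x) ^+ (2 * k) / (2 * k)`!%:R))%:E = (c%:E * (x ^+ (2 * k))%:E)%E.
  by rewrite -EFinM exprMn /c; congr EFin; ring.
under eq_integral do rewrite xE.
rewrite ge0_integralZl//; last 2 first.
- by apply/measurable_EFinP; exact: measurable_funX.
- by move=> x _; rewrite lee_fin exprM exprn_ge0// sqr_ge0.
have [k0|k0] := posnP k.
  under eq_integral do rewrite k0 muln0 expr0.
  by rewrite integral_cst//= probability_setT mule1 lee_fin /c k0 muln0 !expr0 fact0; lra.
apply: le_trans (lee_wpmul2l _ (subg_moment k0)) _; first by rewrite lee_fin.
rewrite -EFinM lee_fin /c.
have := fact_ge_expn k k; rewrite addnn -mul2n -(ler_nat R) natrM natrX => hf.
have f0 : 0 < (2 * k)`!%:R :> R by rewrite ltr0n fact_gt0.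
have g0 : 0 < k`!%:R :> R by rewrite ltr0n fact_gt0.
have -> : 2 * l ^+ (2 * k) / (2 * k)`!%:R * (kappa ^+ 2 * (2 * k)%:R) ^+ k =
  2 * ((2 * (kappa * l) ^+ 2) ^+ k) * (k%:R ^+ k / (2 * k)`!%:R).
  rewrite natrM exprM; do 5 rewrite ?exprMn; ring.
rewrite -mulrA ler_wpM2l// ler_wpM2l ?exprn_ge0//.
by rewrite ler_pdivrMr// mulrC ler_pdivlMr.
Qed.

End subgaussian_moments.

(** * Real-valued expectations, transfer to the law, conditioning on a block *)

Section expectation_toolkit.
Context d (T : measurableType d) (R : realType) (P : probability T R).
Implicit Types (f g : T -> R) (c : R).

Definition rint f : Prop := P.-integrable setT (EFin \o f).

Lemma rint_measurable f : rint f -> measurable_fun setT f.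
Proof. by move=> h; apply/measurable_EFinP; exact: measurable_int h. Qed.

Lemma rintD f g : rint f -> rint g -> rint (fun w => f w + g w).
Proof. by move=> hf hg; apply: eq_integrable (integrableD _ hf hg). Qed.

Lemma rintZ c f : rint f -> rint (fun w => c * f w).
Proof. by move=> hf; apply: eq_integrable (integrableZl _ c hf). Qed.

Lemma rintB f g : rint f -> rint g -> rint (fun w => f w - g w).
Proof. by move=> hf hg; apply: eq_integrable (integrableB _ hf hg). Qed.

Lemma rint_cst c : rint (fun=> c).
Proof. exact: finite_measure_integrable_cst. Qed.

Lemma rint_sum (I : Type) (s : seq I) (F : I -> T -> R) :
  (forall i, rint (F i)) -> rint (fun w => \sum_(i <- s) F i w).
Proof.
move=> hF; elim: s => [|i s IH].
  by under eq_fun do rewrite big_nil; exact: rint_cst.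
by under eq_fun do rewrite big_cons; exact: rintD.
Qed.

Lemma rint_le f g : measurable_fun setT f -> (forall w, `|f w| <= g w) -> rint g -> rint f.
Proof.
move=> mf fg hg; apply: (le_integrable _ _ _ hg) => //; first exact/measurable_EFinP.
by move=> w _; rewrite /= lee_fin (le_trans (fg w))// ler_norm.
Qed.

Lemma rint_bounded f c : measurable_fun setT f -> (forall w, `|f w| <= c) -> rint f.
Proof. by move=> mf fc; apply: rint_le fc _; [|exact: rint_cst]. Qed.

Lemma RintegralcstT c : \int[P]_w c = c.
Proof. by rewrite Rintegral_cst//= probability_setT mulr1. Qed.

Lemma Rintegral_sumT (I : Type) (s : seq I) (F : I -> T -> R) :
  (forall i, rint (F i)) ->
  \int[P]_w (\sum_(i <- s) F i w) = \sum_(i <- s) \int[P]_w (F i w).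
Proof.
move=> hF; elim: s => [|i s IH].
  by under eq_Rintegral do rewrite big_nil; rewrite big_nil RintegralcstT.
under eq_Rintegral do rewrite big_cons.
by rewrite big_cons RintegralD//; [rewrite IH|exact: hF|exact: (rint_sum s hF)].
Qed.

Lemma normr_Rintegral_le f g : rint f -> rint g -> (forall w, `|f w| <= g w) ->
  `|\int[P]_w f w| <= \int[P]_w g w.
Proof.
move=> hf hg fg; apply: le_trans (le_normr_Rintegral _ hf) _ => //.
by apply: le_Rintegral => //; exact: integrable_norm.
Qed.

Lemma Rintegral_mono f g : rint f -> rint g -> (forall w, f w <= g w) ->
  \int[P]_w f w <= \int[P]_w g w.
Proof. by move=> hf hg fg; apply: le_Rintegral. Qed.

Lemma EFin_Rintegral f : rint f -> ((\int[P]_w f w)%:E = \int[P]_w (f w)%:E)%E.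
Proof. by move=> hf; rewrite fineK// integrable_fin_num. Qed.

Lemma rint_ge0_lty f c : measurable_fun setT f -> (forall w, 0 <= f w) ->
  (\int[P]_w (f w)%:E <= c%:E)%E -> rint f.
Proof.
move=> mf f0 fc; apply/integrableP; split; first exact/measurable_EFinP.
under eq_integral do rewrite /= ger0_norm//.
by rewrite (le_lt_trans fc)// ltry.
Qed.

End expectation_toolkit.

Section law_transfer.
Context d (T : measurableType d) (R : realType) (P : probability T R).
Variables (X : {RV P >-> R}) (mu : probability R R).
Hypothesis lawX : forall B, measurable B -> distribution P X B = mu B.

Lemma integral_law (f : R -> \bar R) : measurable_fun setT f ->
  (\int[P]_w f (X w) = \int[mu]_t f t)%E.
Proof.
move=> mf; rewrite -(@integral_distributionT _ _ _ _ _ P X f)//.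
by apply: eq_measure_integral => A mA _; exact: lawX.
Qed.

Lemma Rintegral_law (f : R -> R) : measurable_fun setT f ->
  \int[P]_w f (X w) = \int[mu]_t f t.
Proof.
by move=> mf; rewrite /Rintegral (integral_law (f := EFin \o f))//; exact/measurable_EFinP.
Qed.

Lemma rint_law (f : R -> R) : rint mu f -> rint P (fun w => f (X w)).
Proof.
move=> hf; have mf := rint_measurable hf.
apply/integrableP; split; first by apply/measurable_EFinP; exact: measurableT_comp.
have /integrableP[_] := hf.
rewrite -(integral_law (f := fun t => `|(f t)%:E|%E))//.
by apply: measurableT_comp => //; exact/measurable_EFinP.
Qed.

End law_transfer.

Section independent_expectation.
Context d (T : measurableType d) (R : realType) (P : probability T R).
Context (I : finType) (X : I -> {RV P >-> R}).
Hypothesis indX : mutually_independent X.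
Variables (J J' : {set I}).
Hypothesis dJ : forall i, i \in J -> i \notin J'.

Lemma indep_Rintegral_bound (f : sub_space X J * sub_space X J' -> R) (c : R) :
  measurable_fun setT f -> rint P (fun w => f (w, w)) ->
  (forall w, `|\int[P]_w' f (w, w')| <= c) ->
  (forall w, rint P (fun w' => f (w, w'))) ->
  `|\int[P]_w f (w, w)| <= c.
Proof.
move=> mf intf bf intw.
have c0 : 0 <= c by apply: le_trans (bf point); rewrite normr_ge0.
have mF : measurable_fun setT (fun w : T => \int[P]_w' f (w, w')).
  have h := indep_integral_measurable indX dJ mf intf.
  exact: (measurableT_comp (fine_measurable measurableT) h).
have E1 : \int[P]_w f (w, w) = \int[P]_w \int[P]_w' f (w, w').
  rewrite /Rintegral (indep_integral indX dJ)//; congr fine.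
  by apply: eq_integral => w _; rewrite EFin_Rintegral//; exact: intw.
rewrite E1 -[leRHS](RintegralcstT P); apply: normr_Rintegral_le => //.
- exact: rint_bounded mF bf.
- exact: rint_cst.
Qed.

Lemma indep_RintegralM (f : sub_space X J -> R) (g : sub_space X J' -> R) :
  measurable_fun setT f -> measurable_fun setT g ->
  rint P (f : T -> R) -> rint P (g : T -> R) -> rint P (fun w => f w * g w) ->
  \int[P]_w (f w * g w) = \int[P]_w f w * \int[P]_w g w.
Proof.
move=> mf mg intf intg intfg.
rewrite /Rintegral (@indep_integral _ _ _ _ _ _ indX J J' (fun z => f z.1 * g z.2))//=.
  under eq_integral do rewrite -(EFin_Rintegral (rintZ _ intg)) (RintegralZl _ _ intg)//.
  by rewrite -[LHS]/(\int[P]_w (f w * \int[P]_w0 g w0)) RintegralZr.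
apply: measurable_funM.
- by apply: (measurableT_comp mf); exact: measurable_fst.
- by apply: (measurableT_comp mg); exact: measurable_snd.
Qed.

End independent_expectation.

(** * The mean of a one-bit measurement *)

Section smooth_sign.
Context {R : realType}.
Implicit Types b s y e : R.

(** The derivative of [atan]. Being rational, it has explicit finite differences. *)
Definition ckernel y : R := (1 + y ^+ 2)^-1.

Lemma ckernel_gt0 y : 0 < ckernel y.
Proof. by rewrite invr_gt0 ltr_wpDr// sqr_ge0. Qed.

Lemma ckernel_le1 y : ckernel y <= 1.
Proof. by rewrite invf_le1 ?lerDl ?sqr_ge0// ltr_wpDr// sqr_ge0. Qed.

(** The second difference equals [s^2 (6 b^2 - 2 - 2 s^2) / (p q r)], and
    [p q r >= 1 + 3 b^2 + 2 s^2] dominates half the numerator factor. *)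
Lemma ckernel_diff2 b s : `|ckernel (b + s) + ckernel (b - s) - 2 * ckernel b| <= 2 * s ^+ 2.
Proof.
rewrite /ckernel; set p := 1 + (b + s) ^+ 2; set q := 1 + (b - s) ^+ 2; set r := 1 + b ^+ 2.
have p0 : 0 < p by rewrite ltr_wpDr// sqr_ge0.
have q0 : 0 < q by rewrite ltr_wpDr// sqr_ge0.
have r0 : 0 < r by rewrite ltr_wpDr// sqr_ge0.
have -> : p^-1 + q^-1 - 2 * r^-1 = s ^+ 2 * ((6 * b ^+ 2 - 2 - 2 * s ^+ 2) / (p * q * r)).
  have -> : s ^+ 2 * ((6 * b ^+ 2 - 2 - 2 * s ^+ 2) / (p * q * r)) =
      (r * (p + q) - 2 * (p * q)) / (p * q * r).
    by rewrite mulrA; congr (_ / _); rewrite /p /q /r; ring.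
  by field; rewrite !gt_eqF.
have pqr : 1 + 3 * b ^+ 2 + 2 * s ^+ 2 <= p * q * r.
  have h1 : 1 + 2 * b ^+ 2 + 2 * s ^+ 2 <= p * q.
    have -> : p * q = 1 + 2 * b ^+ 2 + 2 * s ^+ 2 + (b ^+ 2 - s ^+ 2) ^+ 2 by rewrite /p /q; ring.
    by rewrite lerDl sqr_ge0.
  apply: le_trans (ler_wpM2r (ltW r0) h1); rewrite /r.
  have := sqr_ge0 b; have := sqr_ge0 s; have := sqr_ge0 (b * s); have := sqr_ge0 (b ^+ 2).
  rewrite exprMn; nra.
rewrite normrM ger0_norm ?sqr_ge0// mulrC ler_wpM2r ?sqr_ge0//.
have pqr0 : 0 < p * q * r by rewrite !mulr_gt0.
rewrite normrM normfV (gtr0_norm pqr0) ler_pdivrMr// ler_norml.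
by have := sqr_ge0 b; have := sqr_ge0 s; lra.
Qed.

(** Mean value theorem in [s]: the derivative of the left-hand expression is the second difference
    of [ckernel], of order [s^2]. *)
Lemma atan_diff_ge0 b s : 0 <= s ->
  `|atan (b + s) - atan (b - s) - 2 * s * ckernel b| <= 2 * s ^+ 3.
Proof.
rewrite le_eqVlt => /predU1P[<-|s0].
  by rewrite addr0 subr0 subrr mulr0 mul0r subr0 normr0 expr0n mulr0.
pose f (t : R) := atan (b + t) - atan (b - t) - 2 * t * ckernel b.
have df (t : R) : is_derive t (1 : R) f (ckernel (b + t) + ckernel (b - t) - 2 * ckernel b).
  apply: is_derive_eq; rewrite /ckernel /GRing.scale/=; lra.
have [|c] := @MVT _ f _ _ _ s0 (fun t _ => df t).
  by apply: derivable_within_continuous => t _; exact: ex_derive.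
rewrite in_itv/= => /andP[c0 cs]; rewrite {2}/f addr0 subr0 subrr mulr0 mul0r !subr0 => fs.
rewrite -/(f s) fs normrM (gtr0_norm s0) exprSr mulrA ler_wpM2r ?(ltW s0)//.
apply: le_trans (ckernel_diff2 b c) _; rewrite ler_wpM2l//.
by rewrite ler_pXn2r ?nnegrE ?ltW.
Qed.

Lemma atan_diff b s : `|atan (b + s) - atan (b - s) - 2 * s * ckernel b| <= 2 * `|s| ^+ 3.
Proof.
have [s0|s0] := ger0P s; first exact: atan_diff_ge0.
have := @atan_diff_ge0 b (- s); rewrite oppr_ge0 (ltW s0) opprK => /(_ isT).
have -> : atan (b + s) - atan (b - s) - 2 * s * ckernel b =
  - (atan (b - s) - atan (b + s) - 2 * - s * ckernel b) by ring.
by rewrite normrN.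
Qed.

Lemma atan_le y : 0 <= y -> atan y <= y.
Proof.
rewrite le_eqVlt => /predU1P[<-|y0]; first by rewrite atan0.
have [|c _] := @MVT _ (@atan R) _ _ _ y0 (fun t _ => is_derive1_atan t).
  by apply: derivable_within_continuous => t _; exact: ex_derive.
rewrite atan0 !subr0 => ->; rewrite -[leRHS]mul1r ler_wpM2r ?(ltW y0)//.
exact: ckernel_le1.
Qed.

(** The left side is an angle with tangent [1 / y], that is [atan (1 / y)]. *)
Lemma pihalf_sub_atan_le y : 0 < y -> pi / 2 - atan y <= y^-1.
Proof.
move=> y0; set th := atan y.
have th0 : 0 < th by rewrite -(@atan0 R) lt_atan.
have thpi : th < pi / 2 := atan_ltpi2 y.
have tanE : tan (pi / 2 - th) = y^-1.
  rewrite -[pi / 2 - th]opprB tanN /tan cosBpihalf sinBpihalf mulNr opprK.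
  by rewrite -[cos th / _]invf_div -/(tan th) atanK.
rewrite -(tanK (x := pi / 2 - th)) ?in_itv/=; last by apply/andP; split; lra.
by rewrite tanE atan_le// invr_ge0 ltW.
Qed.

Definition smooth_sgn e y : R := 2 / pi * atan (y / e).
Definition smooth_sgn_deriv e y : R := 2 / pi / e * ckernel (y / e).

Lemma two_div_pi_bounds : 2^-1 <= 2 / (pi : R) <= 1.
Proof.
have p0 := pi_gt0 R; have := pihalf_lt2 R; have := pi_ge2 R => h1 h2.
by rewrite ler_pdivlMr// ler_pdivrMr//; lra.
Qed.

Lemma smooth_sgn_bound e y : `|smooth_sgn e y| <= 1.
Proof.
have p0 := pi_gt0 R.
rewrite normrM gtr0_norm ?divr_gt0// -ler_pdivlMl ?divr_gt0// invf_div mulr1.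
by rewrite ler_norml ltW ?atan_gtNpi2// ltW// atan_ltpi2.
Qed.

Lemma sgn_abs (y : R) : sgn y * y = `|y|.
Proof. by rewrite /sgn; case: ger0P => _; rewrite ?mul1r ?mulN1r. Qed.

(** The squared error is bounded by the shape of [smooth_sgn_deriv] itself, so its mean is of order
    [e] times the mean of that derivative, a quantity Stein's identity controls. *)
Lemma smooth_sgn_error e y : 0 < e ->
  (sgn y - smooth_sgn e y) ^+ 2 <= 2 * ckernel (y / e).
Proof.
move=> e0; have p0 := pi_gt0 R; have /andP[p1 p2] := two_div_pi_bounds.
(* For [t <= 1] the square is at most 1 and [1 + t^2 <= 2]; for [t > 1] the square is at most
   [1 / t^2] and [1 + t^2 <= 2 t^2]. *)
have key (t : R) : 0 <= t -> (1 - 2 / pi * atan t) ^+ 2 <= 2 * ckernel t.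
  move=> t0.
  have a0 : 0 <= atan t by rewrite -(@atan0 R) le_atan.
  have a1 := atan_ltpi2 t.
  have E : 1 - 2 / pi * atan t = 2 / pi * (pi / 2 - atan t).
    by clear -p0; move: pi (atan t) p0 => c A c0; field; rewrite gt_eqF.
  have d0 : 0 <= 1 - 2 / pi * atan t by rewrite E mulr_ge0 ?divr_ge0 ?(ltW p0)//; lra.
  rewrite /ckernel ler_pdivlMr; last by rewrite ltr_wpDr// sqr_ge0.
  have [t1|t1] := leP t 1.
    have u1 : (1 - 2 / pi * atan t) ^+ 2 <= 1.
      by rewrite expr_le1// gerBl mulr_ge0 ?divr_ge0 ?(ltW p0).
    have u2 : 1 + t ^+ 2 <= 2.
      have : t ^+ 2 <= 1 by rewrite expr_le1.
      by lra.
    rewrite -[leRHS]mul1r; apply: ler_pM => //; first exact: sqr_ge0.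
    by rewrite addr_ge0// sqr_ge0.
  have d1 : 1 - 2 / pi * atan t <= t^-1.
    have h := pihalf_sub_atan_le (lt_trans ltr01 t1).
    rewrite E; apply: le_trans h; rewrite ler_piMl//; lra.
  have d2 : (1 - 2 / pi * atan t) ^+ 2 <= t^-1 ^+ 2.
    by rewrite ler_pXn2r ?nnegrE// invr_ge0.
  have t21 : 1 <= t ^+ 2 by nra.
  apply: le_trans (ler_wpM2r _ d2) _; first by rewrite addr_ge0// sqr_ge0.
  by rewrite exprVn mulrC ler_pdivrMr; lra.
rewrite /sgn /smooth_sgn; have [y0|y0] := leP 0 y; first by apply: key; rewrite divr_ge0// ltW.
have -> : (- 1 - 2 / pi * atan (y / e)) ^+ 2 = (1 - 2 / pi * atan (- (y / e))) ^+ 2.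
  by rewrite atanN; ring.
have -> : ckernel (y / e) = ckernel (- (y / e)) by rewrite /ckernel sqrrN.
by apply: key; rewrite -mulNr divr_ge0 ?oppr_ge0 ?ltW.
Qed.

Lemma smooth_sgn_mul_le e y : 0 < e -> smooth_sgn e y * y <= `|y|.
Proof.
move=> e0; apply: le_trans (ler_norm _) _; rewrite normrM.
by rewrite -[leRHS]mul1r ler_wpM2r// smooth_sgn_bound.
Qed.

Lemma smooth_sgn_taylor e b s : 0 < e ->
  `|smooth_sgn e (b + s) - smooth_sgn e (b - s) - 2 * s * smooth_sgn_deriv e b|
  <= 2 * `|s| ^+ 3 / e ^+ 3.
Proof.
move=> e0; have /andP[p1 p2] := two_div_pi_bounds.
have -> : smooth_sgn e (b + s) - smooth_sgn e (b - s) - 2 * s * smooth_sgn_deriv e b =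
   2 / pi * (atan (b / e + s / e) - atan (b / e - s / e) - 2 * (s / e) * ckernel (b / e)).
  rewrite /smooth_sgn /smooth_sgn_deriv.
  have -> : (b + s) / e = b / e + s / e by rewrite mulrDl.
  have -> : (b - s) / e = b / e - s / e by rewrite mulrBl.
  by have p0 := pi_gt0 R; move: pi p0 => c c0; field; rewrite !gt_eqF.
rewrite normrM (ger0_norm (x := 2 / pi)); last by lra.
apply: (@le_trans _ _ (1 * (2 * `|s / e| ^+ 3))).
  by apply: ler_pM => //; [lra|exact: atan_diff].
by rewrite mul1r normrM normfV (gtr0_norm e0) expr_div_n mulrA.
Qed.

Lemma smooth_sgn_deriv_taylor e b s : 0 < e ->
  `|smooth_sgn_deriv e (b + s) + smooth_sgn_deriv e (b - s) - 2 * smooth_sgn_deriv e b|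
  <= 2 * s ^+ 2 / e ^+ 3.
Proof.
move=> e0; have /andP[p1 p2] := two_div_pi_bounds.
have -> : smooth_sgn_deriv e (b + s) + smooth_sgn_deriv e (b - s) - 2 * smooth_sgn_deriv e b =
   2 / pi * e^-1 * (ckernel (b / e + s / e) + ckernel (b / e - s / e) - 2 * ckernel (b / e)).
  rewrite /smooth_sgn_deriv.
  have -> : (b + s) / e = b / e + s / e by rewrite mulrDl.
  have -> : (b - s) / e = b / e - s / e by rewrite mulrBl.
  by have p0 := pi_gt0 R; move: pi p0 => c c0; field; rewrite !gt_eqF.
rewrite !normrM (ger0_norm (x := 2)) ?normfV ?(gtr0_norm (pi_gt0 R)) ?(gtr0_norm e0)//.
have -> : 2 * s ^+ 2 / e ^+ 3 = 1 * e^-1 * (2 * (s / e) ^+ 2) by field; rewrite gt_eqF.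
apply: ler_pM => //; last exact: ckernel_diff2.
  by rewrite mulr_ge0// ?invr_ge0 ?(ltW e0)//; lra.
by rewrite ler_wpM2r// invr_ge0 ltW.
Qed.

Lemma smooth_sgn_deriv_ge0 e y : 0 < e -> 0 <= smooth_sgn_deriv e y.
Proof. by move=> e0; rewrite mulr_ge0 ?divr_ge0 ?pi_ge0 ?(ltW e0) ?(ltW (ckernel_gt0 _)). Qed.

Lemma smooth_sgn_deriv_le e y : 0 < e -> smooth_sgn_deriv e y <= e^-1.
Proof.
move=> e0; have /andP[p1 p2] := two_div_pi_bounds.
rewrite /smooth_sgn_deriv -[leRHS]mulr1 ler_pM ?ckernel_le1 ?(ltW (ckernel_gt0 _))//.
  by rewrite divr_ge0 ?(ltW e0)//; lra.
by rewrite -[leRHS]mul1r ler_wpM2r// invr_ge0 ltW.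
Qed.

Lemma measurable_smooth_sgn e : measurable_fun setT (smooth_sgn e).
Proof.
have ma : measurable_fun setT (@atan R).
  by apply: continuous_measurable_fun => y; exact: continuous_atan.
apply: measurable_funM => //; apply: (measurableT_comp ma).
exact: measurable_funM.
Qed.

Lemma measurable_ckernel : measurable_fun setT ckernel.
Proof.
apply: continuous_measurable_fun => y; apply: cvgV.
  by rewrite gt_eqF// ltr_wpDr// sqr_ge0.
by apply: cvgD; [exact: cvg_cst|exact: sqr_continuous].
Qed.

Lemma measurable_smooth_sgn_deriv e : measurable_fun setT (smooth_sgn_deriv e).
Proof.
apply: measurable_funM => //; apply: (measurableT_comp measurable_ckernel).
exact: measurable_funM.
Qed.

Lemma measurable_sgn : measurable_fun setT (@sgn R).
Proof.
rewrite /sgn; apply: measurable_fun_ifT => //.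
exact: measurable_fun_ler.
Qed.

End smooth_sign.

(** * Approximate Stein identity in one variable *)

Section stein_one_dim.
Context {R : realType} (mu : probability R R) (M : R).
Hypotheses (sym : symmetric_law mu) (var1 : (\int[mu]_t (t ^+ 2)%:E = 1)%E)
  (M1 : 1 <= M) (mom4 : (\int[mu]_t (t ^+ 4)%:E <= M%:E)%E).

Lemma rint_pow4 : rint mu (fun t => t ^+ 4).
Proof.
apply: rint_ge0_lty mom4; first exact: measurable_funX.
by move=> t; rewrite (exprM t 2 2) sqr_ge0.
Qed.

Lemma rint_pow2 : rint mu (fun t => t ^+ 2).
Proof.
apply: (@rint_ge0_lty _ _ _ _ _ 1); first exact: measurable_funX.
- by move=> t; rewrite sqr_ge0.
- by rewrite var1.
Qed.

Lemma rint_id : rint mu (fun t => t).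
Proof.
apply: (@rint_le _ _ _ mu _ (fun t => 1 + t ^+ 2)) => //.
  move=> t; have := sqr_ge0 (`|t| - 1); rewrite sqrrB real_normK ?num_real// => h.
  have := normr_ge0 t; nra.
by apply: rintD; [exact: rint_cst|exact: rint_pow2].
Qed.

Lemma Rintegral_symmetric (f : R -> R) : measurable_fun setT f ->
  \int[mu]_t f (- t)%R = \int[mu]_t f t.
Proof.
move=> mf; rewrite /Rintegral; congr fine.
by apply: (integral_symmetric sym (f := EFin \o f)); exact/measurable_EFinP.
Qed.

Lemma Rintegral_id : \int[mu]_t t = 0.
Proof.
have := @Rintegral_symmetric id (@measurable_id _ _ setT).
under eq_Rintegral do rewrite -mulN1r.
rewrite RintegralZl//; last exact: rint_id.
by rewrite /=; lra.
Qed.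

Lemma Rintegral_pow2 : \int[mu]_t (t ^+ 2) = 1.
Proof. by rewrite /Rintegral var1. Qed.

Lemma Rintegral_pow4_le : \int[mu]_t (t ^+ 4) <= M.
Proof. by rewrite -lee_fin EFin_Rintegral//; exact: rint_pow4. Qed.

(** The Stein expression [t h(t) - h'(t)] for [h(t) = smooth_sgn e (b + t x)]; its mean would vanish
    if [t] were standard Gaussian. *)
Definition stein_diff (e x b t : R) : R :=
  t * smooth_sgn e (b + t * x) - x * smooth_sgn_deriv e (b + t * x).

Lemma stein_diff_bound e x b t : 0 < e -> `|stein_diff e x b t| <= `|t| + `|x| / e.
Proof.
move=> e0; apply: le_trans (ler_normB _ _) _; rewrite (normrM t) (normrM x).
apply: lerD; first by apply: ler_piMr => //; exact: smooth_sgn_bound.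
by rewrite ler_wpM2l// ger0_norm ?smooth_sgn_deriv_ge0// smooth_sgn_deriv_le.
Qed.

Lemma measurable_stein_diff e x b : measurable_fun setT (stein_diff e x b).
Proof.
have ml : measurable_fun setT (fun t : R => b + t * x).
  by apply: measurable_funD => //; exact: measurable_funM.
apply: measurable_funB; apply: measurable_funM => //.
  exact: (measurableT_comp (measurable_smooth_sgn e) ml).
exact: (measurableT_comp (measurable_smooth_sgn_deriv e) ml).
Qed.

Lemma rint_stein_diff e x b : 0 < e -> rint mu (stein_diff e x b).
Proof.
move=> e0; apply: (@rint_le _ _ _ mu _ (fun t => `|t| + `|x| / e)).
- exact: measurable_stein_diff.
- by move=> t; exact: stein_diff_bound.
- by apply: rintD; [exact: integrable_norm rint_id|exact: rint_cst].
Qed.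

(** Averaging over [t] and [- t] leaves symmetric differences. Subtracting [A (t^2 - 1)], of mean
    zero by unit variance, cancels their leading terms; the remainder [Rm] is at most
    [2 c (t^4 + t^2)] with [c = |x|^3 / e^3], and [M >= 1] merges the two moments. *)
Lemma stein_one_dim e x b : 0 < e ->
  `|\int[mu]_t stein_diff e x b t| <= 2 * M * `|x| ^+ 3 / e ^+ 3.
Proof.
move=> e0; have mD := measurable_stein_diff e x b; have iD := rint_stein_diff x b e0.
have mDN : measurable_fun setT (fun t : R => stein_diff e x b (- t)).
  exact: (measurableT_comp mD).
have iDN : rint mu (fun t => stein_diff e x b (- t)).
  apply: (@rint_le _ _ _ mu _ (fun t => `|t| + `|x| / e)) => //.
    by move=> t; apply: le_trans (stein_diff_bound _ _ _ e0) _; rewrite normrN.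
  by apply: rintD; [exact: integrable_norm rint_id|exact: rint_cst].
pose A := 2 * x * smooth_sgn_deriv e b.
pose Rm t := stein_diff e x b t + stein_diff e x b (- t) - A * (t ^+ 2 - 1).
have i21 : rint mu (fun t => t ^+ 2 - 1) by apply: rintB; [exact: rint_pow2|exact: rint_cst].
have iS : rint mu (fun t => stein_diff e x b t + stein_diff e x b (- t)) := rintD iD iDN.
have iA : rint mu (fun t => A * (t ^+ 2 - 1)) := rintZ A i21.
have iR : rint mu Rm by apply: rintB.
have E2 : 2 * \int[mu]_t stein_diff e x b t = \int[mu]_t Rm t.
  rewrite [RHS](RintegralB _ iS iA)// (RintegralD _ iD iDN)// (RintegralZl _ _ i21)//.
  rewrite [X in A * X](RintegralB _ rint_pow2 (rint_cst _ 1))//.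
  rewrite Rintegral_pow2 RintegralcstT subrr mulr0 subr0.
  by rewrite (Rintegral_symmetric mD); ring.
pose c := `|x| ^+ 3 / e ^+ 3.
have c0 : 0 <= c by rewrite divr_ge0// exprn_ge0// ltW.
have Rb t : `|Rm t| <= 2 * c * t ^+ 4 + 2 * c * t ^+ 2.
  have -> : Rm t = t * (smooth_sgn e (b + t * x) - smooth_sgn e (b - t * x)
       - 2 * (t * x) * smooth_sgn_deriv e b)
     - x * (smooth_sgn_deriv e (b + t * x) + smooth_sgn_deriv e (b - t * x)
       - 2 * smooth_sgn_deriv e b).
    rewrite /Rm /stein_diff /A.
    have -> : - t * x = - (t * x) by rewrite mulNr.
    move: (smooth_sgn e _) (smooth_sgn e _) (smooth_sgn_deriv e _) => u1 u2 u3.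
    move: (smooth_sgn_deriv e _) (smooth_sgn_deriv e _) => u4 u5.
    ring.
  apply: le_trans (ler_normB _ _) _; rewrite (normrM t) (normrM x); apply: lerD.
    apply: le_trans (ler_wpM2l (normr_ge0 t) (smooth_sgn_taylor b (t * x) e0)) _.
    have -> : t ^+ 4 = `|t| ^+ 4.
      by rewrite (exprM t 2 2) -(real_normK (num_real t)) -exprM.
    rewrite normrM /c le_eqVlt; apply/orP; left; apply/eqP; field.
    by rewrite gt_eqF.
  apply: le_trans (ler_wpM2l (normr_ge0 x) (smooth_sgn_deriv_taylor b (t * x) e0)) _.
  rewrite exprMn -(real_normK (num_real x)) /c le_eqVlt; apply/orP; left; apply/eqP; field.
  by rewrite gt_eqF.
have iRb : rint mu (fun t => 2 * c * t ^+ 4 + 2 * c * t ^+ 2).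
  by apply: rintD; apply: rintZ; [exact: rint_pow4|exact: rint_pow2].
have := normr_Rintegral_le iR iRb Rb.
rewrite -E2 normrM ger0_norm//.
rewrite (RintegralD _ (rintZ (2 * c) rint_pow4) (rintZ (2 * c) rint_pow2))//.
rewrite (RintegralZl _ _ rint_pow4)// (RintegralZl _ _ rint_pow2)//.
rewrite Rintegral_pow2 => h; rewrite -[leRHS]mulrA -/c.
have h1 := ler_wpM2l c0 Rintegral_pow4_le; have h2 := ler_wpM2l c0 M1.
by rewrite mulr1 in h2; lra.
Qed.

End stein_one_dim.

(** * The vector [E sgn(<a, x>) a] for a row [a] with independent coordinates *)

Section stein.
Context d (T : measurableType d) (R : realType) (P : probability T R).
Context (I : finType) (X : I -> {RV P >-> R}) (n : nat) (idx : 'I_n -> I).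
Hypotheses (indX : mutually_independent X) (idx_inj : injective idx).
Variables (mu : probability R R) (M : R).
Hypotheses (sym : symmetric_law mu) (var1 : (\int[mu]_t (t ^+ 2)%:E = 1)%E)
  (M1 : 1 <= M) (mom4 : (\int[mu]_t (t ^+ 4)%:E <= M%:E)%E).
Hypothesis lawX : forall j B, measurable B -> distribution P (X (idx j)) B = mu B.
Variable x : 'rV[R]_n.
Local Notation a j w := (X (idx j) w).

Definition linform (z : 'rV[R]_n) (w : T) : R := dotv (\row_j a j w) z.

Lemma linformE z w : linform z w = \sum_j a j w * z ord0 j.
Proof. by apply: eq_bigr => j _; rewrite mxE. Qed.

Lemma measurable_linform z : measurable_fun setT (linform z).
Proof.
rewrite (_ : linform z = fun w => \sum_j a j w * z ord0 j); last first.
  by apply/funext => w; exact: linformE.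
by apply: measurable_sum => j; exact: measurable_funM.
Qed.

Lemma rint_coord j : rint P (fun w => a j w).
Proof. exact: (rint_law (lawX j) (rint_id var1)). Qed.

Lemma rint_coord2 j : rint P (fun w => a j w ^+ 2).
Proof. exact: (rint_law (lawX j) (rint_pow2 var1)). Qed.

Lemma rint_coordM j k : rint P (fun w => a j w * a k w).
Proof.
apply: (@rint_le _ _ _ P _ (fun w => a j w ^+ 2 + a k w ^+ 2)).
- exact: measurable_funM.
- move=> w; rewrite normrM -(real_normK (num_real (a j w))) -(real_normK (num_real (a k w))).
  have := sqr_ge0 (`|a j w| - `|a k w|); have := normr_ge0 (a j w); have := normr_ge0 (a k w).
  nra.
- by apply: rintD; exact: rint_coord2.
Qed.

Lemma Rintegral_coord j : \int[P]_w a j w = 0.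
Proof. by rewrite (Rintegral_law (lawX j) (f := id)) ?(Rintegral_id sym var1). Qed.

Lemma Rintegral_coordM j k : \int[P]_w (a j w * a k w) = (j == k)%:R.
Proof.
have [<-|jk] := eqVneq j k.
  under eq_Rintegral do rewrite -expr2.
  by rewrite (Rintegral_law (lawX j) (f := fun t => t ^+ 2)) ?(Rintegral_pow2 var1).
have dJ (i : I) : i \in [set idx j]%SET -> i \notin [set idx k]%SET.
  by rewrite !inE => /eqP ->; rewrite (inj_eq idx_inj).
rewrite (indep_RintegralM indX dJ (f := X (idx j)) (g := X (idx k))).
- by rewrite Rintegral_coord mul0r.
- by apply: sub_space_coord; rewrite inE.
- by apply: sub_space_coord; rewrite inE.
- exact: rint_coord.
- exact: rint_coord.
- exact: rint_coordM.
Qed.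

Lemma linform_sqrE z w :
  linform z w ^+ 2 = \sum_j \sum_k z ord0 j * z ord0 k * (a j w * a k w).
Proof.
rewrite linformE expr2 mulr_suml; apply: eq_bigr => j _.
by rewrite mulr_sumr; apply: eq_bigr => k _; ring.
Qed.

Lemma rint_linform_sqr z : rint P (fun w => linform z w ^+ 2).
Proof.
under eq_fun do rewrite linform_sqrE.
by do 2 (apply: rint_sum => ?); apply: rintZ; exact: rint_coordM.
Qed.

Lemma Rintegral_linform_sqr z : \int[P]_w (linform z w ^+ 2) = norm2 z ^+ 2.
Proof.
under eq_Rintegral do rewrite linform_sqrE.
rewrite Rintegral_sumT => [|j]; last first.
  by apply: rint_sum => k; apply: rintZ; exact: rint_coordM.
rewrite sqr_norm2; apply: eq_bigr => j _.
rewrite Rintegral_sumT => [|k]; last by apply: rintZ; exact: rint_coordM.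
rewrite (bigD1 j)//= big1 ?addr0 => [|k kj].
  by rewrite RintegralZl//; [rewrite Rintegral_coordM eqxx mulr1|exact: rint_coordM].
rewrite RintegralZl//; last exact: rint_coordM.
by rewrite Rintegral_coordM eq_sym (negbTE kj) mulr0.
Qed.

Lemma rint_linform z : rint P (linform z).
Proof.
rewrite (_ : linform z = fun w => \sum_j z ord0 j * a j w); last first.
  by apply/funext => w; rewrite linformE; apply: eq_bigr => j _; rewrite mulrC.
by apply: rint_sum => j; apply: rintZ; exact: rint_coord.
Qed.

Let rintM_bounded (h f : T -> R) : measurable_fun setT h -> (forall w, `|h w| <= 1) ->
  rint P f -> rint P (fun w => h w * f w).
Proof.
move=> mh h1 hf; apply: (@rint_le _ _ _ P _ (fun w => `|f w|)).
- by apply: measurable_funM => //; exact: rint_measurable hf.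
- by move=> w; rewrite normrM ler_piMl.
- exact: integrable_norm.
Qed.

(** All coordinates except [j] are frozen; they contribute the shift [b] of the one-variable
    estimate, which is uniform in [b]. *)
Lemma stein_coord (e : R) j : 0 < e ->
  `|\int[P]_w (smooth_sgn e (linform x w) * a j w)
    - x ord0 j * \int[P]_w smooth_sgn_deriv e (linform x w)|
  <= 2 * M * `|x ord0 j| ^+ 3 / e ^+ 3.
Proof.
move=> e0; have mW := measurable_linform x.
have mH : measurable_fun setT (fun w => smooth_sgn e (linform x w)).
  exact: (measurableT_comp (measurable_smooth_sgn e) mW).
have mH' : measurable_fun setT (fun w => smooth_sgn_deriv e (linform x w)).
  exact: (measurableT_comp (measurable_smooth_sgn_deriv e) mW).
have iH : rint P (fun w => smooth_sgn e (linform x w) * a j w).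
  apply: rintM_bounded => //; last exact: rint_coord.
  by move=> w; exact: smooth_sgn_bound.
have iH' : rint P (fun w => smooth_sgn_deriv e (linform x w)).
  apply: (@rint_bounded _ _ _ P _ e^-1) => // w.
  by rewrite ger0_norm ?smooth_sgn_deriv_ge0// smooth_sgn_deriv_le.
rewrite -RintegralZl// -RintegralB//; last exact: rintZ.
pose J := (~: [set idx j])%SET; pose J' := [set idx j]%SET.
pose f (z : sub_space X J * sub_space X J') : R :=
  stein_diff e (x ord0 j) (\sum_(k | k != j) X (idx k) z.1 * x ord0 k) (X (idx j) z.2).
have fE w : f (w, w) = smooth_sgn e (linform x w) * a j w
    - x ord0 j * smooth_sgn_deriv e (linform x w).
  rewrite /f /stein_diff/=.
  have -> : \sum_(k | k != j) a k w * x ord0 k + a j w * x ord0 j = linform x w.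
    by rewrite linformE [RHS](bigD1 j)//= addrC.
  by rewrite mulrC.
under eq_Rintegral do rewrite -fE.
apply: (indep_Rintegral_bound indX).
- by move=> i; rewrite !inE.
- have mb : measurable_fun setT (fun z : sub_space X J * sub_space X J' =>
      \sum_(k | k != j) X (idx k) z.1 * x ord0 k).
    under eq_fun do rewrite big_mkcond.
    apply: measurable_sum => k; case: (boolP (k != j)) => kj; last exact: measurable_cst.
    apply: measurable_funM => //; apply: measurable_coord_fst.
    by rewrite !inE (inj_eq idx_inj).
  have ma : measurable_fun setT (fun z : sub_space X J * sub_space X J' => X (idx j) z.2).
    by apply: measurable_coord_snd; rewrite inE.
  have ml : measurable_fun setT (fun z : sub_space X J * sub_space X J' =>
      \sum_(k | k != j) X (idx k) z.1 * x ord0 k + X (idx j) z.2 * x ord0 j).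
    by apply: measurable_funD => //; exact: measurable_funM.
  apply: measurable_funB; apply: measurable_funM => //.
    exact: (measurableT_comp (measurable_smooth_sgn e) ml).
  exact: (measurableT_comp (measurable_smooth_sgn_deriv e) ml).
- under eq_fun do rewrite fE.
  by apply: rintB => //; exact: rintZ.
- move=> w; rewrite /f/=.
  rewrite (Rintegral_law (lawX j) (measurable_stein_diff e (x ord0 j) _)).
  exact: stein_one_dim.
- move=> w; rewrite /f/=.
  exact: (rint_law (lawX j) (@rint_stein_diff _ _ var1 e (x ord0 j) _ e0)).
Qed.

Lemma Rintegral_linformM (h : T -> R) z :
  measurable_fun setT h -> (forall w, `|h w| <= 1) ->
  \int[P]_w (h w * linform z w) = \sum_j z ord0 j * \int[P]_w (h w * a j w).
Proof.
move=> mh h1.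
have ih j : rint P (fun w => h w * a j w) by apply: rintM_bounded => //; exact: rint_coord.
transitivity (\int[P]_w (\sum_j z ord0 j * (h w * a j w))).
  apply: eq_Rintegral => w _; rewrite linformE mulr_sumr; apply: eq_bigr => j _; ring.
rewrite Rintegral_sumT => [|j]; last exact: rintZ.
by apply: eq_bigr => j _; rewrite (RintegralZl _ _ (ih j)).
Qed.

Let M0 : 0 <= M := le_trans ler01 M1.

Let mW : measurable_fun setT (linform x) := measurable_linform x.

Let mS : measurable_fun setT (fun w => sgn (linform x w)).
Proof. exact: (measurableT_comp measurable_sgn mW). Qed.

Let mH e : measurable_fun setT (fun w => smooth_sgn e (linform x w)).
Proof. exact: (measurableT_comp (measurable_smooth_sgn e) mW). Qed.

Let mH' e : measurable_fun setT (fun w => smooth_sgn_deriv e (linform x w)).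
Proof. exact: (measurableT_comp (measurable_smooth_sgn_deriv e) mW). Qed.

Let rint_deriv e : 0 < e -> rint P (fun w => smooth_sgn_deriv e (linform x w)).
Proof.
move=> e0; apply: (@rint_bounded _ _ _ P _ e^-1) => // w.
by rewrite ger0_norm ?smooth_sgn_deriv_ge0// smooth_sgn_deriv_le.
Qed.

Let sgn_bound (y : R) : `|sgn y| <= 1.
Proof. by rewrite /sgn; case: ifP => _; rewrite ?normrN normr1. Qed.

Variable Xi : R.
Hypothesis xXi : forall j, `|x ord0 j| <= Xi.

(** Coordinate errors are cubic in [x_j]: two factors are bounded by [Xi], the third is paired with
    [z_j] by Cauchy-Schwarz, so the dimension does not enter. *)
Lemma stein_linform (e : R) z : 0 < e ->
  `|\int[P]_w (smooth_sgn e (linform x w) * linform z w)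
    - dotv x z * \int[P]_w smooth_sgn_deriv e (linform x w)|
  <= 2 * M * Xi ^+ 2 / e ^+ 3 * (norm2 x * norm2 z).
Proof.
move=> e0; rewrite Rintegral_linformM//; last by move=> w; exact: smooth_sgn_bound.
set D := \int[P]_w smooth_sgn_deriv _ _.
have -> : dotv x z * D = \sum_j z ord0 j * (x ord0 j * D).
  by rewrite mulr_suml; apply: eq_bigr => j _; ring.
rewrite -sumrB; apply: le_trans (ler_norm_sum _ _ _) _.
have C0 : 0 <= 2 * M * Xi ^+ 2 / e ^+ 3.
  apply: divr_ge0; last by rewrite exprn_ge0// ltW.
  by apply: mulr_ge0; [exact: mulr_ge0|exact: sqr_ge0].
apply: (@le_trans _ _ (\sum_j 2 * M * Xi ^+ 2 / e ^+ 3 * (`|x ord0 j| * `|z ord0 j|))).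
  apply: ler_sum => j _; rewrite -mulrBr normrM.
  apply: le_trans (ler_wpM2l (normr_ge0 _) (stein_coord j e0)) _.
  have -> : `|z ord0 j| * (2 * M * `|x ord0 j| ^+ 3 / e ^+ 3) =
      2 * M * `|x ord0 j| ^+ 2 / e ^+ 3 * (`|x ord0 j| * `|z ord0 j|).
    by field; rewrite gt_eqF.
  apply: ler_wpM2r; first exact: mulr_ge0.
  rewrite ler_pM2r ?invr_gt0 ?exprn_gt0// ler_wpM2l//; first exact: mulr_ge0.
  by rewrite ler_pXn2r ?nnegrE// (le_trans _ (xXi j)).
rewrite -mulr_sumr ler_wpM2l//.
pose nx : 'rV[R]_n := \row_j `|x ord0 j|; pose nz : 'rV[R]_n := \row_j `|z ord0 j|.
have nE (u : 'rV[R]_n) : norm2 (\row_j `|u ord0 j|) = norm2 u.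
  by congr Num.sqrt; apply: eq_bigr => j _; rewrite !mxE -!expr2 real_normK ?num_real.
have := cauchy_schwarz nx nz; rewrite !nE; apply: le_trans.
by rewrite le_eqVlt; apply/orP; left; apply/eqP; apply: eq_bigr => j _; rewrite !mxE.
Qed.

Definition sign_vec : 'rV[R]_n := \row_j \int[P]_w (sgn (linform x w) * a j w).

Lemma dotv_sign_vec z : dotv sign_vec z = \int[P]_w (sgn (linform x w) * linform z w).
Proof.
rewrite Rintegral_linformM//; apply: eq_bigr => j _.
by rewrite mxE mulrC.
Qed.

Lemma dotv_sign_vec_self : dotv sign_vec x = \int[P]_w `|linform x w|.
Proof. by rewrite dotv_sign_vec; apply: eq_Rintegral => w _; rewrite sgn_abs. Qed.

Hypothesis x1 : norm2 x = 1.

Let EW2 : \int[P]_w (linform x w ^+ 2) = 1.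
Proof. by rewrite Rintegral_linform_sqr x1 expr1n. Qed.

Let rintHW e : rint P (fun w => smooth_sgn e (linform x w) * linform x w).
Proof.
apply: rintM_bounded => //; last exact: rint_linform.
by move=> w; exact: smooth_sgn_bound.
Qed.

Let rint_absW : rint P (fun w => `|linform x w|).
Proof. exact: integrable_norm (rint_linform x). Qed.

Let dotxx : dotv x x = 1.
Proof. by rewrite -sqr_norm2 x1 expr1n. Qed.

Lemma EHW_le e : 0 < e ->
  \int[P]_w (smooth_sgn e (linform x w) * linform x w) <= dotv sign_vec x.
Proof.
move=> e0; rewrite dotv_sign_vec_self; apply: Rintegral_mono => //.
by move=> w; exact: smooth_sgn_mul_le.
Qed.

Lemma sign_vec_self_le1 : dotv sign_vec x <= 1.
Proof.
rewrite dotv_sign_vec_self.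
have i2 : rint P (fun w => 2^-1 * linform x w ^+ 2) := rintZ _ (rint_linform_sqr x).
apply: (@le_trans _ _ (\int[P]_w (2^-1 + 2^-1 * linform x w ^+ 2))).
  apply: Rintegral_mono => //; first by apply: rintD => //; exact: rint_cst.
  move=> w; have := sqr_ge0 (`|linform x w| - 1).
  by rewrite sqrrB real_normK ?num_real//; lra.
rewrite (RintegralD _ (rint_cst _ _) i2)// RintegralcstT.
by rewrite (RintegralZl _ _ (rint_linform_sqr x))// EW2; lra.
Qed.

(** Smoothing at scale 1 here, unlike in the orthogonal estimate. The mean derivative is at least
    1/4: [smooth_sgn_deriv 1 y >= 3/8 - y^2 / 8], a consequence of [(y^2 - 1)^2 >= 0], and [<a, x>]
    has second moment 1. The Stein error costs at most 1/8. *)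
Lemma sign_vec_self_ge : 2 * M * Xi ^+ 2 <= 8^-1 -> 8^-1 <= dotv sign_vec x.
Proof.
move=> small; apply: le_trans (EHW_le ltr01).
have := stein_linform x ltr01; rewrite expr1n divr1 x1 dotxx mul1r !mulr1.
set A := \int[P]_w _; set B := \int[P]_w _ => h.
have hB : 4^-1 <= B.
  have i2 : rint P (fun w => (8^-1) * linform x w ^+ 2) := rintZ _ (rint_linform_sqr x).
  have -> : 4^-1 = \int[P]_w (3 / 8 - 8^-1 * linform x w ^+ 2).
    rewrite (RintegralB _ (rint_cst _ _) i2)// RintegralcstT.
    by rewrite (RintegralZl _ _ (rint_linform_sqr x))// EW2; lra.
  apply: Rintegral_mono.
  - by apply: rintB => //; exact: rint_cst.
  - exact: rint_deriv.
  move=> w; rewrite /smooth_sgn_deriv !divr1 /ckernel; set y := linform x w.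
  have /andP[p1 p2] := @two_div_pi_bounds R.
  have y0 : 0 < 1 + y ^+ 2 by rewrite ltr_wpDr// sqr_ge0.
  rewrite ler_pdivlMr//; have := sqr_ge0 (y ^+ 2 - 1); nra.
by move: h; rewrite ler_norml => /andP[h1 h2]; lra.
Qed.

(** For the component [z] orthogonal to [x], [|z|^2 = E sgn(<a, x>) <a, z>]. Replacing [sgn] by its
    smoothing costs the mean squared error plus [|z|^2 / 4]; the smoothed term is at most [del |z|]
    since [x] and [z] are orthogonal. The squared error is [4 e] times the mean derivative, and
    Stein applied to [x] itself bounds that mean by [1 + del]. *)
Lemma sign_vec_orth (e del : R) : 0 < e -> del = 2 * M * Xi ^+ 2 / e ^+ 3 ->
  norm2 (sign_vec - dotv sign_vec x *: x) ^+ 2 <= 8 * e * (1 + del) + 2 * del ^+ 2.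
Proof.
move=> e0 delE; set lam := dotv sign_vec x; set z := sign_vec - lam *: x.
have zx : dotv x z = 0 by rewrite dotvBr dotvZr dotxx mulr1 dotvC subrr.
have zz : norm2 z ^+ 2 = \int[P]_w (sgn (linform x w) * linform z w).
  by rewrite -dotv_sign_vec sqr_norm2 {1}/z dotvBl dotvZl zx mulr0 subr0.
have iHV : rint P (fun w => smooth_sgn e (linform x w) * linform z w).
  apply: rintM_bounded => //; last exact: rint_linform.
  by move=> w; exact: smooth_sgn_bound.
have iSV : rint P (fun w => sgn (linform x w) * linform z w).
  by apply: rintM_bounded => //; exact: rint_linform.
have iV2 : rint P (fun w => 4^-1 * linform z w ^+ 2) := rintZ _ (rint_linform_sqr z).
have iD : rint P (fun w => 4 * e * smooth_sgn_deriv e (linform x w)) := rintZ _ (rint_deriv e0).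
have step : norm2 z ^+ 2 <= 4 * e * \int[P]_w smooth_sgn_deriv e (linform x w)
    + 4^-1 * norm2 z ^+ 2 + \int[P]_w (smooth_sgn e (linform x w) * linform z w).
  rewrite {1}zz -(Rintegral_linform_sqr z).
  rewrite -(RintegralZl _ _ (rint_deriv e0))// -(RintegralZl _ _ (rint_linform_sqr z))//.
  rewrite -(RintegralD _ iD iV2)// -(RintegralD _ (rintD iD iV2) iHV)//.
  apply: Rintegral_mono => //; first exact: (rintD (rintD iD iV2) iHV).
  move=> w; set y := linform x w; set v := linform z w.
  have h1 := smooth_sgn_error y e0.
  have h2 : 2 * ckernel (y / e) <= 4 * e * smooth_sgn_deriv e y.
    have /andP[p1 p2] := @two_div_pi_bounds R.
    have -> : 4 * e * smooth_sgn_deriv e y = (4 * (2 / pi)) * ckernel (y / e).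
      by rewrite /smooth_sgn_deriv; move: (2 / pi) => c; field; rewrite gt_eqF.
    by rewrite ler_wpM2r ?(ltW (ckernel_gt0 _))//; lra.
  have := sqr_ge0 ((sgn y - smooth_sgn e y) - v / 2); nra.
have hx := stein_linform x e0; rewrite dotxx x1 mul1r !mulr1 -delE in hx.
have hz := stein_linform z e0; rewrite zx mul0r subr0 x1 mul1r -delE in hz.
have hl := EHW_le e0; have hl1 := sign_vec_self_le1.
move: step hx hz hl; set A := \int[P]_w _; set B := \int[P]_w _; set C := \int[P]_w _.
rewrite !ler_norml => step /andP[hx1 hx2] /andP[hz1 hz2] hl.
have hA : A <= 1 + del by lra.
have := ler_wpM2l (ltW e0) hA.
have := sqr_ge0 (del - norm2 z / 2); nra.
Qed.

End stein.

(** * Symmetrization *)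

Lemma expR_convex {R : realType} (a s t : R) : 0 <= a <= 1 ->
  expR (a * s + (1 - a) * t) <= a * expR s + (1 - a) * expR t.
Proof.
move=> /andP[a0 a1]; set c := a * s + (1 - a) * t.
have tangent r : expR c * (1 + (r - c)) <= expR r.
  have := expR_ge1Dx (r - c); rewrite expRD expRN ler_pdivlMr ?expR_gt0//.
  by rewrite mulrC.
have h1 := ler_wpM2l a0 (tangent s).
have h2 : (1 - a) * (expR c * (1 + (t - c))) <= (1 - a) * expR t.
  by apply: ler_wpM2l (tangent t); lra.
apply: le_trans (lerD h1 h2); rewrite le_eqVlt; apply/orP; left; apply/eqP.
by rewrite {3 5}/c; ring.
Qed.

Lemma borel_rV_comp {R : realType} {n : nat} (g : 'rV[R]_n -> R) d (T : measurableType d)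
    (v : T -> 'rV[R]_n) :
  borel_rV g -> (forall j, measurable_fun setT (fun w => v w ord0 j)) ->
  measurable_fun setT (fun w => g (v w)).
Proof.
move=> bg mv; rewrite (_ : (fun w => g (v w)) = fun w => g (\row_j v w ord0 j)).
  exact: bg.
by apply/funext => w; congr g; apply/rowP => j; rewrite mxE.
Qed.

Lemma ge0_integral_half d (T : measurableType d) (R : realType) (P : probability T R)
    (f g : T -> \bar R) :
  measurable_fun [set: T] f -> (forall w, 0 <= f w)%E ->
  measurable_fun [set: T] g -> (forall w, 0 <= g w)%E ->
  (\int[P]_w (2^-1%:E * (f w + g w)) =
   2^-1%:E * (\int[P]_w f w + \int[P]_w g w))%E.
Proof.
move=> mf f0 mg g0; rewrite ge0_integralZl//.
- by rewrite ge0_integralD.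
- exact: emeasurable_funD.
- by move=> w _; exact: adde_ge0.
Qed.

(** * Exponential of the width and its symmetrization *)

Section exp_width.
Context {R : realType} {n : nat} (K : set 'rV[R]_n).
Hypotheses (K0 : K !=set0) (K1 : forall v, K v -> norm2 v <= 1).
Variable l : R.
Hypothesis l0 : 0 <= l.

Definition exp_width (v : 'rV[R]_n) : R := expR (l * width_fun K v).

Lemma exp_width_ge0 v : 0 <= exp_width v. Proof. exact: expR_ge0. Qed.

Lemma borel_width : borel_rV (width_fun K).
Proof. by move=> d T Y mY; apply: lip1_measurable (width_fun_lip1 K0 K1) mY. Qed.

Lemma borel_exp_width : borel_rV exp_width.
Proof.
move=> d T Y mY; apply: measurableT_comp => //.
by apply: measurable_funM => //; exact: borel_width.
Qed.

Lemma exp_width_convex (a : R) u v : 0 <= a <= 1 ->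
  exp_width (a *: u + (1 - a) *: v) <= a * exp_width u + (1 - a) * exp_width v.
Proof.
move=> a01; apply: le_trans (expR_convex _ _ a01); rewrite ler_expR.
have /andP[a0 a1] := a01.
have h := width_funD K0 K1 (a *: u) ((1 - a) *: v).
rewrite !(width_funZ K0 K1) in h; [|lra|lra].
by have := ler_wpM2l l0 h; lra.
Qed.

Section jensen_width.
Context d (T : measurableType d) (P : probability T R) (N : T -> 'rV[R]_n).
Hypothesis intN : forall j, rint P (fun w => N w ord0 j).

Definition mean_rV : 'rV[R]_n := \row_j \int[P]_w N w ord0 j.

Lemma rint_dotv u : rint P (fun w => dotv (N w) u).
Proof.
rewrite (_ : (fun w => _) = fun w => \sum_j u ord0 j * N w ord0 j); last first.
  by apply/funext => w; apply: eq_bigr => j _; rewrite mulrC.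
by apply: rint_sum => j; exact: rintZ.
Qed.

Lemma dotv_mean u : dotv mean_rV u = \int[P]_w dotv (N w) u.
Proof.
transitivity (\int[P]_w (\sum_j u ord0 j * N w ord0 j)); last first.
  by apply: eq_Rintegral => w _; apply: eq_bigr => j _; rewrite mulrC.
rewrite Rintegral_sumT => [|j]; last exact: rintZ.
by apply: eq_bigr => j _; rewrite mxE (RintegralZl _ _ (intN j))// mulrC.
Qed.

Lemma measurable_exp_width_sub c :
  measurable_fun setT (fun w => exp_width (c - N w)).
Proof.
apply: (borel_rV_comp borel_exp_width) => j.
under eq_fun do rewrite !mxE.
by apply: measurable_funB => //; exact: rint_measurable (intN j).
Qed.

(* [exp_width] is a supremum of exponentials of linear forms, to each of which
   the scalar Jensen inequality applies. *)
Lemma jensen_exp_width c :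
  ((exp_width (c - mean_rV))%:E <= \int[P]_w (exp_width (c - N w))%:E)%E.
Proof.
have [->|fin] := eqVneq (\int[P]_w (exp_width (c - N w))%:E)%E +oo%E; first exact: leey.
have I0 : (0 <= \int[P]_w (exp_width (c - N w))%:E)%E.
  by apply: integral_ge0 => w _; rewrite lee_fin expR_ge0.
pose r := fine (\int[P]_w (exp_width (c - N w))%:E)%E.
have rE : (\int[P]_w (exp_width (c - N w))%:E = r%:E)%E.
  by rewrite fineK// ge0_fin_numE// ltey.
have H u : minkdiff K u -> expR (l * dotv (c - mean_rV) u) <= r.
  move=> Ku; pose h w := l * dotv (c - N w) u.
  have iB : rint P (fun w => dotv (c - N w) u).
    rewrite (_ : (fun w => _) = fun w => dotv c u - dotv (N w) u).
      exact: (rintB (rint_cst _ _) (rint_dotv u)).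
    by apply/funext => w; rewrite dotvBl.
  have ih : rint P h := rintZ l iB.
  have Eh : \int[P]_w h w = l * dotv (c - mean_rV) u.
    rewrite (RintegralZl _ _ iB)//.
    under eq_Rintegral do rewrite dotvBl.
    by rewrite (RintegralB _ (rint_cst _ _) (rint_dotv u))// RintegralcstT dotvBl dotv_mean.
  rewrite -lee_fin -rE -Eh; apply: le_trans (jensen_expR ih) _.
  have mh := rint_measurable ih.
  apply: ge0_le_integral => //.
  - by apply/measurable_EFinP; exact: measurableT_comp.
  - by apply/measurable_EFinP; exact: measurable_exp_width_sub.
  - by move=> w _; rewrite lee_fin ler_expR ler_wpM2l// dotv_le_width.
have r0 : 0 < r by apply: lt_le_trans (H _ (minkdiff0 K0)); exact: expR_gt0.
rewrite rE lee_fin /exp_width -(lnK r0) ler_expR -(width_funZ K0 K1)//.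
apply: width_fun_le => // u Ku; rewrite dotvZl -ler_expR lnK//; exact: H.
Qed.

(** Jensen replaces the mean by an independent copy [N']; then [b + N - N'] is the midpoint of
    [b + 2 N] and [b - 2 N'], and convexity separates the two. *)
Lemma symmetrization_step b :
  (\int[P]_w (exp_width (b + (N w - mean_rV)))%:E <=
   2^-1%:E * (\int[P]_w (exp_width (b + 2 *: N w))%:E
     + \int[P]_w (exp_width (b - 2 *: N w))%:E))%E.
Proof.
have mN j := rint_measurable (intN j).
have measurableEFin (f : T -> R) : measurable_fun setT f ->
    measurable_fun [set: T] (fun w => (f w)%:E) by move=> ?; exact/measurable_EFinP.
have mp (s : R) c : measurable_fun setT (fun w => exp_width (c + s *: N w)).
  apply: (borel_rV_comp borel_exp_width) => j.
  under eq_fun do rewrite !mxE.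
  by apply: measurable_funD => //; exact: measurable_funM.
have mpp := mp 2 b.
have mpm : measurable_fun setT (fun w => exp_width (b - 2 *: N w)).
  by under eq_fun do rewrite -scaleNr; exact: mp.
pose Im := (\int[P]_w (exp_width (b - 2 *: N w))%:E)%E.
have Im0 : (0 <= Im)%E by apply: integral_ge0 => w _; rewrite lee_fin exp_width_ge0.
have mcst (r : \bar R) : measurable_fun [set: T] (fun=> r) by exact: measurable_cst.
have mpmE := measurableEFin _ mpm; have mppE := measurableEFin _ mpp.
rewrite -[X in (_ + X)%E]/Im.
have cstE (r : \bar R) : (\int[P]_w r = r)%E.
  by rewrite integral_cst//= probability_setT mule1.
have step w : ((exp_width (b + (N w - mean_rV)))%:E <=
    2^-1%:E * ((exp_width (b + 2 *: N w))%:E + Im))%E.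
  rewrite addrA; apply: le_trans (jensen_exp_width _) _.
  rewrite -[X in (X + Im)%E]cstE /Im.
  rewrite -(ge0_integral_half P (mcst _) _ mpmE _).
  apply: ge0_le_integral; first by [].
  - by move=> w' _; rewrite lee_fin exp_width_ge0.
  - by apply/measurable_EFinP; exact: measurable_exp_width_sub.
  - apply: measurable_funeM; apply: emeasurable_funD; first exact: measurable_cst.
    exact: mpmE.
  - move=> w' _; rewrite -EFinD -EFinM lee_fin mulrDr.
    have h01 : 0 <= (2^-1 : R) <= 1 by lra.
    have := exp_width_convex (b + 2 *: N w) (b - 2 *: N w') h01.
    have -> : 1 - 2^-1 = 2^-1 :> R by lra.
    suff -> : 2^-1 *: (b + 2 *: N w) + 2^-1 *: (b - 2 *: N w') = b + N w - N w' by [].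
    by apply/rowP => j; rewrite !mxE; field.
  - by move=> _; rewrite lee_fin exp_width_ge0.
  - by move=> w'; rewrite lee_fin exp_width_ge0.
rewrite -[X in (_ + X)%E]cstE.
rewrite -(ge0_integral_half P mppE _ (mcst _) _).
- apply: ge0_le_integral; first by [].
  + by move=> w _; rewrite lee_fin exp_width_ge0.
  + apply/measurable_EFinP; apply: (borel_rV_comp borel_exp_width) => j.
    under eq_fun do rewrite !mxE.
    by apply: measurable_funD => //; exact: measurable_funB.
  + apply: measurable_funeM; apply: emeasurable_funD; last exact: measurable_cst.
    exact: mppE.
  + by move=> w _; exact: step.
- by move=> w; rewrite lee_fin exp_width_ge0.
- by move=> _.
Qed.

End jensen_width.
End exp_width.

(** * Removing the noise and the signs, one row at a time *)

Section one_bit_measurements.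
Context d (T : measurableType d) (R : realType) (P : probability T R) (m n : nat).
Variables (A : 'I_m -> 'I_n -> {RV P >-> R}) (eps : 'I_m -> {RV P >-> R}).
Variable x : 'rV[R]_n.

Definition measurement_family (k : ('I_m * 'I_n) + 'I_m) : {RV P >-> R} :=
  match k with inl ij => A ij.1 ij.2 | inr i => eps i end.

Hypothesis indX : mutually_independent measurement_family.

(* Total sign of the noise: it agrees with [eps i] almost surely and takes only
   the values [1] and [-1], so that no "almost everywhere" is needed below. *)
Definition pm (t : R) : R := if t == 1 then 1 else -1.

Lemma pm_cases t : pm t = 1 \/ pm t = -1.
Proof. by rewrite /pm; case: ifP => _; [left|right]. Qed.

Lemma sgn_cases (t : R) : sgn t = 1 \/ sgn t = -1.
Proof. by rewrite /sgn; case: ifP => _; [left|right]. Qed.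

Lemma measurable_pm : measurable_fun setT pm.
Proof. by apply: measurable_fun_ifT => //; exact: measurable_fun_eqr. Qed.

Definition obs (i : 'I_m) (w : T) : 'rV[R]_n :=
  (pm (eps i w) * sgn (dotv (rvec (A i) w) x)) *: rvec (A i) w.

Lemma obs_cases i w : obs i w = rvec (A i) w \/ obs i w = - rvec (A i) w.
Proof.
rewrite /obs; have [->|->] := pm_cases (eps i w);
  have [->|->] := sgn_cases (dotv (rvec (A i) w) x).
- by left; rewrite mulr1 scale1r.
- by right; rewrite mul1r scaleN1r.
- by right; rewrite mulr1 scaleN1r.
- by left; rewrite mulrNN mulr1 scale1r.
Qed.

(** Stated along a map [phi] so that it applies both to [T] and to a [sub_space], where [phi] is the
    identity but the sigma-algebra is smaller. *)
Lemma measurable_obs d1 (T1 : measurableType d1) (phi : T1 -> T) i :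
  (forall j, measurable_fun setT (fun z => A i j (phi z))) ->
  measurable_fun setT (fun z => eps i (phi z)) ->
  forall j, measurable_fun setT (fun z => obs i (phi z) ord0 j).
Proof.
move=> mA me j; under eq_fun do rewrite !mxE.
apply: measurable_funM => //; apply: measurable_funM.
  exact: (measurableT_comp measurable_pm me).
apply: (measurableT_comp measurable_sgn); apply: measurable_sum => k.
by under eq_fun do rewrite mxE; exact: measurable_funM.
Qed.

Hypothesis intA : forall i j, rint P (A i j).

Lemma rint_obs i j : rint P (fun w => obs i w ord0 j).
Proof.
apply: (@rint_le _ _ _ P _ (fun w => `|A i j w|)).
- exact: (@measurable_obs _ T id).
- move=> w; have [->|->] := obs_cases i w; rewrite !mxE ?normrN//.
- exact: integrable_norm (intA i j).
Qed.

(** The block of all variables that [obs i] depends on: the entries of row [i] together with its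
    noise. *)
Definition row_index (i : 'I_m) : {set ('I_m * 'I_n) + 'I_m} :=
  [set k | match k with inl ij => ij.1 == i | inr i' => i' == i end]%SET.

Variable Phi : 'rV[R]_n -> R.
Hypotheses (borel_Phi : borel_rV Phi) (Phi_ge0 : forall v, 0 <= Phi v).
Hypothesis Phi_symmetrization : forall N : T -> 'rV[R]_n,
  (forall j, rint P (fun w => N w ord0 j)) -> forall b,
  (\int[P]_w (Phi (b + (N w - mean_rV P N)))%:E <=
   2^-1%:E * (\int[P]_w (Phi (b + 2 *: N w))%:E
     + \int[P]_w (Phi (b - 2 *: N w))%:E))%E.
Local Notation other i := (~: row_index i)%SET.

Lemma row_integral_split i (b h : T -> 'rV[R]_n) :
  (forall j, measurable_fun setT (fun z : sub_space measurement_family (other i) => b z ord0 j)) ->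
  (forall j, measurable_fun setT (fun z : sub_space measurement_family (row_index i) => h z ord0 j)) ->
  (\int[P]_w (Phi (b w + h w))%:E = \int[P]_w \int[P]_w' (Phi (b w + h w'))%:E)%E.
Proof.
move=> mb mh.
apply: (@indep_ge0_integral _ _ _ _ _ _ indX (other i) (row_index i)
  (fun z => (Phi (b z.1 + h z.2))%:E)).
- by move=> k; rewrite inE.
- apply/measurable_EFinP; apply: (borel_rV_comp borel_Phi) => j.
  under eq_fun do rewrite mxE; apply: measurable_funD.
    by apply: (measurableT_comp (mb j)); exact: measurable_fst.
  by apply: (measurableT_comp (mh j)); exact: measurable_snd.
- by move=> z; rewrite lee_fin Phi_ge0.
Qed.

Lemma measurable_inner_integral (b h : T -> 'rV[R]_n) :
  (forall j, measurable_fun setT (fun w => b w ord0 j)) ->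
  (forall j, measurable_fun setT (fun w => h w ord0 j)) ->
  measurable_fun [set: T] (fun w => \int[P]_w' (Phi (b w + h w'))%:E)%E.
Proof.
move=> mb mh.
have mf : measurable_fun setT (fun z : T * T => (Phi (b z.1 + h z.2))%:E).
  apply/measurable_EFinP; apply: (borel_rV_comp borel_Phi) => j.
  under eq_fun do rewrite mxE; apply: measurable_funD.
    by apply: (measurableT_comp (mb j)); exact: measurable_fst.
  by apply: (measurableT_comp (mh j)); exact: measurable_snd.
apply: (measurable_fun_fubini_tonelli_F (m2 := P) _ mf) => z.
by rewrite lee_fin Phi_ge0.
Qed.

(** The symmetrized bound is even in the observation, and [obs i] is the row up to sign; hence the
    noise and the dependence on [x] disappear. *)
Lemma obs_symmetrization i b :
  (\int[P]_w (Phi (b + (obs i w - mean_rV P (obs i))))%:E <=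
   2^-1%:E * (\int[P]_w (Phi (b + 2 *: rvec (A i) w))%:E
     + \int[P]_w (Phi (b + (- 2) *: rvec (A i) w))%:E))%E.
Proof.
apply: le_trans (Phi_symmetrization (rint_obs i) b) _.
have mPhi (h : T -> 'rV[R]_n) s : (forall j, measurable_fun setT (fun w => h w ord0 j)) ->
    measurable_fun [set: T] (fun w => (Phi (b + s *: h w))%:E).
  move=> mh; apply/measurable_EFinP; apply: (borel_rV_comp borel_Phi) => j.
  by under eq_fun do rewrite !mxE; apply: measurable_funD => //; exact: measurable_funM.
have mobs j : measurable_fun setT (fun w => obs i w ord0 j).
  by apply: (@measurable_obs _ T id) => *; exact: measurable_funP.
have mrow j : measurable_fun setT (fun w => rvec (A i) w ord0 j).
  by under eq_fun do rewrite mxE; exact: measurable_funP.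
have pos (h : T -> 'rV[R]_n) s w : (0 <= (Phi (b + s *: h w))%:E)%E.
  by rewrite lee_fin Phi_ge0.
under [X in (_ + X)%E]eq_integral do rewrite -scaleNr.
rewrite -(ge0_integral_half P (mPhi _ 2 mobs) (pos _ _) (mPhi _ (- 2) mobs) (pos _ _)).
rewrite -(ge0_integral_half P (mPhi _ 2 mrow) (pos _ _) (mPhi _ (- 2) mrow) (pos _ _)).
rewrite le_eqVlt; apply/orP; left; apply/eqP; congr (integral _ _ _); apply/funext => w.
have [->|->] := obs_cases i w; first by [].
by rewrite !scalerN !scaleNr opprK addeC.
Qed.

Definition hybrid (k : nat) (r : 'I_m -> R) (i : 'I_m) (w : T) : 'rV[R]_n :=
  if (i < k)%N then (2 * r i) *: rvec (A i) w else obs i w - mean_rV P (obs i).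

(** Row [k] is independent of the rest of the hybrid sum, so it can be symmetrized with the others
    frozen. The result is an average over two signs, and keeping the sign with the larger integral
    makes the choice deterministic. *)
Lemma symmetrization_signs k : (k <= m)%N ->
  exists r : 'I_m -> R, (forall i, r i = 1 \/ r i = -1) /\
  (\int[P]_w (Phi (\sum_i (obs i w - mean_rV P (obs i))))%:E <=
   \int[P]_w (Phi (\sum_i hybrid k r i w))%:E)%E.
Proof.
elim: k => [_|k IH km].
  exists (fun=> 1); split; first by left.
  by rewrite le_eqVlt; apply/orP; left; apply/eqP; apply: eq_integral => w _.
have [r [r1 hr]] := IH (ltnW km); pose i := Ordinal km.
pose b w := \sum_(i' | i' != i) hybrid k r i' w.
pose r' s i' := if i' == i then s else r i'.
have splitE s w : \sum_i' hybrid k.+1 (r' s) i' w = b w + (2 * s) *: rvec (A i) w.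
  rewrite (bigD1 i)//= addrC; congr (_ + _); last by rewrite /hybrid/= ltnSn /r' eqxx.
  apply: eq_bigr => i' i'i; rewrite /hybrid /r' (negbTE i'i) ltnS leq_eqVlt.
  by rewrite -[(i' == k :> nat)]/(i' == i) (negbTE i'i).
have split0 w : \sum_i' hybrid k r i' w = b w + (obs i w - mean_rV P (obs i)).
  by rewrite (bigD1 i)//= addrC; congr (_ + _); rewrite /hybrid/= ltnn.
have mhyb d1 (T1 : measurableType d1) (phi : T1 -> T) i' :
    (forall j, measurable_fun setT (fun z => A i' j (phi z))) ->
    measurable_fun setT (fun z => eps i' (phi z)) ->
    forall j, measurable_fun setT (fun z => hybrid k r i' (phi z) ord0 j).
  move=> mA me j; rewrite /hybrid; case: (i' < k)%N; under eq_fun do rewrite !mxE.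
    exact: measurable_funM.
  apply: measurable_funB; last exact: measurable_cst.
  by have := measurable_obs mA me j; under eq_fun do rewrite !mxE.
have mb d1 (T1 : measurableType d1) (phi : T1 -> T) :
    (forall i' j, i' != i -> measurable_fun setT (fun z => A i' j (phi z))) ->
    (forall i', i' != i -> measurable_fun setT (fun z => eps i' (phi z))) ->
    forall j, measurable_fun setT (fun z => b (phi z) ord0 j).
  move=> mA me j; rewrite /b; under eq_fun do rewrite summxE big_mkcond.
  apply: measurable_sum => i'; case: (boolP (i' != i)) => i'i; last exact: measurable_cst.
  by apply: mhyb => [j'|]; [exact: mA|exact: me].
have mbT j : measurable_fun setT (fun w => b w ord0 j) by exact: (@mb _ T id).
have mbJ j : measurable_fun setT
    (fun z : sub_space measurement_family (other i) => b z ord0 j).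
  apply: (@mb _ (sub_space measurement_family (other i)) id) => [i' j'|i'] i'i.
    by apply: (@sub_space_coord _ _ _ _ _ measurement_family _ (inl (i', j'))); rewrite !inE.
  by apply: (@sub_space_coord _ _ _ _ _ measurement_family _ (inr i')); rewrite !inE.
have mAJ j : measurable_fun setT
    (fun z : sub_space measurement_family (row_index i) => A i j z).
  by apply: (@sub_space_coord _ _ _ _ _ measurement_family _ (inl (i, j))); rewrite !inE.
have meJ : measurable_fun setT
    (fun z : sub_space measurement_family (row_index i) => eps i z).
  by apply: (@sub_space_coord _ _ _ _ _ measurement_family _ (inr i)); rewrite !inE.
have mobsJ j : measurable_fun setT
    (fun z : sub_space measurement_family (row_index i) => (obs i z - mean_rV P (obs i)) ord0 j).
  under eq_fun do rewrite mxE; apply: measurable_funD; last exact: measurable_cst.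
  exact: (@measurable_obs _ (sub_space measurement_family (row_index i)) id).
have mrowJ s j : measurable_fun setT
    (fun z : sub_space measurement_family (row_index i) => (s *: rvec (A i) z) ord0 j).
  by under eq_fun do rewrite !mxE; exact: measurable_funM.
have mrowT s j : measurable_fun setT (fun z : T => (s *: rvec (A i) z) ord0 j).
  by under eq_fun do rewrite !mxE; apply: measurable_funM => //; exact: measurable_funP.
pose I s := (\int[P]_w (Phi (\sum_i' hybrid k.+1 (r' s) i' w))%:E)%E.
have IE s : I s = (\int[P]_w \int[P]_w' (Phi (b w + (2 * s) *: rvec (A i) w'))%:E)%E.
  rewrite /I -(row_integral_split mbJ (mrowJ (2 * s))).
  by apply: eq_integral => w _; rewrite splitE.
have key : (\int[P]_w (Phi (\sum_i' hybrid k r i' w))%:E <= 2^-1%:E * (I 1%R + I (- 1)%R))%E.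
  rewrite !IE mulr1 mulrN1.
  rewrite -(ge0_integral_half P (measurable_inner_integral mbT (mrowT 2)) _
    (measurable_inner_integral mbT (mrowT (-2))) _).
  - have -> : (\int[P]_w (Phi (\sum_i' hybrid k r i' w))%:E =
        \int[P]_w \int[P]_w' (Phi (b w + (obs i w' - mean_rV P (obs i))))%:E)%E.
      rewrite -(row_integral_split mbJ mobsJ).
      by apply: eq_integral => w _; rewrite split0.
    apply: ge0_le_integral; first by [].
    + by move=> w _; apply: integral_ge0 => w' _; rewrite lee_fin Phi_ge0.
    + apply: measurable_inner_integral => // j.
      under eq_fun do rewrite mxE; apply: measurable_funD; last exact: measurable_cst.
      exact: (@measurable_obs _ T id).
    + apply: measurable_funeM; apply: emeasurable_funD;
        [exact: (measurable_inner_integral mbT (mrowT 2))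
        |exact: (measurable_inner_integral mbT (mrowT (-2)))].
    + by move=> w _; exact: obs_symmetrization.
  - by move=> w; apply: integral_ge0 => w' _; rewrite lee_fin Phi_ge0.
  - by move=> w; apply: integral_ge0 => w' _; rewrite lee_fin Phi_ge0.
have r'1 s : s = 1 \/ s = -1 -> forall i', r' s i' = 1 \/ r' s i' = -1.
  by move=> hs i'; rewrite /r'; case: ifP.
have avg (u v : \bar R) : (0 <= u)%E -> (u <= v)%E -> (2^-1%:E * (u + v) <= v)%E.
  move=> u0 uv; rewrite lee_pdivrMl//; apply: le_trans (leeD uv (lexx v)) _.
  by rewrite mule_natl mule2n.
have I0 s : (0 <= I s)%E by apply: integral_ge0 => w _; rewrite lee_fin Phi_ge0.
have [le1|/ltW le2] := leP (I 1) (I (-1)).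
  exists (r' (-1)); split; first by apply: r'1; right.
  by apply: le_trans hr (le_trans key _); exact: avg.
exists (r' 1); split; first by apply: r'1; left.
by apply: le_trans hr (le_trans key _); rewrite addeC; exact: avg.
Qed.

End one_bit_measurements.

(** * Comparison with a Gaussian vector *)

Section column_comparison.
Context d (T : measurableType d) (R : realType) (P : probability T R).
Context d' (T' : measurableType d') (Q : probability T' R) (n : nat).
Variable G : 'I_n -> {RV Q >-> R}.
Hypothesis gaussG : std_gaussian_vector G.
Context (I : finType) (X : I -> {RV P >-> R}).
Hypothesis indX : mutually_independent X.
Variables (col : 'I_n -> {set I}) (Z : 'I_n -> {RV P >-> R}).
Hypothesis disj_col : forall j k i, j != k -> i \in col j -> i \notin col k.
Hypothesis measurable_col : forall j (J : {set I}), col j \subset J ->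
  measurable_fun setT (Z j : sub_space X J -> R).
Variable sigma : R.
Hypotheses (sigma0 : 0 < sigma)
  (tailZ : forall j (t : R), 0 <= t ->
    (P [set w | (t <= `|Z j w|)%R] <= (2 * expR (- (t / sigma) ^+ 2))%:E)%E)
  (intZ : forall j, P.-integrable setT (EFin \o Z j))
  (EZ : forall j, (\int[P]_w (Z j w)%:E = 0)%E).
Variable u : 'rV[R]_n -> R.
Hypotheses (borel_u : borel_rV u) (u0 : forall v, 0 <= u v).
Hypothesis convex_u : forall (a : R) v w, 0 <= a <= 1 ->
  u (a *: v + (1 - a) *: w) <= a * u v + (1 - a) * u w.

Let s : R := 2 * domination_const * sigma.
Let s0 : 0 < s.
Proof.
have h := @domination_const_ge1 R; have h0 : 0 < domination_const :> R by lra.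
by rewrite /s mulr_gt0// mulr_gt0.
Qed.

Let F k v := (\int[Q]_w' (u (mix G k w' v))%:E)%E.
Let F0 k v : (0 <= F k v)%E.
Proof. by apply: integral_ge0 => w _; rewrite lee_fin. Qed.

Let measurable_F k d1 (T1 : measurableType d1) (Y : 'I_n -> T1 -> R) :
  (forall j, measurable_fun setT (Y j)) ->
  measurable_fun setT (fun z => F k (\row_j Y j z)).
Proof.
move=> mY.
have mf : measurable_fun setT (fun z : T1 * T' => (u (mix G k z.2 (\row_j Y j z.1)))%:E).
  apply/measurable_EFinP; apply: borel_u => j /=; case: (j < k)%N.
    by apply: measurableT_comp => //; exact: measurable_snd.
  under eq_fun do rewrite mxE.
  by apply: (measurableT_comp (mY j)); exact: measurable_fst.
apply: (measurable_fun_fubini_tonelli_F (m2 := Q) _ mf) => z.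
by rewrite lee_fin.
Qed.

Lemma mix_upd_convex k i w v : convex_real (fun t => u (mix G k w (upd v i t))).
Proof.
move=> a b c c01; apply: le_trans (convex_u _ _ c01).
rewrite le_eqVlt; apply/orP; left; apply/eqP; congr u; apply/rowP => j; rewrite !mxE.
by case: ifP => _; [ring|case: ifP => _ //; ring].
Qed.

(** After exchanging integrals, the Gaussian sample [w'] is fixed and only a convex function of one
    real variable remains, to which [convex_domination] applies. *)
Lemma column_domination (i : 'I_n) v :
  (\int[P]_w F i (upd v i (Z i w / s)) <= F i.+1 v)%E.
Proof.
have mu1 d1 (T1 : measurableType d1) (f : T1 -> T') (g : T1 -> R) :
    measurable_fun setT f -> measurable_fun setT g ->
    measurable_fun setT (fun z => (u (mix G i (f z) (upd v i (g z))))%:E).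
  move=> mf mg; apply/measurable_EFinP; apply: borel_u => j; case: (j < i)%N.
    by apply: measurableT_comp.
  under eq_fun do rewrite mxE.
  by case: (j == i); [exact: mg|exact: measurable_cst].
have mZs : measurable_fun setT (fun w => Z i w / s).
  by apply: measurable_funM => //; exact: measurable_cst.
have mPQ : measurable_fun setT
    (fun z : T * T' => (u (mix G i z.2 (upd v i (Z i z.1 / s))))%:E).
  apply: mu1; first exact: measurable_snd.
  by apply: (measurableT_comp mZs); exact: measurable_fst.
have mQQ : measurable_fun setT
    (fun z : T' * T' => (u (mix G i z.2 (upd v i (G i z.1))))%:E).
  apply: mu1; first exact: measurable_snd.
  by apply: measurableT_comp; [exact: measurable_funP|exact: measurable_fst].
have posPQ z : (0 <= (fun z : T * T' => (u (mix G i z.2 (upd v i (Z i z.1 / s))))%:E) z)%E.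
  by rewrite lee_fin.
have posQQ z : (0 <= (fun z : T' * T' => (u (mix G i z.2 (upd v i (G i z.1))))%:E) z)%E.
  by rewrite lee_fin.
rewrite /F (integral_mixS gaussG i v borel_u u0).
have [_ lawG] := gaussG.
rewrite -(ge0_integral_gauss_law (lawG i)); last 2 first.
- exact: measurable_integral_mix.
- by move=> t; apply: integral_ge0 => w _; rewrite lee_fin.
rewrite (fubini_tonelli (m1 := P) (m2 := Q) _ mPQ posPQ).
rewrite (fubini_tonelli (m1 := Q) (m2 := Q) _ mQQ posQQ).
apply: ge0_le_integral; first by [].
- by move=> w' _; apply: integral_ge0 => w _; rewrite lee_fin.
- exact: (measurable_fun_fubini_tonelli_G (m1 := P) _ mPQ posPQ).
- exact: (measurable_fun_fubini_tonelli_G (m1 := Q) _ mQQ posQQ).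
move=> w' _.
(* Dividing by [s] inside [psi] cancels the rescaling of the Gaussian, leaving a standard one. *)
pose psi t := u (mix G i w' (upd v i (t / s))).
have mpsi : measurable_fun setT psi.
  apply/measurable_EFinP; apply: (mu1 _ R (fun=> w')); first exact: measurable_cst.
  by apply: measurable_funM => //; exact: measurable_cst.
have cpsi : convex_real psi.
  move=> a b c c01; rewrite /psi mulrDl -!mulrA; exact: mix_upd_convex.
apply: le_trans (convex_domination sigma0 (tailZ i) (intZ i) (EZ i) mpsi (fun=> u0 _) cpsi) _.
rewrite -/s le_eqVlt; apply/orP; left; apply/eqP.
rewrite (ge0_integral_gauss_law (f := fun t => (u (mix G i w' (upd v i t)))%:E) (lawG i)).
- by apply: eq_integral => t _; rewrite /psi mulrAC divff ?mul1r// gt_eqF.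
- by apply: (mu1 _ (measurableTypeR R) (fun=> w')); [exact: measurable_cst|exact: measurable_id].
- by move=> t; rewrite lee_fin.
Qed.

(** Replacement in the style of Lindeberg, but with an inequality at each step: column [i] is
    integrated alone, independently of the remaining columns, and exchanged for a Gaussian
    coordinate. *)
Lemma gauss_domination :
  (\int[P]_w (u (\row_j (Z j w / s)))%:E <= \int[Q]_w (u (rvec G w))%:E)%E.
Proof.
pose xs w : 'rV[R]_n := \row_j (Z j w / s).
have mZs (J : {set I}) j : col j \subset J -> measurable_fun setT (fun w : sub_space X J => Z j w / s).
  by move=> jJ; apply: measurable_funM; [exact: measurable_col|exact: measurable_cst].
have step (i : 'I_n) : (\int[P]_w F i (xs w) <= \int[P]_w F i.+1 (xs w))%E.
  pose f (z : sub_space X (~: col i)%SET * sub_space X (col i)) : \bar R :=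
    F i (\row_j (if j == i then Z i z.2 / s else Z j z.1 / s)).
  have -> : (\int[P]_w F i (xs w) = \int[P]_w f (w, w))%E.
    apply: eq_integral => w _; congr (F i _); apply/rowP => j; rewrite !mxE.
    by case: eqP => // ->.
  rewrite (indep_ge0_integral indX); [|by move=> k; rewrite inE| |by move=> z; exact: F0].
  - have -> : (fun w => \int[P]_w' f (w, w'))%E =
        (fun w => \int[P]_w' F i (upd (xs w) i (Z i w' / s)))%E.
      apply/funext => w; apply: eq_integral => w' _; congr (F i _); apply/rowP => j.
      by rewrite !mxE.
    apply: ge0_le_integral; first by [].
    + by move=> w _; apply: integral_ge0 => w' _; exact: F0.
    + have mf : measurable_fun setT (fun z : T * T => F i (upd (xs z.1) i (Z i z.2 / s))).
        apply: measurable_F => j; case: (j == i).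
          apply: measurable_funM; last exact: measurable_cst.
          by apply: measurableT_comp; [exact: measurable_funP|exact: measurable_snd].
        under eq_fun do rewrite mxE.
        apply: measurable_funM; last exact: measurable_cst.
        by apply: measurableT_comp; [exact: measurable_funP|exact: measurable_fst].
      exact: (measurable_fun_fubini_tonelli_F (m2 := P) _ mf (fun z => F0 _ _)).
    + by apply: measurable_F => j; apply: measurable_funM; [exact: measurable_funP|exact: measurable_cst].
    + by move=> w _; exact: column_domination.
  - apply: measurable_F => j; case: eqP => [_|/eqP ji].
      have := mZs (col i) i (subxx _) => h.
      by apply: (measurableT_comp h); exact: measurable_snd.
    have h := mZs (~: col i)%SET j; have cj : col j \subset (~: col i)%SET.
      by apply/fintype.subsetP => k kj; rewrite inE; exact: disj_col kj.
    by apply: (measurableT_comp (h cj)); exact: measurable_fst.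
have chain k : (k <= n)%N -> (\int[P]_w F 0 (xs w) <= \int[P]_w F k (xs w))%E.
  elim: k => [//|k IH kn]; apply: le_trans (IH (ltnW kn)) _.
  exact: (step (Ordinal kn)).
have := chain n (leqnn n).
have -> : (fun w => F 0 (xs w)) = (fun w => (u (xs w))%:E).
  apply/funext => w; rewrite /F.
  rewrite (eq_integral (fun=> (u (xs w))%:E)) => [|w' _]; last first.
    by congr ((u _)%:E); apply/rowP => j; rewrite mxE.
  by rewrite integral_cst//= probability_setT mule1.
have -> : (fun w => F n (xs w)) = (fun=> \int[Q]_w (u (rvec G w))%:E)%E.
  apply/funext => w; apply: eq_integral => w' _.
  by congr ((u _)%:E); apply/rowP => j; rewrite !mxE ltn_ord.
by rewrite integral_cst//= probability_setT mule1.
Qed.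

End column_comparison.

(** * Tails from exponential moments *)

Section exponential_tails.
Context d (T : measurableType d) (R : realType) (P : probability T R).

Lemma exp_markov (Z : T -> R) (r a c : R) : measurable_fun setT Z -> 0 < r ->
  (\int[P]_w (expR (r * Z w))%:E <= (expR c)%:E)%E ->
  (P [set w | (a <= Z w)%R] <= (expR (c - r * a))%:E)%E.
Proof.
move=> mZ r0 hc.
pose Z' : {RV P >-> R} := HB.pack_for {RV P >-> R} Z (isMeasurableFun.Build _ _ _ _ Z mZ).
apply: le_trans (chernoff Z' a r0) _.
rewrite expRD EFinM; apply: lee_wpmul2r; first by rewrite lee_fin expR_ge0.
rewrite /mmt_gen_fun expectation.unlock; apply: le_trans hc.
by rewrite le_eqVlt; apply/orP; left; apply/eqP; apply: eq_integral => w _ /=; rewrite mulrC.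
Qed.

Lemma subg_tail (Z : T -> R) (b t : R) : measurable_fun setT Z -> 0 < b -> 0 <= t ->
  (forall l : R, \int[P]_w (expR (l * Z w))%:E <= (expR (b * l ^+ 2))%:E)%E ->
  (P [set w | (t <= `|Z w|)%R] <= (2 * expR (- t ^+ 2 / (4 * b)))%:E)%E.
Proof.
move=> mZ b0 t0 mgfZ.
have mN : measurable_fun setT (fun w => - Z w) by exact: measurableT_comp.
have m1 (Y : T -> R) : measurable_fun setT Y -> measurable [set w | (t <= Y w)%R].
  move=> mY; rewrite -[X in measurable X]setTI.
  have -> : [set w | t <= Y w] = Y @^-1` `[t, +oo[%classic.
    by apply/seteqP; split => w /=; rewrite in_itv/= andbT.
  by apply: mY.
have mabs : measurable_fun setT (fun w => `|Z w|) by exact: measurableT_comp.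
have [tE|tn0] := eqVneq t 0.
  apply: le_trans (probability_le1 P (m1 _ mabs)) _.
  by rewrite tE expr0n/= oppr0 mul0r expR0 lee_fin; lra.
have {tn0 t0}t0 : 0 < t by rewrite lt_neqAle eq_sym tn0.
(* The minimizer of [b r^2 - r t]; it must be positive for Markov, so [t = 0] was settled by the
   bound 1 on probabilities. *)
pose r := t / (2 * b); have r0 : 0 < r by rewrite divr_gt0// mulr_gt0.
have rE : b * r ^+ 2 - r * t = - t ^+ 2 / (4 * b).
  by rewrite /r; field; rewrite gt_eqF.
have h1 := exp_markov t mZ r0 (mgfZ r).
have h2 : (P [set w | (t <= - Z w)%R] <= (expR (b * r ^+ 2 - r * t))%:E)%E.
  apply: (exp_markov t mN r0); have := mgfZ (- r); rewrite sqrrN.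
  by under eq_integral do rewrite mulNr -mulrN.
have -> : [set w | t <= `|Z w|] = [set w | t <= Z w] `|` [set w | t <= - Z w].
  apply/seteqP; split => w /=; rewrite ler_normr; first by move=> /orP.
  by move=> /orP.
apply: (le_trans (measureU2 P (m1 _ mZ) (m1 _ mN))).
have -> : 2 * expR (- t ^+ 2 / (4 * b)) = expR (- t ^+ 2 / (4 * b)) + expR (- t ^+ 2 / (4 * b)).
  by rewrite mulr_natl mulr2n.
by rewrite EFinD -rE leeD.
Qed.

End exponential_tails.

Section independent_mgf.
Context d (T : measurableType d) (R : realType) (P : probability T R).
Context (I : finType) (X : I -> {RV P >-> R}).
Hypothesis indX : mutually_independent X.
Context (H : finType) (idx : H -> I).
Hypothesis idx_inj : injective idx.

(** Induction on the list: uniqueness keeps the head outside the block of the tail, so the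
    exponential moments multiply. *)
Lemma mgf_indep_sum (c : H -> R) (b : R) (s : seq H) : uniq s ->
  (forall i, \int[P]_w (expR (c i * X (idx i) w))%:E <= (expR b)%:E)%E ->
  (\int[P]_w (expR (\sum_(i <- s) c i * X (idx i) w))%:E <= (expR (b *+ size s))%:E)%E.
Proof.
move=> us hc; elim: s us => [_|i s IH /= /andP[nis us]].
  under eq_integral do rewrite big_nil expR0.
  by rewrite integral_cst//= probability_setT mule1 mulr0n expR0.
pose J := [set idx i]%SET; pose J' := [set k in map idx s]%SET.
pose f (z : sub_space X J * sub_space X J') : \bar R :=
  ((expR (c i * X (idx i) z.1))%:E * (expR (\sum_(k <- s) c k * X (idx k) z.2))%:E)%E.
have mcX (k : H) d1 (T1 : measurableType d1) (g : T1 -> R) :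
  measurable_fun setT g -> measurable_fun setT (fun z => c k * g z) by exact: measurable_funM.
have -> : (\int[P]_w (expR (\sum_(k <- i :: s) c k * X (idx k) w))%:E =
    \int[P]_w f (w, w))%E.
  by apply: eq_integral => w _; rewrite big_cons expRD EFinM.
rewrite (indep_ge0_integral indX).
- have mS : measurable_fun setT (fun w => expR (\sum_(k <- s) c k * X (idx k) w)).
    by apply: measurableT_comp => //; apply: measurable_sum => k; exact: mcX.
  have -> : (fun w => \int[P]_w' f (w, w'))%E = (fun w => (expR (c i * X (idx i) w))%:E *
      \int[P]_w' (expR (\sum_(k <- s) c k * X (idx k) w'))%:E)%E.
    apply/funext => w; rewrite /f/= ge0_integralZl//.
    exact/measurable_EFinP.
  have mi : measurable_fun setT (fun w => expR (c i * X (idx i) w)).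
    by apply: measurableT_comp => //; exact: mcX.
  rewrite ge0_integralZr//; last 2 first.
  + exact/measurable_EFinP.
  + by apply: integral_ge0 => w _; rewrite lee_fin expR_ge0.
  rewrite mulrS expRD EFinM; apply: lee_pmul => //; last exact: IH.
  + by apply: integral_ge0 => w _; rewrite lee_fin expR_ge0.
  + by apply: integral_ge0 => w _; rewrite lee_fin expR_ge0.
- move=> k; rewrite !inE => /eqP ->; apply: contra nis => /mapP[j js /idx_inj ->//].
- apply: emeasurable_funM; apply/measurable_EFinP; apply: measurableT_comp => //.
    by apply: mcX; apply: measurable_coord_fst; rewrite inE.
  rewrite [X in measurable_fun _ X](_ : _ = fun z : sub_space X J * sub_space X J' =>
      \sum_(k <- s | k \in s) c k * X (idx k) z.2); last first.
    by apply/funext => z; rewrite big_seq.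
  under eq_fun do rewrite big_mkcond.
  apply: measurable_sum => k; case: (boolP (k \in s)) => ks; last exact: measurable_cst.
  by apply: mcX; apply: measurable_coord_snd; rewrite inE map_f.
- by move=> z; rewrite /f mule_ge0// lee_fin expR_ge0.
Qed.

End independent_mgf.

(** * Exponential moments of the width of the signed sum of rows *)

Section row_comparison.
Context d (T : measurableType d) (R : realType) (P : probability T R) (m n : nat).
Variables (A : 'I_m -> 'I_n -> {RV P >-> R}) (eps : 'I_m -> {RV P >-> R}).
Variables (mu : probability R R) (kappa : R).
Hypothesis indX : mutually_independent (measurement_family A eps).
Hypotheses (sym : symmetric_law mu) (var1 : (\int[mu]_t (t ^+ 2)%:E = 1)%E)
  (subg : subg_norm mu = kappa%:E)
  (lawA : forall i j B, measurable B -> distribution P (A i j) B = mu B).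
Hypothesis m0 : (0 < m)%N.

Lemma subg_norm_gt0 : 0 < kappa.
Proof.
have h := subg_sqr_ge subg var1; rewrite lt_neqAle (subg_norm_ge0 subg) andbT.
by apply/eqP => k0; move: h; rewrite -k0 expr0n/=; lra.
Qed.

Lemma rint_entry i j : rint P (A i j).
Proof. exact: (rint_law (lawA i j) (rint_id var1)). Qed.

Variable r : 'I_m -> R.
Hypothesis r1 : forall i, r i = 1 \/ r i = -1.

Definition signed_col (j : 'I_n) (w : T) : R := \sum_i (2 * r i) * A i j w.

Lemma rint_signed_col j : rint P (signed_col j).
Proof. by apply: rint_sum => i; apply: rintZ; exact: rint_entry. Qed.

HB.instance Definition _ j :=
  isMeasurableFun.Build _ _ _ _ (signed_col j) (rint_measurable (rint_signed_col j)).

Lemma integral_signed_col j : (\int[P]_w (signed_col j w)%:E = 0)%E.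
Proof.
rewrite -EFin_Rintegral; last exact: rint_signed_col.
rewrite /signed_col Rintegral_sumT => [|i]; last by apply: rintZ; exact: rint_entry.
rewrite big1// => i _; rewrite (RintegralZl _ _ (rint_entry i j))//.
rewrite (Rintegral_law (lawA i j) (f := fun t => t))//.
by rewrite (Rintegral_id sym var1) mulr0.
Qed.

Lemma mgf_signed_col j (l : R) :
  (\int[P]_w (expR (l * signed_col j w))%:E <= (expR (9 * m%:R * kappa ^+ 2 * l ^+ 2))%:E)%E.
Proof.
pose idx (i : 'I_m) : ('I_m * 'I_n) + 'I_m := inl (i, j).
have idx_inj : injective idx by move=> i i' [].
have := @mgf_indep_sum _ _ _ _ _ _ indX _ idx idx_inj (fun i => l * (2 * r i))
  (9 * (kappa * l) ^+ 2) (index_enum 'I_m) (index_enum_uniq _).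
have -> : size (index_enum 'I_m) = m by rewrite [index_enum _]unlock -enumT size_enum_ord.
have -> : (9 * (kappa * l) ^+ 2) *+ m = 9 * m%:R * kappa ^+ 2 * l ^+ 2.
  by rewrite -mulr_natr; ring.
have -> : (fun w => (expR (l * signed_col j w))%:E) =
    (fun w => (expR (\sum_i l * (2 * r i) * measurement_family A eps (idx i) w))%:E).
  apply/funext => w; rewrite /signed_col mulr_sumr; congr ((expR _)%:E).
  by apply: eq_bigr => i _; rewrite mulrA.
apply => i; rewrite (integral_law (lawA i j) (f := fun t => (expR (l * (2 * r i) * t))%:E)).
  apply: le_trans (subg_mgf subg sym _) _; rewrite lee_fin ler_expR.
  have r2 : r i ^+ 2 = 1 by have [->|->] := r1 i; rewrite ?sqrrN expr1n.
  have -> : 2 * (kappa * (l * (2 * r i))) ^+ 2 = 8 * (kappa * l) ^+ 2 * r i ^+ 2 by ring.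
  by rewrite r2 mulr1 ler_wpM2r ?sqr_ge0//; lra.
by apply/measurable_EFinP; apply: measurableT_comp => //; exact: measurable_funM.
Qed.

(** Each entry contributes [8 (kappa l)^2] to the exponent; this was rounded up to 9 so that the
    factor [4 * 9] in the tail is the square of 6. *)
Definition col_scale : R := 6 * kappa * Num.sqrt m%:R.

Lemma col_scale_gt0 : 0 < col_scale.
Proof.
apply: mulr_gt0; last by rewrite sqrtr_gt0 ltr0n.
by apply: mulr_gt0 => //; exact: subg_norm_gt0.
Qed.

Lemma signed_col_tail j (t : R) : 0 <= t ->
  (P [set w | (t <= `|signed_col j w|)%R] <= (2 * expR (- (t / col_scale) ^+ 2))%:E)%E.
Proof.
move=> t0; have k0 := subg_norm_gt0; have M0 : 0 < (m%:R : R) by rewrite ltr0n.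
have b0 : 0 < 9 * m%:R * kappa ^+ 2 by rewrite !mulr_gt0// exprn_gt0.
have := subg_tail (rint_measurable (rint_signed_col j)) b0 t0 (mgf_signed_col j).
suff -> : - t ^+ 2 / (4 * (9 * m%:R * kappa ^+ 2)) = - (t / col_scale) ^+ 2 by [].
rewrite exprMn exprVn mulNr; congr (- (_ * _^-1)).
rewrite /col_scale exprMn sqr_sqrtr; last exact: ltW.
by ring.
Qed.

Context d' (T' : measurableType d') (Q : probability T' R).
Variable G : 'I_n -> {RV Q >-> R}.
Hypothesis gaussG : std_gaussian_vector G.
Variables (K : set 'rV[R]_n) (W : R).
Hypotheses (K0 : K !=set0) (K1 : forall v, K v -> norm2 v <= 1).
Hypothesis widthK : mean_width G K = W%:E.

(** The scale of the columns times the dilation lost in the convex comparison. *)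
Definition noise_scale : R := 2 * domination_const * col_scale.

Lemma noise_scale_gt0 : 0 < noise_scale.
Proof.
have := @domination_const_ge1 R => h; apply: mulr_gt0; last exact: col_scale_gt0.
by apply: mulr_gt0 => //; lra.
Qed.

Lemma gauss_width_mgf (l : R) : 0 <= l ->
  (\int[Q]_w (exp_width K l (rvec G w))%:E <= (expR (l * W + 4 * l ^+ 2))%:E)%E.
Proof.
move=> l0.
have EW : (\int[Q]_w (width_fun K (rvec G w))%:E = W%:E)%E.
  by rewrite -widthK; apply: eq_integral => w _; rewrite ereal_sup_width.
apply: (gauss_concentration gaussG (borel_width K0 K1)) => //.
  exact: width_fun_lip.
apply: (@rint_ge0_lty _ _ _ _ _ W).
- exact: borel_width.
- by move=> w; exact: width_fun_ge0.
- by rewrite EW.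
Qed.

(** Coordinate [j] of the signed sum depends only on column [j] of the matrix, so the coordinates
    are independent. Positive homogeneity of the width moves [noise_scale] from the vector into the
    exponent. *)
Lemma signed_rows_width_mgf (l : R) : 0 <= l ->
  (\int[P]_w (exp_width K l (\sum_i (2 * r i) *: rvec (A i) w))%:E <=
   (expR (l * noise_scale * W + 4 * (l * noise_scale) ^+ 2))%:E)%E.
Proof.
move=> l0; have s0 := noise_scale_gt0.
have ls0 : 0 <= l * noise_scale by rewrite mulr_ge0// ltW.
apply: le_trans (gauss_width_mgf ls0).
pose col (j : 'I_n) : {set ('I_m * 'I_n) + 'I_m} :=
  [set k | match k with inl ij => ij.2 == j | inr _ => false end]%SET.
have disj j k i : j != k -> i \in col j -> i \notin col k.
  by move=> jk; rewrite !inE; case: i => // ij /eqP ->.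
have meas j (J : {set ('I_m * 'I_n) + 'I_m}) : col j \subset J ->
    measurable_fun setT (signed_col j : sub_space (measurement_family A eps) J -> R).
  move=> /fintype.subsetP jJ; apply: measurable_sum => i; apply: measurable_funM => //.
  apply: (@sub_space_coord _ _ _ _ _ (measurement_family A eps) J (inl (i, j))).
  by apply: jJ; rewrite inE/=.
have convex (a : R) v w : 0 <= a <= 1 -> exp_width K (l * noise_scale) (a *: v + (1 - a) *: w) <=
    a * exp_width K (l * noise_scale) v + (1 - a) * exp_width K (l * noise_scale) w.
  by move=> a01; exact: exp_width_convex.
have := gauss_domination gaussG indX disj meas col_scale_gt0 signed_col_tail rint_signed_col
  integral_signed_col (borel_exp_width K0 K1 _) (exp_width_ge0 K _) convex.
rewrite -/noise_scale; apply: le_trans; rewrite le_eqVlt; apply/orP; left; apply/eqP.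
apply: eq_integral => w _.
have -> : \sum_i (2 * r i) *: rvec (A i) w =
    noise_scale *: \row_j (signed_col j w / noise_scale).
  apply/rowP => j; rewrite summxE !mxE mulrC divfK ?gt_eqF//.
  by apply: eq_bigr => i _; rewrite !mxE.
by rewrite /exp_width (width_funZ K0 K1) ?(ltW s0)// mulrA.
Qed.

End row_comparison.

(** * Recovery *)

Lemma error_bound_large {R : realType} (delta2 e V B D : R) : 8^-1 < e -> 0 <= V ->
  0 <= B -> 1 <= D -> delta2 <= 2 ^+ 2 -> delta2 <= (300 * 300 * 300 + 2000 * D) * (e + V + B).
Proof.
move=> e0 V0 B0 D1 h; apply: (le_trans h).
have h1 : 8^-1 <= e + V + B by lra.
have D0 : 32 <= 300 * 300 * 300 + 2000 * D by lra.
have := @ler_pM _ 32 (300 * 300 * 300 + 2000 * D) 8^-1 (e + V + B).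
by rewrite invr_ge0 => /(_ _ _ D0 h1); lra.
Qed.

(** Multiplying by 32 gives the constants: [32 * 8 * 260^2 < 300^3] and
    [32 * 12 * 4 = 1536 < 2000]. *)
Lemma error_bound_small {R : realType} (delta2 e V B D : R) : 0 <= e -> 0 <= V ->
  0 <= B -> 1 <= D -> delta2 / 32 - 8 * (260 * 260 * e) <= 12 * D * (V + 4 * B) ->
  delta2 <= (300 * 300 * 300 + 2000 * D) * (e + V + B).
Proof.
move=> e0 V0 B0 D1 h; have D0 : 0 <= D by lra.
have h1 := mulr_ge0 D0 e0; have h2 := mulr_ge0 D0 V0; have h3 := mulr_ge0 D0 B0.
by lra.
Qed.

(** Since [del <= 64], the left side is at most [(8 * 65 + 2 * 64 * 512) e = 66056 e], and
    [260^2 = 67600]. *)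
Lemma orth_bound {R : realType} (e del : R) : 0 <= e -> e <= 8^-1 -> 0 <= del ->
  del <= 512 * e -> 8 * e * (1 + del) + 2 * del ^+ 2 <= 260 * 260 * e.
Proof.
move=> e0 e1 d0 d1; have d64 : del <= 64 by lra.
have h1 := ler_wpM2l e0 d64; have h2 := ler_wpM2l d0 d64.
by rewrite (expr2 del); lra.
Qed.

Section recovery.
Context d (T : measurableType d) (R : realType) (P : probability T R) (m n : nat).
Variables (A : 'I_m -> 'I_n -> {RV P >-> R}) (eps : 'I_m -> {RV P >-> R}).
Variables (mu : probability R R) (kappa p : R).
Hypothesis indX : mutually_independent (measurement_family A eps).
Hypotheses (sym : symmetric_law mu) (var1 : (\int[mu]_t (t ^+ 2)%:E = 1)%E)
  (subg : subg_norm mu = kappa%:E)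
  (lawA : forall i j B, measurable B -> distribution P (A i j) B = mu B).
Hypothesis m0 : (0 < m)%N.
Hypotheses (eps_pos : forall i, P (eps i @^-1` [set 1]) = (1 - p)%:E)
  (eps_neg : forall i, P (eps i @^-1` [set -1]) = p%:E).
Variable x : 'rV[R]_n.
Hypothesis x1 : norm2 x = 1.

Let entry_int i j : rint P (A i j).
Proof. exact: rint_entry var1 lawA i j. Qed.

Definition row_entry (i : 'I_m) (j : 'I_n) : ('I_m * 'I_n) + 'I_m := inl (i, j).

Lemma row_entry_inj i : injective (row_entry i).
Proof. by move=> j j' []. Qed.

Definition row_sign_vec (i : 'I_m) : 'rV[R]_n :=
  sign_vec (measurement_family A eps) (row_entry i) x.

Lemma measurable_eps_preimage (t : R) i : measurable (eps i @^-1` [set t]).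
Proof. by rewrite -[X in measurable X]setTI; exact: measurable_funP. Qed.

Lemma Rintegral_pm i : \int[P]_w pm (eps i w) = 1 - 2 * p.
Proof.
have mS := @measurable_eps_preimage 1 i.
have pmE w : pm (eps i w) = 2 * \1_(eps i @^-1` [set 1]) w - 1.
  rewrite /pm indicE; have [e1|/eqP e1] := eqVneq (eps i w) 1.
    by rewrite mem_set//=; lra.
  by rewrite memNset//=; lra.
under eq_Rintegral do rewrite pmE.
have i1 : rint P (\1_(eps i @^-1` [set 1]) : T -> R).
  apply: (@rint_bounded _ _ _ _ _ 1); first exact: measurable_indic.
  by move=> w; rewrite indicE; case: (_ \in _); rewrite ?normr0 ?normr1.
rewrite (RintegralB _ (rintZ 2 i1) (rint_cst _ _))// RintegralcstT (RintegralZl _ _ i1)//.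
have -> : \int[P]_w \1_(eps i @^-1` [set 1]) w = 1 - p.
  have h : (\int[P]_w (\1_(eps i @^-1` [set 1%R]) w)%:E = (1 - p)%:E)%E.
    by rewrite integral_indic// setIT; exact: eps_pos.
  by rewrite /Rintegral h.
by lra.
Qed.

(** The noise of row [i] is independent of all matrix entries, so its mean factors out. *)
Lemma mean_obs i : mean_rV P (obs A eps x i) = (1 - 2 * p) *: row_sign_vec i.
Proof.
apply/rowP => j; rewrite !mxE -(Rintegral_pm i).
pose f (w : T) : R := pm (eps i w).
pose g (w : T) : R := sgn (dotv (rvec (A i) w) x) * A i j w.
transitivity (\int[P]_w (f w * g w)).
  by apply: eq_Rintegral => w _; rewrite !mxE mulrA.
pose J := [set (inr i : ('I_m * 'I_n) + 'I_m)]%SET.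
pose J' := [set k : ('I_m * 'I_n) + 'I_m | if k is inl _ then true else false]%SET.
have dJ k : k \in J -> k \notin J' by rewrite !inE => /eqP ->.
have mf : measurable_fun setT (f : sub_space (measurement_family A eps) J -> R).
  apply: (measurableT_comp (@measurable_pm R)).
  by apply: (@sub_space_coord _ _ _ _ _ (measurement_family A eps) J (inr i)); rewrite inE.
have mA k : measurable_fun setT
    (A i k : sub_space (measurement_family A eps) J' -> R).
  by apply: (@sub_space_coord _ _ _ _ _ (measurement_family A eps) J' (inl (i, k))); rewrite inE.
have mgen d1 (T1 : measurableType d1) (phi : T1 -> T) :
    (forall k, measurable_fun setT (fun z => A i k (phi z))) ->
    measurable_fun setT (fun z => g (phi z)).
  move=> h; apply: measurable_funM => //; apply: (measurableT_comp measurable_sgn).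
  by apply: measurable_sum => k; under eq_fun do rewrite mxE; exact: measurable_funM.
have mg : measurable_fun setT (g : sub_space (measurement_family A eps) J' -> R).
  exact: (@mgen _ (sub_space (measurement_family A eps) J') id mA).
have gA w : `|g w| = `|A i j w|.
  by rewrite /g normrM; case: (sgn_cases (dotv (rvec (A i) w) x)) => ->;
    rewrite ?normrN normr1 mul1r.
have f1 w : `|f w| = 1.
  by rewrite /f; case: (pm_cases (eps i w)) => ->; rewrite ?normrN normr1.
have intf : rint P f.
  apply: (@rint_bounded _ _ _ _ _ 1); last by move=> w; rewrite f1.
  exact: (measurableT_comp (@measurable_pm R)).
have mgT : measurable_fun setT g by exact: (@mgen _ T id).
have intg : rint P g.
  apply: (@rint_le _ _ _ _ _ (fun w => `|A i j w|)) => //; first by move=> w; rewrite gA.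
  exact: integrable_norm (entry_int i j).
have intfg : rint P (fun w => f w * g w).
  apply: (@rint_le _ _ _ _ _ (fun w => `|A i j w|)); last exact: integrable_norm (entry_int i j).
    by apply: measurable_funM => //; exact: rint_measurable intf.
  by move=> w; rewrite normrM f1 gA mul1r.
exact: (indep_RintegralM indX dJ mf mg intf intg intfg).
Qed.

Let k0 : 0 < kappa.
Proof. exact: subg_norm_gt0 var1 subg. Qed.

Let kk : 2^-1 <= kappa ^+ 2.
Proof. exact: subg_sqr_ge subg var1. Qed.

Definition rho : R := Num.sqrt (normInf x).

Lemma coord_le_normInf (v : 'rV[R]_n) j : `|v ord0 j| <= normInf v.
Proof. by rewrite /normInf; apply: le_bigmax_cond. Qed.

Lemma normInf_ge0 (v : 'rV[R]_n) : 0 <= normInf v.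
Proof. by rewrite /normInf; exact: bigmax_ge_id. Qed.

Lemma normInf_gt0 : 0 < normInf x.
Proof.
rewrite lt_neqAle normInf_ge0 andbT; apply/eqP => h0.
have x0 j : x ord0 j = 0.
  by apply/eqP; rewrite -normr_le0 h0; exact: coord_le_normInf.
have : norm2 x ^+ 2 = 0.
  by rewrite sqr_norm2 /dotv big1// => j _; rewrite x0 mul0r.
by rewrite x1 expr1n; lra.
Qed.

Lemma rho_gt0 : 0 < rho.
Proof. by rewrite sqrtr_gt0 normInf_gt0. Qed.

Lemma sqr_rho : rho ^+ 2 = normInf x.
Proof. by rewrite sqr_sqrtr// normInf_ge0. Qed.

Section one_row.
Variable i : 'I_m.
Hypothesis small : kappa ^+ 3 * rho <= 8^-1.

Local Notation lam := (dotv (row_sign_vec i) x).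
Local Notation z := (row_sign_vec i - lam *: x).
Local Notation e := (kappa ^+ 3 * rho).
Let e0 : 0 < e. Proof. by rewrite mulr_gt0 ?exprn_gt0// rho_gt0. Qed.
Let k8 : 16^-1 <= kappa ^+ 8.
Proof.
have -> : 16^-1 = (2^-1 : R) ^+ 4 by field.
rewrite (exprM kappa 2 4) ler_pXn2r ?nnegrE ?sqr_ge0 ?invr_ge0//.
Qed.
Let M1 : 1 <= 16 * kappa ^+ 4.
Proof.
have : (2^-1 : R) ^+ 2 <= (kappa ^+ 2) ^+ 2 by rewrite ler_pXn2r ?nnegrE ?sqr_ge0 ?invr_ge0//.
by rewrite -exprM; lra.
Qed.
(** With [M = 16 kappa^4] the smallness condition reads [32 kappa^4 rho^4 <= 1/8]; as
    [kappa^8 >= 1/16], its left side is at most [512 e^4], which [e <= 1/8] makes at most 1/8. *)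
Lemma row_self_ge : 8^-1 <= lam.
Proof.
apply: (sign_vec_self_ge indX (@row_entry_inj i) sym var1 M1 (subg_moment4 subg)
  (lawA i) (coord_le_normInf x) x1).
rewrite -sqr_rho -exprM; pose y := kappa ^+ 4 * rho ^+ 4.
have -> : 2 * (16 * kappa ^+ 4) * rho ^+ (2 * 2) = 32 * y by rewrite /y; ring.
have y0 : 0 <= y by rewrite mulr_ge0 ?exprn_ge0// ltW// rho_gt0.
have he : e ^+ 4 <= 8^-1 ^+ 4 by rewrite ler_pXn2r ?nnegrE ?invr_ge0// ltW.
have ye : y * 16^-1 <= e ^+ 4.
  have <- : y * kappa ^+ 8 = e ^+ 4 by rewrite /y; ring.
  exact: (ler_wpM2l y0 k8).
have -> : 8^-1 = 32 * 16 * 8^-1 ^+ 4 :> R by field.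
by have := le_trans ye he; lra.
Qed.

(** Here the choice of [e] pays off: [del = 32 e / kappa^8 <= 512 e], the same order as the
    smoothing error. *)
Lemma row_orth_le : norm2 z ^+ 2 <= (260 * 260) * e.
Proof.
pose del := 2 * (16 * kappa ^+ 4) * normInf x ^+ 2 / e ^+ 3.
have := @sign_vec_orth _ _ _ _ _ _ _ _ indX (@row_entry_inj i) _ _ sym var1 M1
  (subg_moment4 subg) (lawA i) _ _ (coord_le_normInf x) x1 _ del e0 erefl => h.
have r0 := rho_gt0.
have delE : del * kappa ^+ 8 = 32 * e.
  rewrite /del -sqr_rho; field.
  by rewrite !gt_eqF.
have del0 : 0 <= del.
  by rewrite divr_ge0 ?exprn_ge0 ?(ltW e0)// !mulr_ge0 ?exprn_ge0// ?normInf_ge0// ltW.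
have := ler_wpM2l del0 k8; rewrite delE => hd.
have hd' : del <= 512 * e by lra.
exact: le_trans h (orth_bound (ltW e0) small del0 hd').
Qed.

(* Completing the square: [|z| D <= lam D^2 / 4 + |z|^2 / lam]. *)
Lemma row_sign_vec_gap xh : norm2 xh <= 1 ->
  norm2 (x - xh) ^+ 2 / 32 - 8 * ((260 * 260) * e) <= dotv (row_sign_vec i) (x - xh).
Proof.
move=> xh1; set h := x - xh; have hl := row_self_ge; have hz := row_orth_le.
have -> : dotv (row_sign_vec i) h = lam * dotv x h + dotv z h.
  by rewrite dotvBl dotvZl addrC subrK.
(* As [|x| = 1] and [|xh| <= 1], expanding gives [|h|^2 <= 2 - 2 <x, xh> = 2 <x, h>]. *)
have xx : norm2 h ^+ 2 / 2 <= dotv x h.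
  rewrite /h sqr_norm2B dotvBr -sqr_norm2 x1.
  have : norm2 xh ^+ 2 <= 1 by rewrite exprn_ile1 ?norm2_ge0.
  by lra.
have cz := cauchy_schwarz (- z) h; rewrite dotvNl norm2N in cz.
have h0 := norm2_ge0 h; have z0 := norm2_ge0 z.
set D := norm2 h in xx cz h0 *; set N := norm2 z in cz hz z0.
(* Gives [D N <= D^2 / 32 + 8 N^2], half of the [D^2 / 16] available from [lam >= 1/8]. *)
have sq := sqr_ge0 (D / 4 - 4 * N).
have := ler_wpM2r (sqr_ge0 D) hl.
have : lam * (D ^+ 2 / 2) <= lam * dotv x h by apply: ler_wpM2l xx; lra.
by nra.
Qed.

End one_row.

Context d' (T' : measurableType d') (Q : probability T' R).
Variable G : 'I_n -> {RV Q >-> R}.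
Hypothesis gaussG : std_gaussian_vector G.
Variables (K : set 'rV[R]_n) (W : R).
Hypotheses (K0 : K !=set0) (K1 : forall v, K v -> norm2 v <= 1).
Hypothesis widthK : mean_width G K = W%:E.

Definition noise_width (w : T) : R :=
  width_fun K (\sum_i (obs A eps x i w - mean_rV P (obs A eps x i))).

Lemma measurable_noise_width : measurable_fun setT noise_width.
Proof.
apply: (borel_rV_comp (borel_width K0 K1)) => j; under eq_fun do rewrite summxE.
apply: measurable_sum => i; under eq_fun do rewrite mxE.
apply: measurable_funD; last exact: measurable_cst.
exact: (rint_measurable (rint_obs eps x entry_int i j)).
Qed.

Lemma noise_width_mgf (l : R) : 0 <= l ->
  (\int[P]_w (expR (l * noise_width w))%:E <=
   (expR (l * noise_scale m kappa * W + 4 * (l * noise_scale m kappa) ^+ 2))%:E)%E.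
Proof.
move=> l0.
have [r [r1 hr]] := symmetrization_signs x indX entry_int (borel_exp_width K0 K1 l)
  (exp_width_ge0 K l) (fun N iN b => symmetrization_step K0 K1 l0 iN b) (leqnn m).
apply: le_trans hr _.
apply: le_trans (signed_rows_width_mgf indX sym var1 subg lawA m0 r1 gaussG K0 K1 widthK l0).
rewrite le_eqVlt; apply/orP; left; apply/eqP; apply: eq_integral => w _.
by congr ((exp_width K l _)%:E); apply: eq_bigr => i _; rewrite /hybrid ltn_ord.
Qed.

Lemma noise_width_tail (beta : R) : 0 < beta ->
  (P [set w | (noise_scale m kappa * (W + 4 * beta) <= noise_width w)%R] <=
   (expR (- beta ^+ 2))%:E)%E.
Proof.
move=> b0; have s0 := noise_scale_gt0 var1 subg m0.
(* With this choice the variance term contributes [beta^2] and the threshold [- 2 beta^2], while the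
   terms in [W] cancel. *)
pose l := beta / (2 * noise_scale m kappa).
have l0 : 0 < l by rewrite divr_gt0// mulr_gt0.
apply: le_trans (exp_markov _ measurable_noise_width l0 (noise_width_mgf (ltW l0))) _.
rewrite lee_fin ler_expR le_eqVlt; apply/orP; left; apply/eqP.
by rewrite /l; field; rewrite gt_eqF.
Qed.

(** Written as a cylinder so that the product rule yields its probability; on it [pm] does not
    change the noise. *)
Definition sign_event : set T :=
  \bigcap_(k in [set: ('I_m * 'I_n) + 'I_m]) (measurement_family A eps k @^-1`
    (if k is inr _ then [set 1; -1] else setT)).

Let measurable_signs (k : ('I_m * 'I_n) + 'I_m) :
  measurable (if k is inr _ then [set 1; -1] else setT : set R).
Proof. by case: k => // ?; apply: measurableU; exact: measurable_set1. Qed.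

Lemma measurable_sign_event : measurable sign_event.
Proof. by apply: cyl_measurable => k; exact: measurable_signs. Qed.

Lemma probability_sign_event : P sign_event = 1%E.
Proof.
rewrite /sign_event indX// big1// => -[ij|i] _.
  by rewrite preimage_setT probability_setT.
transitivity (fine (P (eps i @^-1` [set 1%R]) + P (eps i @^-1` [set (-1)%R]))%E).
  rewrite preimage_setU measureU//; [exact: measurable_eps_preimage..|].
  by apply/seteqP; split => // w [/= ->]; lra.
by rewrite eps_pos eps_neg -EFinD subrK.
Qed.

(** Pathwise: comparing the objective at [xh] and [x] shows that the centered sum of observations,
    tested against [xh - x] in [K - K], is at least the mean part. *)
Lemma maximizer_gap w xh : sign_event w -> K x -> K xh ->
  \sum_(i < m) eps i w * sgn (dotv (rvec (A i) w) x) * dotv (rvec (A i) w) x <=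
  \sum_(i < m) eps i w * sgn (dotv (rvec (A i) w) x) * dotv (rvec (A i) w) xh ->
  (1 - 2 * p) * \sum_i dotv (row_sign_vec i) (x - xh) <= noise_width w.
Proof.
move=> hw Kx Kxh.
have pmE i : pm (eps i w) = eps i w.
  have := hw (inr i) I; rewrite /pm => -[/= ->|/= ->]; first by rewrite eqxx.
  by case: eqP => // h; lra.
have objE v : \sum_(i < m) eps i w * sgn (dotv (rvec (A i) w) x) * dotv (rvec (A i) w) v =
    dotv (\sum_i obs A eps x i w) v.
  by rewrite dotv_suml; apply: eq_bigr => i _; rewrite /obs dotvZl pmE.
rewrite !objE => hmax.
have Kd : minkdiff K (xh - x) by exists xh, x.
apply: le_trans (dotv_le_width K1 _ Kd).
have -> : \sum_i (obs A eps x i w - mean_rV P (obs A eps x i)) =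
    \sum_i obs A eps x i w - (1 - 2 * p) *: \sum_i row_sign_vec i.
  by rewrite sumrB scaler_sumr; congr (_ - _); apply: eq_bigr => i _; rewrite mean_obs.
rewrite -dotv_suml dotvBl dotvZl !dotvBr; lra.
Qed.

Hypothesis p2 : p < 2^-1.

Lemma recovery_error (beta : R) w xh : 0 < beta -> 0 <= W ->
  sign_event w -> noise_width w < noise_scale m kappa * (W + 4 * beta) -> K x -> K xh ->
  \sum_(i < m) eps i w * sgn (dotv (rvec (A i) w) x) * dotv (rvec (A i) w) x <=
  \sum_(i < m) eps i w * sgn (dotv (rvec (A i) w) x) * dotv (rvec (A i) w) xh ->
  norm2 (x - xh) ^+ 2 <= (300 * 300 * 300 + 2000 * domination_const) *
    (kappa ^+ 3 * rho + kappa / (Num.sqrt m%:R * (1 - 2 * p)) * (W + beta)).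
Proof.
move=> b0 W0 hw hN Kx Kxh hmax; have p0 : 0 < 1 - 2 * p by have := p2; lra.
pose e := kappa ^+ 3 * rho.
have e0 : 0 <= e by rewrite mulr_ge0 ?exprn_ge0// ltW// rho_gt0.
pose s : R := Num.sqrt m%:R; have s0 : 0 < s by rewrite sqrtr_gt0 ltr0n.
pose q := kappa / (s * (1 - 2 * p)); have q0 : 0 < q by rewrite divr_gt0// mulr_gt0.
have D1 := @domination_const_ge1 R.
have V0 : 0 <= q * W by rewrite mulr_ge0// ltW.
have B0 : 0 <= q * beta by rewrite mulr_ge0// ltW.
rewrite [X in _ * (_ + X)]mulrDr addrA.
(* For large [e] the trivial bound [|x - xh|^2 <= 4] is already below the claimed one. *)
have [small|large] := leP e 8^-1; last first.
  have h2 : norm2 (x - xh) <= 2.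
    by have := ler_norm2D x (- xh); rewrite norm2N x1; have := K1 Kxh; lra.
  have h4 : norm2 (x - xh) ^+ 2 <= 2 ^+ 2.
    by rewrite ler_pXn2r ?nnegrE ?norm2_ge0.
  exact: error_bound_large large V0 B0 D1 h4.
apply: (error_bound_small e0 V0 B0 D1).
(* Multiplying by [(1 - 2 p) m], with [m = s^2], makes the right side the noise threshold, because
   [noise_scale] is [12 * domination_const * kappa * s]; the left side becomes a sum of identical
   lower bounds over the rows. *)
set X := _ / 32 - _; rewrite -(ler_pM2l (mulr_gt0 p0 (exprn_gt0 2 s0))).
have -> : (1 - 2 * p) * s ^+ 2 * (12 * domination_const * (q * W + 4 * (q * beta))) =
    noise_scale m kappa * (W + 4 * beta).
  by rewrite /noise_scale /col_scale -/s /q; field; rewrite !gt_eqF.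
apply: le_trans (ltW hN); apply: le_trans (maximizer_gap hw Kx Kxh hmax).
rewrite -mulrA ler_pM2l// sqr_sqrtr// mulr_natl -[m in X *+ m]card_ord -sumr_const.
by apply: ler_sum => i _; exact: row_sign_vec_gap (K1 Kxh).
Qed.

End recovery.

Theorem theorem1p1 (R : realType) :
  exists C : R, 0 < C /\
  forall (d : measure_display) (T : measurableType d) (P : probability T R)
    (n m : nat) (mu : probability R R) (kappa : R)
    (A : 'I_m -> 'I_n -> {RV P >-> R}) (eps : 'I_m -> {RV P >-> R})
    (p : R) (K : set 'rV[R]_n) (x : 'rV[R]_n) (beta : R)
    (d' : measure_display) (T' : measurableType d') (Q : probability T' R)
    (G : 'I_n -> {RV Q >-> R}),
    (0 < m)%N ->
    symmetric_law mu ->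
    (\int[mu]_t (t ^+ 2)%:E)%E = 1%E ->
    subg_norm mu = kappa%:E ->
    (forall i j B, measurable B -> distribution P (A i j) B = mu B) ->
    mutually_independent
      (fun k : ('I_m * 'I_n) + 'I_m =>
         match k with inl ij => A ij.1 ij.2 | inr i => eps i end) ->
    0 <= p < 2^-1 ->
    (forall i, P (eps i @^-1` [set 1]) = (1 - p)%:E) ->
    (forall i, P (eps i @^-1` [set -1]) = p%:E) ->
    (forall v, K v -> norm2 v <= 1) ->
    K x -> norm2 x = 1 ->
    0 < beta ->
    std_gaussian_vector G ->
    let y i w := eps i w * sgn (dotv (rvec (A i) w) x) in
    let obj w x' := \sum_(i < m) y i w * dotv (rvec (A i) w) x' in
    exists E : set T, measurable E /\
      ((1 - 4 * expR (- beta ^+ 2))%:E <= P E)%E /\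
      forall w, E w ->
      forall xh, K xh -> (forall x', K x' -> obj w x' <= obj w xh) ->
      (((norm2 (x - xh)) ^+ 2)%:E <=
        C%:E * ((kappa ^+ 3 * Num.sqrt (normInf x))%:E
                + (kappa / (Num.sqrt m%:R * (1 - 2 * p)))%:E
                  * (mean_width G K + beta%:E)))%E.
Proof.
have D1 := @domination_const_ge1 R.
have C0 : 0 < 300 * 300 * 300 + 2000 * domination_const :> R by lra.
exists (300 * 300 * 300 + 2000 * domination_const); split; first exact: C0.
move=> d T P n m mu kappa A eps p K x beta d' T' Q G m0 sym var1 subg lawA indX p01
  eps_pos eps_neg K1 Kx x1 b0 gaussG y obj.
have /andP[p0 p2] := p01; have K0 : K !=set0 by exists x.
have k0 : 0 < kappa := subg_norm_gt0 var1 subg.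
have pp : 0 < 1 - 2 * p by lra.
have q0 : 0 < kappa / (Num.sqrt m%:R * (1 - 2 * p)).
  by rewrite divr_gt0// mulr_gt0// sqrtr_gt0 ltr0n.
have width_ge0 : (0 <= mean_width G K)%E.
  apply: integral_ge0 => w _.
  by rewrite (ereal_sup_width K0 K1) lee_fin (width_fun_ge0 K0 K1).
(* The excluded event has probability at most [exp (- beta^2)], which leaves room in the stated
   factor 4. *)
have prob_ge : (1 - 4 * expR (- beta ^+ 2) <= 1 - expR (- beta ^+ 2) :> R).
  by have := expR_gt0 (- beta ^+ 2); lra.
(* An infinite width makes the right-hand side infinite, so the whole space serves as the event;
   otherwise the width is a real number [W]. *)
have [widthK|widthK] := eqVneq (mean_width G K) +oo%E.
  exists setT; split; first exact: measurableT.
  split.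
    rewrite probability_setT lee_fin; apply: le_trans prob_ge _.
    by have := expR_gt0 (- beta ^+ 2); lra.
  move=> w _ xh _ _; rewrite widthK addye// gt0_muley ?lte_fin//.
  by rewrite addey// gt0_muley ?lte_fin// leey.
pose W := fine (mean_width G K).
have WE : mean_width G K = W%:E by rewrite fineK// ge0_fin_numE// ltey.
have W0 : 0 <= W by rewrite -lee_fin -WE.
have indX' : mutually_independent (measurement_family A eps) := indX.
pose noise := noise_width A eps x K.
pose bad := [set w | noise_scale m kappa * (W + 4 * beta) <= noise w].
have mbad : measurable bad.
  rewrite -[X in measurable X]setTI.
  have -> : bad = noise @^-1` `[noise_scale m kappa * (W + 4 * beta), +oo[%classic.
    by apply/seteqP; split => w /=; rewrite in_itv/= andbT.
  by apply: (measurable_noise_width eps var1 lawA x K0 K1).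
have msign := measurable_sign_event A eps.
exists (sign_event A eps `&` ~` bad); split.
  by apply: measurableI => //; exact: measurableC.
split; last first.
  move=> w [hw /negP]; rewrite -ltNge => hN xh Kxh hmax.
  have := recovery_error indX' sym var1 subg lawA m0 eps_pos x1 K1 p2 b0 W0
    hw hN Kx Kxh (hmax x Kx).
  by rewrite WE -lee_fin.
have mE : measurable (~` sign_event A eps `|` bad).
  by apply: measurableU => //; exact: measurableC.
have -> : (P (sign_event A eps `&` ~` bad) = 1 - P (~` sign_event A eps `|` bad))%E.
  by rewrite -(probability_setC P mE) setCU setCK.
have : (P (~` sign_event A eps `|` bad) <= (expR (- beta ^+ 2))%:E)%E.
  have sign0 : (P (~` sign_event A eps) = 0)%E.
    by rewrite (probability_setC P msign) (probability_sign_event indX' eps_pos eps_neg) subee.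
  have := noise_width_tail indX' sym var1 subg lawA m0 x gaussG K0 K1 WE b0.
  apply: le_trans; rewrite -[leRHS]add0e -sign0; apply: measureU2 => //.
  exact: measurableC.
move=> h; apply: (@le_trans _ _ (1 - (expR (- beta ^+ 2))%:E)%E).
  by rewrite -EFinB lee_fin.
exact: leeB.
Qed.
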